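(* Let $\alpha>0$ and $\sigma>0$. For $u\in H^2_{\mathcal N,\mathrm{rad}}(B)$ set $F(u)=\int_B |x|^\alpha e^{\sigma u^2}\,dx$. Then $$T^{\mathrm{rad}}_\alpha:=\sup\left\{F(u): u\in H^2_{\mathcal N,\mathrm{rad}}(B),\ \|\Delta u\|_2=1\right\}<+\infty \quad\Longleftrightarrow\quad \sigma\le 32\pi^2\left(1+\frac{\alpha}{4}\right).$$
   Context: $B\subset\mathbb R^4$ is the open unit ball centered at the origin. $H^2_{\mathcal N}(B)=H^1_0(B)\cap H^2(B)$ (real-valued functions), and $H^2_{\mathcal N,\mathrm{rad}}(B)$ is its subspace of radially symmetric functions. $\|\cdot\|_2$ is the norm of $L^2(B)$. *)

(* Defs.v *)
From mathcomp Require Import all_boot all_order all_algebra.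
From mathcomp Require Import all_classical all_reals all_analysis.

Set Implicit Arguments.
Unset Strict Implicit.
Unset Printing Implicit Defensive.

Import Order.TTheory GRing.Theory Num.Theory.
Import numFieldNormedType.Exports.

Local Open Scope classical_set_scope.
Local Open Scope ring_scope.

(* The library norm on this product is the max norm; it is used only for its
   topology, and the Euclidean norm is [enorm] below. *)
Notation R4 R := (R * R * R * R)%type.

Section Space.
Context {R : realType}.

(* The product of the Borel sigma-algebras. *)
Definition measurableTypeR4 : measurableType _ :=
  (measurableTypeR R * measurableTypeR R * measurableTypeR R *
   measurableTypeR R)%type.

Definition lebesgue4 : {measure set measurableTypeR4 -> \bar R} :=
  ((@lebesgue_measure R) \x (@lebesgue_measure R) \x
   (@lebesgue_measure R) \x (@lebesgue_measure R))%E.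

Definition enorm (x : R4 R) : R :=
  Num.sqrt (x.1.1.1 ^+ 2 + x.1.1.2 ^+ 2 + x.1.2 ^+ 2 + x.2 ^+ 2).

Definition unit_ball : set (R4 R) := [set x | enorm x < 1].

Definition basis4 (i : 'I_4) : R4 R :=
  ((i == 0%N :> nat)%:R, (i == 1%N :> nat)%:R,
   (i == 2%N :> nat)%:R, (i == 3%N :> nat)%:R).

Definition partial (i : 'I_4) (f : R4 R -> R) : R4 R -> R :=
  fun x => 'D_(basis4 i) f x.

(* A list of indices plays the role of a multi-index: its length is the order
   of differentiation. *)
Definition partials (s : seq 'I_4) (f : R4 R -> R) : R4 R -> R :=
  foldr partial f s.

Definition smooth (f : R4 R -> R) : Prop :=
  forall s : seq 'I_4, continuous (partials s f) /\
    forall (i : 'I_4) (x : R4 R), derivable (partials s f) x (basis4 i).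

Definition test_function (f : R4 R -> R) : Prop :=
  let supp := closure [set x | f x != 0] in
  [/\ smooth f, compact supp & supp `<=` unit_ball].

(* Functions on the ball are total functions whose values outside the ball
   are irrelevant; elements of function spaces are represented by
   functions, not by classes modulo almost everywhere equality. *)
Definition L2 (u : R4 R -> R) : Prop := u \_ unit_ball \in Lfun lebesgue4 2%:E.

Definition norm2 (u : R4 R -> R) : \bar R :=
  'N[lebesgue4]_2%:E[EFin \o (u \_ unit_ball)].

Definition weak_derivative (s : seq 'I_4) (u g : R4 R -> R) : Prop :=
  forall phi, test_function phi ->
    \int[lebesgue4]_(x in unit_ball) (u x * partials s phi x) =
    (-1) ^+ size s * \int[lebesgue4]_(x in unit_ball) (g x * phi x).

Definition sobolev (k : nat) (u : R4 R -> R) : Prop :=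
  L2 u /\ forall s : seq 'I_4, (size s <= k)%N ->
    exists2 g, L2 g & weak_derivative s u g.

(* Closure of the test functions in the H^1 norm. *)
Definition sobolev10 (u : R4 R -> R) : Prop :=
  L2 u /\ exists g : 'I_4 -> R4 R -> R,
    (forall i, L2 (g i) /\ weak_derivative [:: i] u (g i)) /\
    exists phi : nat -> R4 R -> R,
      [/\ forall n, test_function (phi n),
          norm2 (u \- phi n) @[n --> \oo] --> 0%E &
          forall i, norm2 (g i \- partial i (phi n)) @[n --> \oo] --> 0%E].

Definition laplacian (u w : R4 R -> R) : Prop :=
  exists h : 'I_4 -> R4 R -> R,
    (forall i, L2 (h i) /\ weak_derivative [:: i; i] u (h i)) /\
    w = (fun x => \sum_i h i x).

Definition radial (u : R4 R -> R) : Prop :=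
  exists v : R -> R,
    {ae lebesgue4, forall x, unit_ball x -> u x = v (enorm x)}.

Definition H2N : set (R4 R -> R) := [set u | sobolev10 u /\ sobolev 2 u].

Definition H2Nrad : set (R4 R -> R) := [set u | H2N u /\ radial u].

Definition adams_functional (alpha sigma : R) (u : R4 R -> R) : \bar R :=
  \int[lebesgue4]_(x in unit_ball)
    (enorm x `^ alpha * expR (sigma * u x ^+ 2))%:E.

(* The Laplacian is determined up to almost everywhere equality, so any choice
   of [w] gives the same norm. *)
Definition Trad (alpha sigma : R) : \bar R :=
  ereal_sup [set adams_functional alpha sigma u | u in
    [set u | H2Nrad u /\ exists2 w, laplacian u w & norm2 w = 1%E]].

End Space.

(* Main.v *)
(* Put [q = |x|^4]; radial functions are integrated against [(pi^2 / 2) dq].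
   Testing the weak Laplacian [w] of a radial [u] of profile [U] against
   primitives of smooth steps gives the Green bound
     [4 pi^2 |U(a)| <= int_B |w| / max (|x|^2, sqrt a)]
   for almost every [a] in [(0, 1)]. Put [t = - ln a / 4] and let [L] be the
   integral of [w^2] over [q < a]. Cauchy-Schwarz inside and outside [q < a]
   gives [8 pi^2 U(a)^2 <= (y + sqrt L / 2)^2] with [y <= sqrt (1 - L) sqrt t].
   The defect [t - (y + sqrt L / 2)^2] is at least [-1/4], and, as in Moser's
   argument, the set where it is at most [n] lies in two windows of the variable
   [t] of length [O(n)]. Hence [int exp (- b defect) dt] is bounded uniformly in
   [w] for [b = 4 + alpha], which is the claim for [sigma = 8 pi^2 b].
   For sharpness, the profiles [int_q^1 chi(s) / (A + s) ds] with a cutoff [chi]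
   have squared Laplacian norm at most [32 pi^2 ln (1/A) + O(1)] and are at least
   [ln (1/A) - O(1)] on [q <= A]; let [A] tend to [0]. *)

(* Only square-integrable weak derivatives are available, so the profile of [u] is never
   differentiated: the Laplacian is tested against explicit radial potentials, and values of the
   profile are recovered at Lebesgue points. Zero boundary values act through the approximation by
   test functions, which allows integration by parts against fields that do not vanish on the
   sphere; this disposes of the boundary layer created by cutting off the potentials. In the
   variable [t] the measure and the weight contribute [exp (- (4 + alpha) t)], so the bound
   [8 pi^2 U^2 <= t + 1/4] alone would leave a constant to integrate over a half-line at the
   critical exponent. The way out is that the bound cannot be nearly sharp at two distant radii: if
   it is nearly sharp at a large [s], little of the squared Laplacian is left inside that radius,
   and a fixed fraction of any further increase of [t] must be lost in the defect. *)
Require Import Defs.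
From HB Require Import structures.
From mathcomp Require Import all_boot all_order all_algebra.
From mathcomp Require Import all_classical all_reals all_analysis.
From mathcomp Require Import measurable_realfun.
From mathcomp Require Import ring lra.

Set Implicit Arguments.
Unset Strict Implicit.
Unset Printing Implicit Defensive.

Import Order.TTheory GRing.Theory Num.Theory.
Import numFieldNormedType.Exports.

Local Open Scope classical_set_scope.
Local Open Scope ring_scope.

(** * Lebesgue measure on R^4 *)

Section SigmaFiniteProduct.
Context d1 d2 (T1 : measurableType d1) (T2 : measurableType d2) (R : realType).
Variable m1 : {sigma_finite_measure set T1 -> \bar R}.
Variable m2 : {sigma_finite_measure set T2 -> \bar R}.
Local Open Scope ereal_scope.
Lemma product_measure_sigma_finite : sigma_finite setT (m1 \x m2).
Proof.
have /sigma_finiteP[F [TF ndF Foo]] := sigma_finiteT m1.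
have /sigma_finiteP[G [TG ndG Goo]] := sigma_finiteT m2.
exists (fun n => F n `*` G n).
  rewrite -setXTT TF TG; apply/seteqP; split => [[x y]|[x y] [n _ []/= ? ?]]; last by split; exists n.
  move=> [/= [n _ Fnx] [k _ Gky]]; exists (maxn n k) => //; split.
  - by move: x Fnx; exact/subsetPset/ndF/leq_maxl.
  - by move: y Gky; exact/subsetPset/ndG/leq_maxr.
move=> k; have [? ?] := Foo k; have [? ?] := Goo k.
split; first exact: measurableX.
by rewrite product_measure1E// lte_mul_pinfty// ge0_fin_numE.
Qed.

(* On [m1 \x m2] itself the library's instance for subprobabilities shadows
   the sigma-finite one. *)
Definition sigma_product : set (T1 * T2) -> \bar R := (m1 \x m2).
HB.instance Definition _ := Measure.on sigma_product.
HB.instance Definition _ := Measure_isSigmaFinite.Build _ _ _ sigma_product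
  product_measure_sigma_finite.
End SigmaFiniteProduct.

Section ProductScaling.
Local Open Scope ereal_scope.
Context d1 d2 (T1 : measurableType d1) (T2 : measurableType d2) (R : realType).
Variable m1 : {sigma_finite_measure set T1 -> \bar R}.
Variable m2 : {sigma_finite_measure set T2 -> \bar R}.

(** By uniqueness of the product measure it is enough to compare both sides on rectangles. Iterated
    three times, this lifts the affine change of variables from the line to four dimensions. *)
Lemma preimage_product_measure (f1 : T1 -> T1) (f2 : T2 -> T2) (c1 c2 : R) :
  measurable_fun setT f1 -> measurable_fun setT f2 ->
  (0 < c1)%R -> (0 < c2)%R ->
  (forall A, measurable A -> m1 A = c1%:E * m1 (f1 @^-1` A)) ->
  (forall A, measurable A -> m2 A = c2%:E * m2 (f2 @^-1` A)) ->
  forall X, measurable X ->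
  (m1 \x m2) X = (c1 * c2)%:E * (m1 \x m2) ((fun x => (f1 x.1, f2 x.2)) @^-1` X).
Proof.
move=> mf1 mf2 c10 c20 H1 H2 X mX.
have mf : measurable_fun setT (fun x : T1 * T2 => (f1 x.1, f2 x.2)).
  by apply: measurable_fun_pair; exact: measurableT_comp.
pose c := NngNum (ltW (mulr_gt0 c10 c20)).
pose mu : {measure set (T1 * T2) -> \bar R} := mscale c (pushforward (m1 \x m2) (fun x =>
    (f1 x.1, f2 x.2))).
rewrite (product_measure_unique (m' := mu mf))// => A B mA mB.
rewrite /mu /= /mscale /= /pushforward.
rewrite (_ : _ @^-1` (A `*` B) = (f1 @^-1` A) `*` (f2 @^-1` B))//.
rewrite product_measure1E; last 2 first.
- by rewrite -[X in measurable X]setTI; exact: mf1.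
- by rewrite -[X in measurable X]setTI; exact: mf2.
rewrite H1// (H2 B)// EFinM !muleA; congr (_ * _).
by rewrite -!muleA; congr (_ * _); rewrite muleC.
Qed.

End ProductScaling.

Notation measurable4 R D f := (@measurable_fun _ _ (@measurableTypeR4 R) _ D f).

Section Affine.
Context {R : realType}.
Local Notation mu := (@lebesgue_measure R).

Lemma measurable_affine (r h : R) :
  measurable_fun setT (fun x : measurableTypeR R => (r * x + h) : measurableTypeR R).
Proof. apply: measurable_funD => //; exact: measurable_funM. Qed.

Lemma lebesgue_measure_affine (r h : R) : 0 < r -> forall A, measurable A ->
  (mu A = r%:E * mu ((fun x => (r * x + h)%R) @^-1` A))%E.
Proof.
move=> r0.
pose c := NngNum (ltW r0).
pose m : {measure set (measurableTypeR R) -> \bar R} :=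
    mscale c (pushforward mu (fun x : measurableTypeR R => (r * x + h) : measurableTypeR R)).
move=> A mA; rewrite (lebesgue_measure_unique (mu := m (measurable_affine r h)))// => X [[a b]/= _ <-].
rewrite /m /= /mscale /= /pushforward.
rewrite (_ : _ @^-1` _ = `](a - h) / r, (b - h) / r]%classic); last first.
  apply/seteqP; split => x /=; rewrite !in_itv/= ltr_pdivrMr// ler_pdivlMr// ltrBlDr lerBrDr (mulrC x)//.
rewrite !lebesgue_measure_itv/= !lte_fin ltr_pM2r ?invr_gt0// ltrD2r.
case: ifP => _; rewrite ?mule0//.
rewrite -!EFinD -EFinM; congr EFin; field; exact: lt0r_neq0.
Qed.

Let lebesgue2 : {sigma_finite_measure set (measurableTypeR R * measurableTypeR R)%type ->
    \bar R} := sigma_product mu mu.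
Let lebesgue3 : {sigma_finite_measure set (measurableTypeR R * measurableTypeR R *
    measurableTypeR R)%type -> \bar R} := sigma_product lebesgue2 mu.

Definition sigma_lebesgue4 : {sigma_finite_measure set (@measurableTypeR4 R) -> \bar R} :=
  sigma_product lebesgue3 mu.

Lemma lebesgue4E (A : set (@measurableTypeR4 R)) : lebesgue4 A = sigma_lebesgue4 A.
Proof. by []. Qed.

Lemma lebesgue4X (A B C D : set (measurableTypeR R)) :
  measurable A -> measurable B -> measurable C -> measurable D ->
  (lebesgue4 (A `*` B `*` C `*` D) = mu A * mu B * mu C * mu D)%E.
Proof.
move=> mA mB mC mD; have m2 : measurable (A `*` B) by exact: measurableX.
have m3 : measurable (A `*` B `*` C) by exact: measurableX.
rewrite lebesgue4E.
transitivity (lebesgue3 (A `*` B `*` C) * mu D)%E.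
  exact: (product_measure1E lebesgue3 mu m3 mD).
congr (_ * _)%E; transitivity (lebesgue2 (A `*` B) * mu C)%E.
  exact: (product_measure1E lebesgue2 mu m2 mC).
by congr (_ * _)%E; exact: (product_measure1E mu mu mA mB).
Qed.

(** Serves the four-dimensional Gaussian integral, from which the volume of the unit ball is
    deduced. *)
Lemma ge0_integral_lebesgue4_prod (f g h k : R -> R) :
  measurable_fun setT f -> measurable_fun setT g -> measurable_fun setT h -> measurable_fun setT k ->
  (forall x, 0 <= f x) -> (forall x, 0 <= g x) -> (forall x, 0 <= h x) -> (forall x, 0 <= k x) ->
  (\int[lebesgue4]_x (f x.1.1.1 * g x.1.1.2 * h x.1.2 * k x.2)%:E =
   \int[mu]_x (f x)%:E * \int[mu]_x (g x)%:E * \int[mu]_x (h x)%:E * \int[mu]_x (k x)%:E)%E.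
Proof.
move=> mf mg mh mk f0 g0 h0 k0.
have prod d (T : measurableType d) (m : {sigma_finite_measure set T -> \bar R}) (F : T ->
    R) (G : R -> R) :
   measurable_fun setT F -> measurable_fun setT G -> (forall x, 0 <= F x) -> (forall x, 0 <= G x) ->
   (\int[(m \x mu)%E]_z (F z.1 * G z.2)%:E = \int[m]_x (F x)%:E * \int[mu]_y (G y)%:E)%E.
  move=> mF mG F0 G0; rewrite fubini_tonelli1; last 2 first.
  - apply/measurable_EFinP; apply: measurable_funM; exact: measurableT_comp.
  - by move=> x; rewrite lee_fin mulr_ge0.
  rewrite -ge0_integralZr//; last 3 first.
  - exact/measurable_EFinP.
  - by move=> x _; rewrite lee_fin.
  - by apply: integral_ge0 => y _; rewrite lee_fin.
  apply: eq_integral => x _; rewrite /fubini_F /=.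
  under eq_integral do rewrite EFinM.
  rewrite ge0_integralZl//; [exact/measurable_EFinP|by move=> y _; rewrite lee_fin|by rewrite lee_fin].
have mfg : measurable_fun setT (fun z : measurableTypeR R * measurableTypeR R => f z.1 * g z.2).
  apply: measurable_funM; exact: measurableT_comp.
have mfgh : measurable_fun setT (fun z : measurableTypeR R * measurableTypeR R *
    measurableTypeR R => f z.1.1 * g z.1.2 * h z.2).
  apply: measurable_funM; last exact: measurableT_comp.
  exact: (measurableT_comp mfg measurable_fst).
have p1 := prod _ _ mu f g mf mg f0 g0.
have p2 := prod _ _ lebesgue2 _ h mfg mh (fun x => mulr_ge0 (f0 _) (g0 _)) h0.
have p3 := prod _ _ lebesgue3 _ k mfgh mk (fun x => mulr_ge0 (mulr_ge0 (f0 _) (g0 _)) (h0 _)) k0.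
rewrite -p1 -p2 -p3 //.
Qed.

Definition affine4 (r : R) (h : R4 R) : R4 R -> R4 R := fun x =>
 (r * x.1.1.1 + h.1.1.1, r * x.1.1.2 + h.1.1.2, r * x.1.2 + h.1.2, r * x.2 + h.2).

Lemma measurable_affine4 r h : measurable_fun setT (affine4 r h : @measurableTypeR4 R ->
    @measurableTypeR4 R).
Proof.
apply: measurable_fun_pair; last first.
  exact: (measurableT_comp (measurable_affine r h.2)).
apply: measurable_fun_pair; last first.
  exact: (measurableT_comp (measurable_affine r h.1.2) (measurableT_comp _ _)).
apply: measurable_fun_pair.
  exact: (measurableT_comp (measurable_affine r h.1.1.1) (measurableT_comp measurable_fst
      (measurableT_comp measurable_fst measurable_fst))).
  exact: (measurableT_comp (measurable_affine r h.1.1.2) (measurableT_comp measurable_snd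
      (measurableT_comp measurable_fst measurable_fst))).
Qed.

Lemma lebesgue4_affine (r : R) (h : R4 R) : 0 < r -> forall A, measurable A ->
  (lebesgue4 A = (r ^+ 4)%:E * lebesgue4 (affine4 r h @^-1` A))%E.
Proof.
move=> r0 A mA.
have -> : r ^+ 4 = r * r * r * r by ring.
have m1 := measurable_affine r.
have m2 (h1 h2 : R) : measurable_fun setT (fun x : (measurableTypeR R * measurableTypeR R)%type =>
   ((r * x.1 + h1, r * x.2 + h2) : (measurableTypeR R * measurableTypeR R)%type)).
  by apply: measurable_fun_pair; exact: (measurableT_comp (m1 _)).
have m3 (h1 h2 h3 : R) : measurable_fun setT (fun x : (measurableTypeR R * measurableTypeR R *
    measurableTypeR R)%type =>
   ((r * x.1.1 + h1, r * x.1.2 + h2, r * x.2 + h3) : (measurableTypeR R *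
       measurableTypeR R* measurableTypeR R)%type)).
  apply: measurable_fun_pair; last exact: (measurableT_comp (m1 _)).
  exact: (measurableT_comp (m2 _ _) measurable_fst).
have r2 : 0 < r * r by exact: mulr_gt0.
have r3 : 0 < r * r * r by exact: mulr_gt0.
have L h0 := @lebesgue_measure_affine r h0 r0.
have H2 := @preimage_product_measure _ _ _ _ R mu mu _ _ r r (m1 h.1.1.1) (m1 h.1.1.2) r0 r0 (L _) (L _).
have H3 := @preimage_product_measure _ _ _ _ R lebesgue2 mu _ _ (r *
    r) r (m2 h.1.1.1 h.1.1.2) (m1 h.1.2) r2 r0 H2 (L _).
exact: (@preimage_product_measure _ _ _ _ R lebesgue3 mu _ _ (r * r *
    r) r (m3 h.1.1.1 h.1.1.2 h.1.2) (m1 h.2) r3 r0 H3 (L _)).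
Qed.

Lemma ge0_integral_affine4 (r : R) (h : R4 R) (f : R4 R -> \bar R) : 0 < r ->
  measurable4 R setT f -> (forall x, (0 <= f x)%E) ->
  (\int[lebesgue4]_x f x = (r ^+ 4)%:E * \int[lebesgue4]_x f (affine4 r h x))%E.
Proof.
move=> r0 mf f0.
have mF := measurable_affine4 r h.
have rr : 0 < r ^+ 4 by exact: exprn_gt0.
pose m : {measure set (@measurableTypeR4 R) -> \bar R} :=
    mscale (NngNum (ltW rr)) (pushforward lebesgue4 (affine4 r h : @measurableTypeR4 R ->
    @measurableTypeR4 R)).
rewrite (eq_measure_integral (m mF)); last first.
  by move=> A mA _; exact: lebesgue4_affine.
pose pm : {measure set (@measurableTypeR4 R) -> \bar R} :=
    pushforward lebesgue4 (affine4 r h : @measurableTypeR4 R -> @measurableTypeR4 R).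
transitivity ((r ^+ 4)%:E * \int[pm mF]_x f x)%E.
  exact: (ge0_integral_mscale (pm mF) measurableT (NngNum (ltW rr)) mf (fun x _ => f0 x)).
have -> := ge0_integral_pushforward mF lebesgue4 measurableT mf (fun x _ => f0 x).
by rewrite preimage_setT.
Qed.

End Affine.

(* Otherwise unification unfolds the iterated product measure. *)
Opaque lebesgue4.

(** * Radial integration *)

Section OpenMeasurable.
Context {R : realType}.

(** The sigma-algebra is a product of Borel ones, the topology that of the product space. They are
    linked by writing an open set as the countable union of the boxes with rational centres and
    radii [1 / (n + 1)] that it contains. *)
Lemma open_measurable4 (O : set (R4 R)) : open O -> measurable (O : set (@measurableTypeR4 R)).
Proof.
move=> oO.
pose B (i : rat * rat * rat * rat * nat) : set (@measurableTypeR4 R) :=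
  ball (ratr i.1.1.1.1 : R) i.2.+1%:R^-1 `*` ball (ratr i.1.1.1.2 : R) i.2.+1%:R^-1 `*`
  ball (ratr i.1.1.2 : R) i.2.+1%:R^-1 `*` ball (ratr i.1.2 : R) i.2.+1%:R^-1.
pose F i := if pselect (B i `<=` O) then B i else set0.
have -> : O = \bigcup_i F i.
  apply/seteqP; split => [x Ox|x [i _]]; last first.
    by rewrite /F; case: pselect => // BO /BO.
  have /nbhs_ballP[e /= e0 eO] : nbhs x O by exact: open_nbhs_nbhs.
  have [n ne] : exists n, n.+1%:R^-1 < e / 2.
    have := @near_infty_natSinv_lt R (PosNum (divr_gt0 e0 (ltr0Sn _ 1))).
    by move=> [n _ /(_ n) /= H]; exists n; apply: H => /=.
  have N0 : 0 < n.+1%:R^-1 :> R by rewrite invr_gt0.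
  have rat_near (a : R) : exists p : rat, ball (ratr p : R) n.+1%:R^-1 a.
    have [|p] := @rat_in_itvoo R (a - n.+1%:R^-1) (a + n.+1%:R^-1).
      by rewrite ltrBlDr -addrA ltrDl addr_gt0.
    by rewrite in_itv/= => H; exists p; rewrite /ball/= ltr_distl.
  have [p1 H1] := rat_near x.1.1.1.
  have [p2 H2] := rat_near x.1.1.2.
  have [p3 H3] := rat_near x.1.2.
  have [p4 H4] := rat_near x.2.
  exists (p1, p2, p3, p4, n) => //.
  have Bx : B (p1, p2, p3, p4, n) x by [].
  rewrite /F; case: pselect => //= -[] y [[[/= y1 y2] y3] y4]; apply: eO.
  have D (a b c : R) : ball a n.+1%:R^-1 b -> ball a n.+1%:R^-1 c -> ball b e c.
    by move=> ab ac; apply: (@ball_splitr _ _ a); apply: le_ball (ltW ne) _ _.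
  by split => /=; [split => /=; [split => /=|]|]; apply: D; eassumption.
apply: countable_bigcupT_measurable => [|i]; first exact: countableP.
rewrite /F; case: (pselect (B i `<=` O)) => _ /=; last exact: measurable0.
by rewrite /B; do !apply: measurableX; exact: measurable_ball.
Qed.

Lemma continuous_measurable4 (f : R4 R -> R) : continuous f -> measurable4 R setT f.
Proof.
move=> cf; apply: (measurability _ (RGenOpens.measurableE R)).
move=> _ [_ [a [b ->] <-]]; rewrite setTI; apply: open_measurable4.
by move/continuousP : cf; apply; exact: interval_open.
Qed.

End OpenMeasurable.

Section Radial.
Context {R : realType}.
Local Notation mu := (@lebesgue_measure R).

Definition sqnorm (x : R4 R) : R := x.1.1.1 ^+ 2 + x.1.1.2 ^+ 2 + x.1.2 ^+ 2 + x.2 ^+ 2.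
Definition quart (x : R4 R) : R := sqnorm x ^+ 2.

Lemma sqnorm_ge0 x : 0 <= sqnorm x.
Proof. by rewrite /sqnorm !addr_ge0 ?sqr_ge0. Qed.

Lemma quart_ge0 x : 0 <= quart x. Proof. exact: sqr_ge0. Qed.

Lemma sqrt_quart x : Num.sqrt (quart x) = sqnorm x.
Proof. by rewrite sqrtr_sqr ger0_norm// sqnorm_ge0. Qed.

Lemma enorm_quart x : enorm x = Num.sqrt (Num.sqrt (quart x)).
Proof. by rewrite sqrt_quart. Qed.

Lemma unit_ballE : @unit_ball R = [set x | quart x < 1].
Proof.
apply/seteqP; split => x; rewrite /unit_ball /= enorm_quart => H.
  rewrite ltNge; apply: contraL H => H; rewrite -leNgt -(sqrtr1 R) ler_wsqrtr// -(sqrtr1 R) ler_wsqrtr//.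
by rewrite -(sqrtr1 R) ltr_sqrt// -(sqrtr1 R) ltr_sqrt.
Qed.

Lemma continuous_coord (x : R4 R) :
  [/\ {for x, continuous (fun x : R4 R => x.1.1.1)}, {for x, continuous (fun x : R4 R => x.1.1.2)},
      {for x, continuous (fun x : R4 R => x.1.2)} & {for x, continuous (fun x : R4 R => x.2)}].
Proof.
have f (U V : topologicalType) (z : U * V) : {for z, continuous (@fst U V)} by exact: cvg_fst.
have s (U V : topologicalType) (z : U * V) : {for z, continuous (@snd U V)} by exact: cvg_snd.
have c2 : {for x, continuous (fun x : R4 R => x.1.1)}.
  exact: (@continuous_comp _ _ _ (fst : R4 R -> _) fst x (f _ _ x) (f _ _ x.1)).
split.
- exact: (@continuous_comp _ _ _ (fun x : R4 R => x.1.1) fst x c2 (f _ _ x.1.1)).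
- exact: (@continuous_comp _ _ _ (fun x : R4 R => x.1.1) snd x c2 (s _ _ x.1.1)).
- exact: (@continuous_comp _ _ _ (fst : R4 R -> _) snd x (f _ _ x) (s _ _ x.1)).
- exact: s.
Qed.

Lemma continuous_sqnorm : continuous sqnorm.
Proof.
move=> x; have [c1 c2 c3 c4] := continuous_coord x.
have -> : sqnorm = (fun y : R4 R => y.1.1.1 * y.1.1.1 + y.1.1.2 * y.1.1.2 + y.1.2 * y.1.2 +
    y.2 * y.2) by [].
by apply: cvgD; [apply: cvgD; [apply: cvgD|]|]; apply: cvgM.
Qed.

Lemma continuous_quart : continuous quart.
Proof. by move=> x; apply: (@cvgM _ _ _ _ sqnorm sqnorm); exact: continuous_sqnorm. Qed.

Lemma measurable_sqnorm : measurable4 R setT sqnorm.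
Proof. apply: continuous_measurable4; exact: continuous_sqnorm. Qed.

Lemma measurable_quart : measurable4 R setT quart.
Proof. apply: continuous_measurable4; exact: continuous_quart. Qed.

Lemma measurable_unit_ball : measurable (unit_ball : set (@measurableTypeR4 R)).
Proof.
rewrite unit_ballE -[X in measurable X]setTI.
have -> : [set x | quart x < 1] = quart @^-1` `]-oo, 1[ by apply/seteqP; split => x; rewrite /= in_itv/=.
exact: measurable_quart.
Qed.

End Radial.

Section RadialMeasure.
Context {R : realType}.
Local Notation mu := (@lebesgue_measure R).
Local Notation leb4 := (@lebesgue4 R).

(** The volume of the unit ball, carried as an unknown until the radial formula itself determines
    it. *)
Let c4 := leb4 [set x | quart x <= 1].

Lemma measurable_quart_le (s : R) : measurable ([set x | quart x <= s] : set (@measurableTypeR4 R)).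
Proof.
rewrite -[X in measurable X]setTI.
have -> : [set x | quart x <= s] = quart @^-1` `]-oo, s] by apply/seteqP; split => x;
    rewrite /= in_itv/=.
exact: measurable_quart.
Qed.

Lemma quart_affine (r : R) x : quart (affine4 r 0 x) = r ^+ 4 * quart x.
Proof. by rewrite /quart /sqnorm /affine4/= !addr0; ring. Qed.

Let lebesgue4_quart_gt0 (s : R) : 0 < s -> leb4 [set x | quart x <= s] = (s%:E * c4)%E.
Proof.
move=> s0; pose r := Num.sqrt (Num.sqrt s).
have r0 : 0 < r by rewrite !sqrtr_gt0.
have r4 : r ^+ 4 = s.
  have -> : r ^+ 4 = (r ^+ 2) ^+ 2 by ring.
  by rewrite sqr_sqrtr ?sqrtr_ge0// sqr_sqrtr// ltW.
rewrite (lebesgue4_affine 0 r0)//; last exact: measurable_quart_le.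
rewrite r4; congr (_ * leb4 _)%E.
by apply/seteqP; split => x /=; rewrite quart_affine r4 ger_pMr.
Qed.

Let c4_fin : (c4 < +oo)%E.
Proof.
pose I : set (measurableTypeR R) := `[(-1)%R, 1%R]%classic.
have mI : measurable I by exact: measurable_itv.
have muI : (mu I = 2%:E)%E.
  rewrite lebesgue_measure_itv/= lte_fin gtrN// -EFinD; congr EFin; ring.
apply: (@le_lt_trans _ _ (leb4 (I `*` I `*` I `*` I))).
  apply: le_measure; rewrite ?inE.
  - exact: measurable_quart_le.
  - by do !apply: measurableX.
  have ax (a b : R) : 0 <= b -> a ^+ 2 + b <= 1 -> I a.
    move=> b0 H; rewrite /I /= in_itv/= -ler_norml.
    rewrite -(@ler_pXn2r _ 2)// ?nnegrE// expr1n real_normK ?num_real//; lra.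
  move=> x /= H.
  have {}H : sqnorm x <= 1.
    by rewrite -(@ler_pXn2r _ 2)// ?nnegrE ?sqnorm_ge0// expr1n.
  have [p1 p2 p3 p4] : [/\ 0 <= x.1.1.1 ^+ 2, 0 <= x.1.1.2 ^+ 2, 0 <= x.1.2 ^+ 2 & 0 <= x.2 ^+ 2].
    by rewrite !sqr_ge0.
  rewrite /sqnorm in H; split; [split; [split|]|] => /=.
  - by apply: (ax _ (x.1.1.2 ^+ 2 + x.1.2 ^+ 2 + x.2 ^+ 2)); lra.
  - by apply: (ax _ (x.1.1.1 ^+ 2 + x.1.2 ^+ 2 + x.2 ^+ 2)); lra.
  - by apply: (ax _ (x.1.1.1 ^+ 2 + x.1.1.2 ^+ 2 + x.2 ^+ 2)); lra.
  - by apply: (ax _ (x.1.1.1 ^+ 2 + x.1.1.2 ^+ 2 + x.1.2 ^+ 2)); lra.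
have -> : leb4 (I `*` I `*` I `*` I) = (2%:E * 2%:E * 2%:E * 2%:E)%E.
  by rewrite -muI; exact: lebesgue4X.
by rewrite -!EFinM ltry.
Qed.

Let lebesgue4_quart (s : R) : leb4 [set x | quart x <= s] = ((Num.max s 0)%:E * c4)%E.
Proof.
have [s0|s0] := ltP 0 s; first exact: lebesgue4_quart_gt0.
rewrite mul0e; apply/eqP; rewrite eq_le measure_ge0 andbT.
have c0 : (0 <= c4)%E by exact: measure_ge0.
have cf : c4 \is a fin_num by rewrite ge0_fin_numE// c4_fin.
(* For [s <= 0] the set lies in balls of arbitrarily small volume. *)
apply/lee_addgt0Pr => e e0; rewrite add0e.
have e1 : 0 < e / (fine c4 + 1).
  by rewrite divr_gt0// ltr_wpDl// fine_ge0.
apply: (@le_trans _ _ (leb4 [set x | quart x <= e / (fine c4 + 1)])).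
  apply: le_measure; rewrite ?inE; try exact: measurable_quart_le.
  by move=> x /= /le_trans; apply; exact: (le_trans s0 (ltW e1)).
have f0 : 0 <= fine c4 by exact: fine_ge0.
rewrite lebesgue4_quart_gt0// -[in leLHS](fineK cf) -EFinM lee_fin mulrAC.
rewrite ler_pdivrMr ?ltr_wpDl//.
by rewrite ler_pM2l// lerDl.
Qed.

Let Rplus : set (measurableTypeR R) := `[0%R, +oo[%classic.
Let mRplus : measurable Rplus. Proof. exact: measurable_itv. Qed.

Let c4_num : {nonneg R} := NngNum (fine_ge0 (measure_ge0 leb4 [set x | quart x <= 1])).

Let c4E : (c4_num%:num%:E = c4)%E.
Proof. by rewrite /= fineK// ge0_fin_numE ?measure_ge0 ?c4_fin. Qed.

Let quartR : @measurableTypeR4 R -> measurableTypeR R := quart.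
Let mquartR : measurable_fun setT quartR. Proof. exact: measurable_quart. Qed.

(** By dilation the sublevel set of [quart] at [s >= 0] has measure proportional to [s], so the two
    measures agree on half-open intervals, which determine them. *)
Let pushforward_quart (A : set (measurableTypeR R)) : measurable A ->
  pushforward leb4 quartR A = (c4_num%:num%:E * mu (A `&` Rplus))%E.
Proof.
pose pm : {measure set (measurableTypeR R) -> \bar R} := pushforward leb4 quartR.
pose nm : {measure set (measurableTypeR R) -> \bar R} := mscale c4_num (mrestr mu mRplus).
apply: (@measure_unique _ _ (measurableTypeR R) (@ocitv R) (fun n : nat =>
    `]- n%:R, n%:R]%classic) _ _ _ _ (pm mquartR) nm).
- by [].
- exact: ocitvI.
- by move=> n; exact: is_ocitv.
- apply/seteqP; split => // x _; exists (Num.bound `|x|) => //=.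
  have := archi_boundP (normr_ge0 x).
  by rewrite ltr_norml in_itv/= => /andP[-> /ltW ->].
- move=> _ [[a b] /= _ <-].
  have mq := @measurable_quart_le.
  rewrite /pm /nm /= /mscale /mrestr /= c4E /pushforward.
  have [ab|ba] := ltP a b; last first.
    by rewrite set_itv_ge ?bnd_simp -?leNgt// preimage_set0 !measure0 mule0.
  have -> : quartR @^-1` `]a, b] = [set x | quart x <= b] `\` [set x | quart x <= a].
    apply/seteqP; split => x /=; rewrite in_itv/=.
      by move=> /andP[ax ->]; split => //; apply/negP; rewrite -ltNge.
    by move=> [-> /negP]; rewrite -ltNge => ->.
  have fin : (leb4 [set x | (quart x <= b)%R] < +oo)%E by rewrite lebesgue4_quart -c4E -EFinM ltry.
  rewrite (measureD (mq b) (mq a) fin).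
  have -> : [set x : R4 R | quart x <= b] `&` [set x | quart x <= a] = [set x | quart x <= a].
    by apply/seteqP; split => [x []|x /= H] //; split => //; exact: le_trans (ltW ab).
  transitivity ((Num.max b 0)%:E * c4 - (Num.max a 0)%:E * c4)%E.
    by congr (_ - _)%E; exact: lebesgue4_quart.
  rewrite -c4E -!EFinM -EFinB -mulrBl mulrC EFinM; congr (_ * _)%E.
  rewrite /mrestr; have [a0|a0] := leP 0 a.
    rewrite (_ : _ `&` _ = `]a, b]%classic); last first.
      apply/seteqP; split => [x []//|x xab]; split => //; move: xab.
      by rewrite /Rplus /= !in_itv/= andbT => /andP[/ltW /(le_trans a0)].
    rewrite lebesgue_measure_itv/= lte_fin ab -EFinB; congr EFin.
    by rewrite (max_idPl _)// (le_trans a0 (ltW ab)).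
  rewrite (_ : _ `&` _ = `[0, b]%classic); last first.
    apply/seteqP; split => x /=; rewrite /Rplus /= !in_itv/= ?andbT.
      by move=> [/andP[_ ->] ->].
    by move=> /andP[x0 xb]; rewrite x0 xb (lt_le_trans a0 x0).
  rewrite lebesgue_measure_itv/= lte_fin subr0.
  by case: ltP => [b0|b0]; rewrite ?oppr0 ?adde0.
- move=> k; apply: (@le_lt_trans _ _ (leb4 [set x | quart x <= k%:R])).
    rewrite [X in (X <= _)%E](_ : _ = leb4 (quartR @^-1` `](- k%:R), k%:R]%classic))//.
    apply: le_measure; rewrite ?inE.
    + by rewrite -[X in measurable X]setTI; apply: mquartR => //; exact: measurable_itv.
    + exact: measurable_quart_le.
    + by move=> x /=; rewrite in_itv/= => /andP[].
  by rewrite lebesgue4_quart -c4E -EFinM ltry.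
Qed.

Let ge0_integral_quart_c (h : R -> \bar R) : measurable_fun setT h -> (forall q, (0 <= h q)%E) ->
  (\int[leb4]_x h (quart x) = c4 * \int[mu]_(q in `[0%R, +oo[) h q)%E.
Proof.
move=> mh h0.
pose pm : {measure set (measurableTypeR R) -> \bar R} := pushforward leb4 quartR.
pose nm : {measure set (measurableTypeR R) -> \bar R} := mscale c4_num mu.
have E1 : (\int[leb4]_x h (quart x) = \int[pm mquartR]_(q in setT) h q)%E.
  have -> := ge0_integral_pushforward mquartR leb4 measurableT mh (fun x _ => h0 x).
  by rewrite preimage_setT.
have mN : measurable (~` Rplus) by exact: measurableC.
have E2 : (\int[pm mquartR]_(q in setT) h q = \int[pm mquartR]_(q in Rplus) h q)%E.
  rewrite -(setUv Rplus) ge0_integral_setU//; last 2 first.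
    by rewrite setUv.
    exact/disj_setPCl.
  rewrite [X in (_ + X)%E]null_set_integral ?adde0//.
    exact: measurable_funTS.
  rewrite /= pushforward_quart//.
  by rewrite setICl measure0 mule0.
have E3 : (\int[pm mquartR]_(q in Rplus) h q = \int[nm]_(q in Rplus) h q)%E.
  apply: eq_measure_integral => A mA AR; rewrite /= pushforward_quart//.
  by rewrite (setIidl AR).
have E4 := ge0_integral_mscale mu mRplus c4_num (measurable_funTS mh) (fun x _ => h0 x).
by rewrite E1 E2 E3 E4 c4E.
Qed.

Let integral_exp_sqrt : (\int[mu]_(q in `[0%R, +oo[) (expR (- Num.sqrt q))%:E = 2%:E)%E.
Proof.
(* Found by substituting [t = sqrt q], which turns the integrand into [2 t exp (- t)]. The square
   root is not differentiable at [0], where only continuity is used. *)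
pose F (q : R) : R := - 2 * ((1 + Num.sqrt q) * expR (- Num.sqrt q)).
have cF : continuous F.
  move=> x; apply: cvgM; first exact: cvg_cst.
  apply: cvgM; first by apply: cvgD; [exact: cvg_cst|exact: sqrt_continuous].
  apply: (@continuous_comp _ _ _ (fun q : R => - Num.sqrt q) expR); last exact: continuous_expR.
  by apply: cvgN; exact: sqrt_continuous.
have cf : continuous (fun q : R => expR (- Num.sqrt q)).
  move=> x; apply: (@continuous_comp _ _ _ (fun q : R => - Num.sqrt q) expR);
      last exact: continuous_expR.
  by apply: cvgN; exact: sqrt_continuous.
have dF (x : R) : 0 < x -> is_derive x 1 F (expR (- Num.sqrt x)).
  move=> x0; have s0 : Num.sqrt x != 0 by rewrite gt_eqF// sqrtr_gt0.
  have ds := is_derive1_sqrt x0.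
  rewrite /F; apply: is_derive_eq.
  rewrite /GRing.scale /=; field; exact: s0.
have -> : (2%:E = 0%:E - (F 0)%:E)%E.
  by rewrite /F sqrtr0 oppr0 expR0 -EFinB; congr EFin; ring.
apply: ge0_continuous_FTC2y.
- by move=> x _; exact: expR_ge0.
- exact: continuous_subspaceT.
- apply/cvgrPdist_le => e e0; near=> q.
  have q0 : 0 < q by [].
  have s0 : 0 < Num.sqrt q by rewrite sqrtr_gt0.
  have -> : 0 - F q = 2 * ((1 + Num.sqrt q) * expR (- Num.sqrt q)) by rewrite /F; ring.
  rewrite ger0_norm; last by rewrite !mulr_ge0 ?expR_ge0// addr_ge0// ltW.
  (* With [t = sqrt q], both [1 + t <= 2 exp (t / 2)] and [t / 2 <= exp (t / 2)] hold, so that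
     [2 (1 + t) exp (- t) <= 8 / t]. *)
  have es : 8 / Num.sqrt q <= e.
    rewrite ler_pdivrMr// -ler_pdivrMl//.
    rewrite -(@ler_pXn2r _ 2) ?nnegrE ?(ltW s0)//; last by rewrite mulr_ge0// invr_ge0 ltW.
    by rewrite sqr_sqrtr ?(ltW q0)//; near: q; exact: nbhs_pinfty_ge.
  apply: le_trans es.
  have E1 : 1 + Num.sqrt q <= 2 * expR (Num.sqrt q / 2).
    by have := expR_ge1Dx (Num.sqrt q / 2); lra.
  have E2 : Num.sqrt q / 2 <= expR (Num.sqrt q / 2).
    by have := expR_ge1Dx (Num.sqrt q / 2); lra.
  rewrite expRN ler_pdivlMr// mulrA mulrAC ler_pdivrMr ?expR_gt0//.
  have -> : expR (Num.sqrt q) = expR (Num.sqrt q / 2) * expR (Num.sqrt q / 2).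
    by rewrite -expRD; congr expR; field.
  set t := Num.sqrt q in E1 E2 s0 *; set E := expR _ in E1 E2 *.
  nra.
- by move=> x /dF [].
- exact: cvg_at_right_filter (cF _).
- by move=> x; rewrite in_itv/= andbT => /dF ?; rewrite derive1E derive_val.
Unshelve. all: by end_near. Qed.

Let integral_gauss4 : (\int[leb4]_x (expR (- sqnorm x))%:E = (pi ^+ 2)%:E)%E.
Proof.
have mg := @measurable_gauss_fun R; have g0 := @gauss_fun_ge0 R.
have := ge0_integral_lebesgue4_prod mg mg mg mg g0 g0 g0 g0.
rewrite integralT_gauss -!EFinM.
have -> : Num.sqrt pi * Num.sqrt pi * Num.sqrt pi * Num.sqrt pi = pi ^+ 2 :> R.
  have -> (a : R) : a * a * a * a = (a ^+ 2) ^+ 2 by ring.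
  by rewrite sqr_sqrtr// pi_ge0.
move=> <-; apply: eq_integral => x _; congr EFin.
by rewrite /gauss_fun -!expRD; congr expR; rewrite /sqnorm; ring.
Qed.

(** The integral of [exp (- |x|^2)] equals [pi^2] as a product of four Gaussians, and [2 c4] by the
    radial formula. *)
Lemma lebesgue4_quart_le1 : (c4 = (pi ^+ 2 / 2)%:E)%E.
Proof.
have := @ge0_integral_quart_c (fun q => (expR (- Num.sqrt q))%:E).
rewrite integral_exp_sqrt.
under eq_integral do rewrite sqrt_quart.
rewrite integral_gauss4 -c4E -EFinM => H.
have m : measurable_fun setT (fun q : R => (expR (- Num.sqrt q))%:E).
  apply/measurable_EFinP; apply: continuous_measurable_fun => x.
  apply: (@continuous_comp _ _ _ (fun q : R => - Num.sqrt q) expR); last exact: continuous_expR.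
  by apply: cvgN; exact: sqrt_continuous.
have g0 (q : R) : (0%R <= (expR (- Num.sqrt q))%:E)%E by rewrite lee_fin expR_ge0.
by have [->] := H m g0; rewrite mulfK.
Qed.

Lemma ge0_integral_quart (h : R -> \bar R) : measurable_fun setT h -> (forall q, (0 <= h q)%E) ->
  (\int[leb4]_x h (quart x) = (pi ^+ 2 / 2)%:E * \int[mu]_(q in `[0%R, +oo[) h q)%E.
Proof. by move=> mh h0; rewrite ge0_integral_quart_c// lebesgue4_quart_le1. Qed.

End RadialMeasure.

(** * Smooth functions *)

Section SmoothClass.
Context {R : realType}.
Implicit Types (f g : R4 R -> R).

(** Reduces a directional derivative to a derivative on the line, where the chain rule asks for no
    differentiability in the other directions. *)
Lemma is_derive_line (f : R4 R -> R) x v d :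
  is_derive x v f d <-> is_derive (0 : R) (1 : R) (fun h => f (h *: v + x)) d.
Proof.
have E : (fun h : R => h^-1 *: (((fun h => f (h *: v +
    x)) \o shift 0) (h *: (1 : R)) - f (0 *: v + x))) =
         (fun h : R => h^-1 *: ((f \o shift x) (h *: v) - f x)).
  by apply/funext => h /=; rewrite scale0r add0r addr0 /GRing.scale /= mulr1.
by split=> -[d1 d2]; split; move: d1 d2; rewrite /derivable /derive E.
Qed.

Lemma is_derive_chain (F : R -> R) f x v a b :
  is_derive (f x) (1 : R) F a -> is_derive x v f b -> is_derive x v (F \o f) (a * b).
Proof.
move=> dF /is_derive_line df; apply/is_derive_line.
apply: (@is_derive1_comp _ F (fun h => f (h *: v + x))) => //.
by rewrite scale0r add0r.
Qed.

(* [smooth], graded by the number of derivatives, which makes the closure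
   properties provable by induction. *)
Fixpoint smoothn n f : Prop := continuous f /\
  if n is n.+1 then forall i, (forall x, derivable f x (basis4 i)) /\ smoothn n (partial i f)
  else True.

Lemma smoothP f : smooth f <-> forall n, smoothn n f.
Proof.
split => [sf n|sf s].
  have : forall s, smoothn n (partials s f).
    elim: n => [|n IH] s /=; split; [exact: (sf s).1|by []|exact: (sf s).1|].
    by move=> i; split; [exact: (sf s).2|exact: (IH (i :: s))].
  exact: (fun H => H [::]).
have : smoothn (size s).+1 f by exact: sf.
(* [foldr] differentiates along the last index of the list first, whereas [smoothn] peels off the
   first derivative taken; hence the induction from the right. *)
elim/last_ind: s f {sf} => [f /= [cf df]|s i IH f]; first by split => // i; exact: (df i).1.
by rewrite size_rcons => -[cf /(_ i)[_ /IH]]; rewrite /partials -cats1 foldr_cat.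
Qed.

Lemma smoothnS n f : smoothn n.+1 f -> smoothn n f.
Proof.
elim: n f => [|n IH] f; first by case.
move=> [cf df]; split => // i; split; first exact: (df i).1.
exact/IH/(df i).2.
Qed.

Lemma smoothn_derive n f (df : 'I_4 -> R4 R -> R) : continuous f ->
  (forall i x, is_derive x (basis4 i) f (df i x)) -> (forall i, smoothn n (df i)) ->
  smoothn n.+1 f.
Proof.
move=> cf dfE sdf; split => // i; split; first by move=> x; have [] := dfE i x.
have -> : partial i f = df i by apply/funext => x;
    rewrite /partial (@derive_val _ _ _ _ _ _ _ (dfE i x)).
exact: sdf.
Qed.

Lemma smoothn_is_derive n f i x : smoothn n.+1 f -> is_derive x (basis4 i) f (partial i f x).
Proof. by move=> [_ /(_ i)[d _]]; exact: DeriveDef. Qed.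

Lemma smoothn_partial n f i : smoothn n.+1 f -> smoothn n (partial i f).
Proof. by move=> [_ /(_ i)[]]. Qed.

Lemma smoothn_cst n c : smoothn n (fun=> c).
Proof.
elim: n c => [|n IH] c; first by split => // x; exact: cvg_cst.
exact: (@smoothn_derive n (fun=> c) (fun _ => cst 0) (fun x => cvg_cst _) (fun i x =>
    is_derive_cst _ _ _) (fun i => IH 0)).
Qed.

Lemma smoothnD n f g : smoothn n f -> smoothn n g -> smoothn n (fun x => f x + g x).
Proof.
elim: n f g => [|n IH] f g sf sg.
  by split => // x; apply: cvgD; [apply: sf.1|apply: sg.1].
apply: (@smoothn_derive _ _ (fun i x => partial i f x + partial i g x)) => [x|i x|i].
- by apply: cvgD; [apply: sf.1|apply: sg.1].
- exact: (is_deriveD (smoothn_is_derive i x sf) (smoothn_is_derive i x sg)).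
- by apply: IH; exact: smoothn_partial.
Qed.

Lemma smoothnM n f g : smoothn n f -> smoothn n g -> smoothn n (fun x => f x * g x).
Proof.
elim: n f g => [|n IH] f g sf sg.
  by split => // x; apply: cvgM; [apply: sf.1|apply: sg.1].
apply: (@smoothn_derive _ _ (fun i x => f x * partial i g x + g x * partial i f x)) => [x|i x|i].
- by apply: cvgM; [apply: sf.1|apply: sg.1].
- exact: (is_deriveM (smoothn_is_derive i x sf) (smoothn_is_derive i x sg)).
- apply: smoothnD; apply: IH; [exact: smoothnS|exact: smoothn_partial|exact: smoothnS|exact:
    smoothn_partial].
Qed.

Lemma smoothnN n f : smoothn n f -> smoothn n (fun x => - f x).
Proof.
move=> sf; have -> : (fun x => - f x) = (fun x => -1 * f x) by apply/funext => x; rewrite mulN1r.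
by apply: smoothnM => //; exact: smoothn_cst.
Qed.

Lemma smoothnB n f g : smoothn n f -> smoothn n g -> smoothn n (fun x => f x - g x).
Proof. by move=> sf sg; apply: smoothnD => //; exact: smoothnN. Qed.

Lemma smoothnV n f : (forall x, f x != 0) -> smoothn n f -> smoothn n (fun x => (f x)^-1).
Proof.
move=> f0; elim: n => [|n IH] sf.
  by split => // x; apply: cvgV => //; apply: sf.1.
apply: (@smoothn_derive _ _ (fun i x => - ((f x)^-1 * (f x)^-1 * partial i f x))) => [x|i x|i].
- by apply: cvgV => //; apply: sf.1.
- have d := @smoothn_is_derive n f i x sf.
  have -> : - ((f x)^-1 * (f x)^-1 * partial i f x) = - (f x) ^- 2 *: partial i f x.
    by rewrite /GRing.scale /= -invfM -expr2 mulNr.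
  split; first by apply: derivableV => //; case: d.
  by rewrite deriveV//; case: d => // _ ->.
- apply: smoothnN; apply: smoothnM; last exact: smoothn_partial.
  by apply: smoothnM; apply: IH; exact: smoothnS.
Qed.

Lemma smoothn_sum n (F : 'I_4 -> R4 R -> R) : (forall i, smoothn n (F i)) ->
  smoothn n (fun x => \sum_i F i x).
Proof.
move=> sF; have -> : (fun x => \sum_i F i x) = (fun x => F 0 x + F 1 x + F 2 x + F 3 x).
  apply/funext => x; rewrite !big_ord_recl big_ord0 addr0 !addrA.
  by do !congr (_ + _); congr F; apply: val_inj.
by do !apply: smoothnD.
Qed.

Definition coord4 (i : 'I_4) (x : R4 R) : R :=
  nth 0 [:: x.1.1.1; x.1.1.2; x.1.2; x.2] i.

Lemma coord4_basis (i j : 'I_4) : coord4 i (basis4 j) = (i == j)%:R.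
Proof.
by case: i => [[|[|[|[|]]]]] //= ?; case: j => [[|[|[|[|]]]]].
Qed.

Lemma coord4_line (i : 'I_4) (h : R) v x : coord4 i (h *: v + x) = h * coord4 i v + coord4 i x.
Proof. by case: i => [[|[|[|[|]]]]]. Qed.

Lemma continuous_coord4 (i : 'I_4) : continuous (coord4 i).
Proof.
by move=> x; have [c1 c2 c3 c4] := continuous_coord x; case: i => [[|[|[|[|]]]]].
Qed.

Lemma is_derive_coord4 (i j : 'I_4) x : is_derive x (basis4 j) (coord4 i) (i == j)%:R.
Proof.
apply/is_derive_line.
have -> : (fun h : R => coord4 i (h *: basis4 j + x)) = (fun h => h * (i == j)%:R + coord4 i x).
  by apply/funext => h; rewrite coord4_line coord4_basis.
by apply: is_derive_eq; rewrite /GRing.scale /= ; ring.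
Qed.

Lemma smoothn_coord4 n i : smoothn n (coord4 i).
Proof.
case: n => [|n]; first by split => //; exact: continuous_coord4.
apply: (@smoothn_derive _ _ (fun j => cst (i == j)%:R)) => [|j x|j].
- exact: continuous_coord4.
- exact: is_derive_coord4.
- exact: smoothn_cst.
Qed.

Lemma sqnormE x : sqnorm x = \sum_i coord4 i x * coord4 i x.
Proof. by rewrite !big_ord_recl big_ord0 addr0 !addrA -!expr2. Qed.

Lemma smoothn_sqnorm n : smoothn n (@sqnorm R).
Proof.
have -> : @sqnorm R = (fun x => \sum_i coord4 i x * coord4 i x) by apply/funext => x; rewrite sqnormE.
by apply: smoothn_sum => i; apply: smoothnM; exact: smoothn_coord4.
Qed.

Lemma smoothn_quart n : smoothn n (@quart R).
Proof. exact: (smoothnM (smoothn_sqnorm n) (smoothn_sqnorm n)). Qed.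

Lemma is_derive_sqnorm i x : is_derive x (basis4 i) (@sqnorm R) (2 * coord4 i x).
Proof.
apply/is_derive_line.
have -> : (fun h : R => sqnorm (h *: basis4 i + x)) = (fun h => h * h + h * (2 * coord4 i x) + sqnorm x).
  apply/funext => h; case: i => [[|[|[|[|]]]]] //= ?; rewrite /sqnorm /coord4 /= /GRing.scale /=; ring.
by apply: is_derive_eq; rewrite /GRing.scale /= ; ring.
Qed.

Lemma is_derive_quart i x : is_derive x (basis4 i) (@quart R) (4 * sqnorm x * coord4 i x).
Proof.
have d := is_derive_sqnorm i x.
have := @is_deriveM _ _ _ _ x _ _ _ d d.
have -> : 4 * sqnorm x * coord4 i x = sqnorm x *: (2 * coord4 i x) + sqnorm x *: (2 * coord4 i x).
  by rewrite /GRing.scale /=; ring.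
exact.
Qed.

End SmoothClass.

(** * A smooth step function on the line *)

Section Step.
Context {R : realType}.
Implicit Types (y : R).

(** The classical function [exp (- 1 / y)], flat at [0]. The powers of [1 / y] in front make the
    linear span of the family closed under differentiation. *)
Definition flat (k : nat) y : R := if 0 < y then y^-1 ^+ k * expR (- y^-1) else 0.

Lemma flat_le0 k y : y <= 0 -> flat k y = 0.
Proof. by rewrite /flat leNgt => /negbTE ->. Qed.

Lemma flat_gt0 k y : 0 < y -> 0 < flat k y.
Proof. by move=> y0; rewrite /flat y0 mulr_gt0 ?expR_gt0// exprn_gt0// invr_gt0. Qed.

Lemma flat_ge0 k y : 0 <= flat k y.
Proof. by have [/flat_gt0/ltW//|/flat_le0 ->] := ltP 0 y. Qed.

(** The Taylor lower bound of the exponential at [1 / y]. It yields the derivative at [0], where the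
    difference quotient of [flat k] is [flat k.+1]. *)
Lemma flat_bound k y : flat k y <= k.+1`!%:R * `|y|.
Proof.
have [y0|/flat_le0 ->] := ltP 0 y; last by rewrite mulr_ge0.
rewrite /flat y0 expRN ger0_norm ?(ltW y0)// ler_pdivrMr ?expR_gt0//.
have := @expR_ge1Dxn R y^-1 k.
rewrite invr_ge0 (ltW y0) => /(_ isT) H.
have f0 : 0 < k.+1`!%:R :> R by rewrite ltr0n fact_gt0.
have H2 : y^-1 ^+ k.+1 / k.+1`!%:R <= expR y^-1 by apply: le_trans H; rewrite lerDr.
rewrite ler_pdivrMr// in H2.
rewrite -mulrA mulrCA -ler_pdivrMl// -exprS (le_trans H2)//.
by rewrite mulrC.
Qed.

Lemma is_derive_flat k y : is_derive y (1 : R) (flat k) (flat k.+2 y - k%:R * flat k.+1 y).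
Proof.
have [y0|y0|->] := ltgtP y 0.
- rewrite !flat_le0 ?(ltW y0)// mulr0 subr0.
  have H : is_derive y (1 : R) (cst 0 : R -> R) 0 by exact: is_derive_cst.
  apply: near_eq_is_derive H.
  by near=> z; rewrite /cst flat_le0// ltW//; near: z; exact: lt_nbhsl.
- suff H : is_derive y (1 : R) (fun z : R => z^-1 ^+ k * expR (- z^-1)) (flat k.+2 y - k%:R *
    flat k.+1 y).
    apply: near_eq_is_derive H.
    by near=> z; rewrite /flat ifT//; near: z; exact: lt_nbhsr.
  rewrite /flat y0.
  have yn0 : y != 0 by rewrite gt_eqF.
  have dV : is_derive y (1 : R) (fun z : R => z^-1) (- (y ^- 2)).
    have H := @is_deriveV R id y 1 1 yn0 (is_derive_id _ _).
    by apply: (is_derive_eq H); rewrite /GRing.scale /= mulr1.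
  have dE : is_derive y (1 : R) (fun z : R => expR (- z^-1)) (expR (- y^-1) * y ^- 2).
    apply: (@is_derive1_comp _ expR (fun z => - z^-1)).
    by have := is_deriveN dV; rewrite opprK.
  have EX : (fun z : R => z^-1) ^+ k = (fun z : R => z^-1 ^+ k).
    by apply/funext => z; elim: {yn0 dV dE}k => [|k IH]; rewrite ?expr0// !exprS -IH.
  have dX := is_deriveX k dV; rewrite EX in dX.
  have H := is_deriveM dX dE.
  apply: (is_derive_eq H).
  rewrite /GRing.scale /= -!exprVn; clear; move: (expR (- y^-1)) => E; move: (y^-1) => w.
  by case: k => [|k] /=; rewrite !exprS ?expr0; ring.
- rewrite !flat_le0// mulr0 subr0.
  have lim : (fun h : R => h^-1 *: (flat k (h *: (1:R) + 0) - flat k 0)) @ 0^' --> (0 : R).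
    apply/cvgrPdist_le => e e0; near=> h.
    have h0 : h != 0 by near: h; exact: nbhs_dnbhs_neq.
    rewrite sub0r normrN /GRing.scale /= mulr1 addr0 (flat_le0 _ (lexx _)) subr0.
    have [hp|hn] := ltP 0 h; last by rewrite flat_le0// mulr0 normr0 ltW.
    have -> : h^-1 * flat k h = flat k.+1 h by rewrite /flat hp exprS mulrA.
    rewrite ger0_norm ?flat_ge0// (le_trans (flat_bound _ _))//.
    rewrite -ler_pdivlMl ?ltr0n ?fact_gt0//.
    near: h; apply: dnbhs0_le; by rewrite mulr_gt0// invr_gt0 ltr0n fact_gt0.
  by split; [apply/cvg_ex; exists 0|exact/cvg_lim].
Unshelve. all: by end_near. Qed.

Lemma continuous_flat k : continuous (flat k).
Proof.
move=> y; apply: differentiable_continuous; apply/derivable1_diffP.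
by have [] := is_derive_flat k y.
Qed.

Lemma smoothn_flat n k (g : R4 R -> R) : smoothn n g -> smoothn n (flat k \o g).
Proof.
elim: n k => [|n IH] k sg.
  by split => // x; apply: continuous_comp; [apply: sg.1|exact: continuous_flat].
have c : continuous (flat k \o g).
  by move=> x; apply: continuous_comp; [apply: sg.1|exact: continuous_flat].
have d i (x : R4 R) : is_derive x (basis4 i) (flat k \o g) ((flat k.+2 (g x) - k%:R *
    flat k.+1 (g x)) * partial i g x).
  exact: (is_derive_chain (is_derive_flat k (g x)) (smoothn_is_derive i x sg)).
apply: (smoothn_derive c d) => i.
apply: smoothnM; last exact: smoothn_partial.
apply: smoothnB; first exact: (IH k.+2 (smoothnS sg)).
by apply: smoothnM; [exact: smoothn_cst|exact: (IH k.+1 (smoothnS sg))].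
Qed.

Let den y := flat 0 y + flat 0 (1 - y).

Let den_gt0 y : 0 < den y.
Proof.
rewrite /den; have [y0|y0] := ltP 0 y.
  by rewrite ltr_pwDl ?flat_ge0 ?flat_gt0.
by rewrite ltr_wpDl ?flat_ge0 ?flat_gt0// subr_gt0 (le_lt_trans y0).
Qed.

Definition step y : R := flat 0 y / den y.

Definition dstep y : R :=
  (flat 2 y * flat 0 (1 - y) + flat 0 y * flat 2 (1 - y)) / den y ^+ 2.

Lemma step_ge0 y : 0 <= step y.
Proof. by rewrite divr_ge0 ?flat_ge0// ltW// den_gt0. Qed.

Lemma step_le1 y : step y <= 1.
Proof. by rewrite ler_pdivrMr ?den_gt0// mul1r lerDl flat_ge0. Qed.

Lemma step_le0 y : y <= 0 -> step y = 0.
Proof. by move=> y0; rewrite /step flat_le0// mul0r. Qed.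

Lemma step_ge1 y : 1 <= y -> step y = 1.
Proof.
move=> y1; rewrite /step /den (@flat_le0 _ (1 - y)) ?subr_le0// addr0 divff//.
by rewrite gt_eqF// flat_gt0// (lt_le_trans ltr01).
Qed.

Lemma dstep_ge0 y : 0 <= dstep y.
Proof. by rewrite divr_ge0 ?sqr_ge0// addr_ge0// mulr_ge0 ?flat_ge0. Qed.

Lemma dstep_le0 y : y <= 0 -> dstep y = 0.
Proof. by move=> y0; rewrite /dstep !(flat_le0 _ y0) !mul0r addr0 mul0r. Qed.

Lemma dstep_ge1 y : 1 <= y -> dstep y = 0.
Proof. by rewrite -subr_le0 => y0; rewrite /dstep !(flat_le0 _ y0) !mulr0 addr0 mul0r. Qed.

Let is_derive_flat1B k y : is_derive y (1 : R) (fun z =>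
    flat k (1 - z)) (- (flat k.+2 (1 - y) - k%:R * flat k.+1 (1 - y))).
Proof.
rewrite -mulrN1.
apply: (@is_derive1_comp _ (flat k) (fun z => 1 - z)); first exact: is_derive_flat.
by rewrite -[-1]sub0r; exact: is_deriveB.
Qed.

Lemma is_derive_step y : is_derive y (1 : R) step (dstep y).
Proof.
have d0 := is_derive_flat 0 y; have d1 := is_derive_flat1B 0 y.
rewrite !mul0r !subr0 in d0 d1.
have dd : is_derive y (1 : R) den (flat 2 y - flat 2 (1 - y)) by exact: is_deriveD.
have n0 : den y != 0 by rewrite gt_eqF// den_gt0.
have dV := is_deriveV n0 dd.
have H : is_derive y 1 step _ := is_deriveM d0 dV.
apply: (is_derive_eq H).
rewrite /dstep /GRing.scale /=.
have E : flat 0 (1 - y) = den y - flat 0 y by rewrite /den; ring.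
rewrite E; field; exact: n0.
Qed.

Lemma continuous_step : continuous step.
Proof.
move=> y; apply: differentiable_continuous; apply/derivable1_diffP.
by have [] := is_derive_step y.
Qed.

Let continuous_flat1B k : continuous (fun y => flat k (1 - y)).
Proof.
move=> y; apply: (@continuous_comp _ _ _ (fun y : R => 1 - y) (flat k)); last exact: continuous_flat.
by apply: cvgB; [exact: cvg_cst|exact: cvg_id].
Qed.

Lemma continuous_dstep : continuous dstep.
Proof.
move=> y; apply: cvgM.
  by apply: cvgD; apply: cvgM; solve [exact: continuous_flat|exact: continuous_flat1B].
apply: cvgV; first by rewrite expf_neq0// gt_eqF// den_gt0.
by apply: cvgM; apply: cvgD; solve [exact: continuous_flat|exact: continuous_flat1B].
Qed.

Lemma dstep_bounded : exists M : R, forall y, dstep y <= M.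
Proof.
have [c _ cM] := @EVT_max R dstep 0 1 ler01 (continuous_subspaceT continuous_dstep).
exists (Num.max (dstep c) 0) => y; rewrite le_max.
have [y0|y0] := leP y 0; first by rewrite dstep_le0// lexx orbT.
have [y1|y1] := leP 1 y; first by rewrite dstep_ge1// lexx orbT.
by rewrite cM// in_itv/= !ltW.
Qed.

Lemma smoothn_step n (g : R4 R -> R) : smoothn n g -> smoothn n (fun x : R4 R => step (g x)).
Proof.
move=> sg; have s1 : smoothn n (fun x : R4 R => flat 0 (1 - g x)).
  by apply: (@smoothn_flat n 0 (fun x : R4 R => 1 - g x)); apply: smoothnB => //; exact: smoothn_cst.
have s0 : smoothn n (fun x : R4 R => flat 0 (g x)) by exact: smoothn_flat.
apply: smoothnM => //; apply: smoothnV; last exact: smoothnD.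
by move=> x; rewrite gt_eqF// den_gt0.
Qed.

End Step.

(** * Test functions and square-integrable functions *)

Section TestFunctions.
Context {R : realType}.
Local Notation leb4 := (@lebesgue4 R).
Local Notation B := (@unit_ball R).
Implicit Types (f g : R4 R -> R).

Lemma coord_sqr_le (i : 'I_4) (x : R4 R) : coord4 i x ^+ 2 <= sqnorm x.
Proof.
rewrite sqnormE (bigD1 i)//= expr2 lerDl sumr_ge0// => j _.
by rewrite -expr2 sqr_ge0.
Qed.

Lemma compact_quart_le (r : R) : r <= 1 -> compact [set x : R4 R | quart x <= r].
Proof.
move=> r1; pose I : set R := `[-1, 1]%classic.
have cI : compact I by exact: segment_compact.
apply: (@subclosed_compact _ _ (I `*` I `*` I `*` I)).
- have -> : [set x : R4 R | quart x <= r] = quart @^-1` [set z | z <= r] by [].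
  apply: preimage_closed; last exact: closed_le.
  by move=> x _; exact: continuous_quart.
- by do !apply: compact_setX.
- move=> x /= xr.
  have s1 : sqnorm x <= 1.
    by rewrite -(@ler_pXn2r _ 2)// ?nnegrE ?sqnorm_ge0// expr1n (le_trans xr).
  have H (i : 'I_4) : I (coord4 i x).
    rewrite /I /= in_itv/= -ler_norml -(@ler_pXn2r _ 2)// ?nnegrE// expr1n real_normK ?num_real//.
    exact: le_trans (coord_sqr_le i x) s1.
  by split => //=; [split => //=; [split => //=|]|];
      [exact: (H 0)|exact: (H 1)|exact: (H 2)|exact: (H 3)].
Qed.

Lemma closed_quart_le (r : R) : closed [set x : R4 R | quart x <= r].
Proof.
have -> : [set x : R4 R | quart x <= r] = quart @^-1` [set z | z <= r] by [].
apply: preimage_closed; last exact: closed_le.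
by move=> x _; exact: continuous_quart.
Qed.

Lemma compact_bounded_fun (K : set (R4 R)) g : compact K -> continuous g ->
  exists2 M, 0 <= M & forall x, K x -> `|g x| <= M.
Proof.
move=> cK cg.
have : compact (g @` K) by apply: continuous_compact => //; exact: continuous_subspaceT.
move=> /compact_bounded [M [Mr HM]].
exists (`|M| + 1); first by rewrite addr_ge0.
move=> x Kx; apply: (HM (`|M| + 1)); last by exists x.
by rewrite (le_lt_trans (ler_norm _))// ltrDl.
Qed.

Lemma unit_ball_lty : (leb4 B < +oo)%E.
Proof.
apply: (@le_lt_trans _ _ (leb4 [set x | quart x <= 1])).
  apply: le_measure; rewrite ?inE; [exact: measurable_unit_ball|exact: measurable_quart_le|].
  by rewrite unit_ballE => x /= /ltW.
by rewrite lebesgue4_quart_le1 ltry.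
Qed.

Lemma continuous_bounded_ball g : continuous g ->
  exists2 M, 0 <= M & forall x, B x -> `|g x| <= M.
Proof.
move=> cg; have [M M0 HM] := compact_bounded_fun (compact_quart_le (lexx 1)) cg.
by exists M => // x; rewrite unit_ballE => /= /ltW; exact: HM.
Qed.

Lemma bounded_integrable_ball (g : R4 R -> R) (M : R) : measurable4 R B g ->
  (forall x, B x -> `|g x| <= M) -> leb4.-integrable B (EFin \o g).
Proof.
move=> mg gM; apply: measurable_bounded_integrable => //.
- exact: measurable_unit_ball.
- exact: unit_ball_lty.
- exists M; split; first exact: num_real.
  by move=> z Mz x Bx; exact: (le_trans (gM _ Bx) (ltW Mz)).
Qed.

Lemma continuous_integrable_ball g : continuous g -> leb4.-integrable B (EFin \o g).
Proof.
move=> cg; have [M M0 HM] := continuous_bounded_ball cg.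
apply: (bounded_integrable_ball _ HM).
by apply: measurable_funTS; exact: continuous_measurable4.
Qed.

Lemma closure_subset_closed (T : topologicalType) (A C : set T) : A `<=` C -> closed C ->
    closure A `<=` C.
Proof. by move=> AC /closure_id ->; exact: closure_subset. Qed.

Lemma test_function_quart f (r : R) : smooth f -> r < 1 -> (forall x, r <= quart x -> f x = 0) ->
  test_function f.
Proof.
move=> sf r1 f0.
have S : closure [set x | f x != 0] `<=` [set x : R4 R | quart x <= r].
  apply: closure_subset_closed; last exact: closed_quart_le.
  move=> x /=; apply: contra_neqP => /negP; rewrite -ltNge => /ltW; exact: f0.
split => //.
- apply: (subclosed_compact _ (compact_quart_le (ltW r1)) S); exact: closed_closure.
- by rewrite unit_ballE => x /S /= /le_lt_trans; exact.
Qed.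

Lemma test_function0 f x : test_function f -> ~ B x -> f x = 0.
Proof.
move=> [_ _ fB]; apply: contra_notP => fx; apply: fB.
by apply: subset_closure => /=; exact/eqP.
Qed.

Lemma partial_support f i : [set x | partial i f x != 0] `<=` closure [set x | f x != 0].
Proof.
move=> x /= dx; apply: contrapT => nx; move/negP : dx; apply.
have ox : open (~` closure [set x | f x != 0]) by exact/closed_openC/closed_closure.
have nf : \near x, cst (0 : R) x = f x.
  have := open_nbhs_nbhs (conj ox nx); apply: filterS => y /=.
  by move=> /= ny; apply/esym; apply: contra_notP ny => /eqP fy; exact: subset_closure.
apply/eqP; rewrite /partial -(near_eq_derive _ nf).
by rewrite derive_cst.
Qed.

Lemma test_function_partial f i : test_function f -> test_function (partial i f).
Proof.
move=> [sf cf fB].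
have S : closure [set x | partial i f x != 0] `<=` closure [set x | f x != 0].
  by apply: closure_subset_closed; [exact: partial_support|exact: closed_closure].
split.
- by apply/smoothP => n; apply: smoothn_partial; exact: (smoothP f).1.
- by apply: (subclosed_compact _ cf S); exact: closed_closure.
- exact: subset_trans S fB.
Qed.

Lemma smoothM f g : smooth f -> smooth g -> smooth (fun x => f x * g x).
Proof. by move=> /smoothP sf /smoothP sg; apply/smoothP => n; exact: smoothnM. Qed.

Lemma test_functionM f g : test_function f -> smooth g -> test_function (fun x => f x * g x).
Proof.
move=> [sf cf fB] sg.
have S : closure [set x | f x * g x != 0] `<=` closure [set x | f x != 0].
  by apply: closure_subset => x /=; apply: contra_neq => ->; rewrite mul0r.
split; first exact: smoothM.
- by apply: (subclosed_compact _ cf S); exact: closed_closure.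
- exact: subset_trans S fB.
Qed.

Lemma smooth_continuous f : smooth f -> continuous f.
Proof. by move=> sf; exact: (sf [::]).1. Qed.

Lemma smooth_is_derive f i x : smooth f -> is_derive x (basis4 i) f (partial i f x).
Proof. by move=> /smoothP /(_ 1%N); exact: smoothn_is_derive. Qed.

Lemma smooth_partial f i : smooth f -> smooth (partial i f).
Proof. by move=> /smoothP sf; apply/smoothP => n; exact: smoothn_partial. Qed.

Lemma test_function_bounded f : test_function f -> exists2 M, 0 <= M & forall x, `|f x| <= M.
Proof.
move=> tf; have [sf _ _] := tf.
have [M M0 HM] := continuous_bounded_ball (smooth_continuous sf).
exists M => // x; have [Bx|nBx] := pselect (B x); first exact: HM.
by rewrite (test_function0 tf nBx) normr0.
Qed.

Lemma is_derive_along f x v (s d : R) :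
  is_derive (s *: v + x) v f d -> is_derive s (1 : R) (fun h => f (h *: v + x)) d.
Proof.
have E : (fun h : R => h^-1 *: (((fun h => f (h *: v +
    x)) \o shift s) (h *: (1 : R)) - f (s *: v + x))) =
         (fun h : R => h^-1 *: ((f \o shift (s *: v + x)) (h *: v) - f (s *: v + x))).
  apply/funext => h /=; rewrite /GRing.scale /= mulr1.
  by congr (_ * (f _ - _)); rewrite addrA -scalerDl.
by move=> [d1 d2]; split; move: d1 d2; rewrite /derivable /derive E.
Qed.

Lemma smooth_lipschitz f i (M : R) : smooth f -> (forall x, `|partial i f x| <= M) ->
  forall (h : R) x, 0 <= h -> `|f (h *: basis4 i + x) - f x| <= M * h.
Proof.
move=> sf HM h x h0.
have d s : is_derive s (1 : R) (fun h => f (h *: basis4 i + x)) (partial i f (s *: basis4 i + x)).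
  by apply: is_derive_along; exact: smooth_is_derive.
have c : continuous (fun h : R => f (h *: basis4 i + x)).
  by move=> s; apply: differentiable_continuous; apply/derivable1_diffP; case: (d s).
have [s _] := MVT_segment h0 (fun s _ => d s) (continuous_subspaceT c).
rewrite scale0r add0r subr0 => ->.
by rewrite normrM (ger0_norm h0) ler_wpM2r.
Qed.

Lemma integral_translate4 (F : R4 R -> \bar R) (h : R4 R) : measurable4 R setT F ->
  (\int[leb4]_x F (affine4 1 h x) = \int[leb4]_x F x)%E.
Proof.
move=> mF; have H (G : R4 R -> \bar R) : measurable4 R setT G -> (forall x, (0 <= G x)%E) ->
    (\int[leb4]_x G (affine4 1 h x) = \int[leb4]_x G x)%E.
  by move=> mG G0; rewrite [RHS](ge0_integral_affine4 h (@ltr01 R))// expr1n mul1e.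
rewrite integralE [RHS]integralE; congr (_ - _)%E.
  transitivity (\int[leb4]_x F^\+ (affine4 1 h x))%E.
    by apply: eq_integral => x _; rewrite !funeposE.
  by apply: (H (F^\+)%E) => //; exact: measurable_funepos.
transitivity (\int[leb4]_x F^\- (affine4 1 h x))%E.
  by apply: eq_integral => x _; rewrite !funenegE.
by apply: (H (F^\-)%E) => //; exact: measurable_funeneg.
Qed.

(** A box containing the ball and all its translates along an axis by at most one, so that a
    multiple of its indicator dominates every difference quotient of a test function. *)
Let K : set (@measurableTypeR4 R) :=
  (`[- 2, 2]%classic `*` `[- 2, 2]%classic `*` `[- 2, 2]%classic `*` `[- 2, 2]%classic).

Let mK : measurable K.
Proof. by do !apply: measurableX; exact: measurable_itv. Qed.

Let K_lty : (leb4 K < +oo)%E.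
Proof.
rewrite /K lebesgue4X; try exact: measurable_itv.
by rewrite !lebesgue_measure_itv/= lte_fin; case: ifP => _; rewrite -?EFinD -?EFinM ?mul0e ltry.
Qed.

Let ball_add_basis (h : R) i x : `|h| <= 1 -> B (h *: basis4 i + x) -> K x.
Proof.
move=> h1; rewrite unit_ballE /= => Bx.
have s1 : sqnorm (h *: basis4 i + x) <= 1.
  by rewrite -(@ler_pXn2r _ 2)// ?nnegrE ?sqnorm_ge0// expr1n ltW.
have H (j : 'I_4) : (`[- 2, 2]%classic : set R) (coord4 j x).
  have : `|h * (j == i)%:R + coord4 j x| <= 1.
    rewrite -coord4_basis -coord4_line -(@ler_pXn2r _ 2)// ?nnegrE// expr1n real_normK ?num_real//.
    exact: le_trans (coord_sqr_le j _) s1.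
  move: h1; rewrite /= in_itv/= !ler_norml => /andP[? ?].
  by case: (j == i); rewrite ?mulr1 ?mulr0 => /andP[? ?]; apply/andP; split; lra.
by split => //=; [split => //=; [split => //=|]|]; [exact: (H 0)|exact: (H 1)|exact: (H 2)|exact: (H 3)].
Qed.

Let integrable_MK (M : R) : leb4.-integrable setT (fun x => (M%:E * (\1_K x)%:E)%E).
Proof.
apply: integrableZl => //; apply/integrableP; split.
  by apply/measurable_EFinP; exact: measurable_indic.
under eq_integral do rewrite /= ger0_norm//.
by rewrite integral_indic// setIT.
Qed.

Let bounded_integrable_K (G : R4 R -> R) (M : R) : measurable4 R setT G ->
  (forall x, `|G x| <= M * \1_K x) -> leb4.-integrable setT (EFin \o G).
Proof.
move=> mG GM; apply: (@le_integrable _ _ _ _ _ _ _ (fun x => (M%:E * (\1_K x)%:E)%E)) => //.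
- exact/measurable_EFinP.
- move=> x _ /=; rewrite lee_fin.
  exact: (le_trans (GM x) (ler_norm _)).
Qed.

Lemma affine4_1 (h x : R4 R) : affine4 1 h x = h + x.
Proof.
have -> : h + x = (h.1.1.1 + x.1.1.1, h.1.1.2 + x.1.1.2, h.1.2 + x.1.2, h.2 + x.2) by [].
by rewrite /affine4 !mul1r; congr (_, _, _, _); exact: addrC.
Qed.

(** Translation invariance makes the integral of each difference quotient vanish, and dominated
    convergence passes to the derivative. *)
Lemma integral_partial_test f i : test_function f ->
  (\int[leb4]_x (partial i f x)%:E = 0)%E.
Proof.
move=> tf; have [sf _ _] := tf.
have [M M0 HM] := test_function_bounded (test_function_partial i tf).
have [M' M'0 HM'] := test_function_bounded tf.
have mf : measurable4 R setT f by apply: continuous_measurable4; exact: smooth_continuous.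
pose F (n : nat) (x : R4 R) : R := n.+1%:R * (f (n.+1%:R^-1 *: basis4 i + x) - f x).
have n1 (n : nat) : `|n.+1%:R^-1 : R| <= 1 by rewrite ger0_norm// invf_le1// ler1n.
have K0 (n : nat) x : ~ K x -> f (n.+1%:R^-1 *: basis4 i + x) = 0 /\ f x = 0.
  move=> Kx; split; apply: (test_function0 tf); apply: contra_not Kx; first exact: ball_add_basis.
  by move=> Bx; apply: (@ball_add_basis 0 i); rewrite ?normr0// scale0r add0r.
have mfT (n : nat) : measurable4 R setT (fun x => f (n.+1%:R^-1 *: basis4 i + x)).
  have -> : (fun x => f (n.+1%:R^-1 *: basis4 i + x)) = f \o affine4 1 (n.+1%:R^-1 *: basis4 i).
    by apply/funext => x; rewrite /= affine4_1.
  exact: (measurableT_comp mf (measurable_affine4 _ _)).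
have mF (n : nat) : measurable4 R setT (F n).
  by apply: measurable_funM => //; apply: measurable_funB.
have FM (n : nat) x : `|F n x| <= M * \1_K x.
  have [Kx|Kx] := pselect (K x).
    rewrite indicE mem_set// mulr1 normrM ger0_norm// mulrC -ler_pdivlMr//.
    exact: smooth_lipschitz.
  have [fT0 f0] := K0 n x Kx.
  by rewrite /F fT0 f0 subrr mulr0 normr0 mulr_ge0.
have FM' n x : (`|(F n x)%:E| <= M%:E * (\1_K x)%:E)%E by rewrite lee_fin.
have iK (G : R4 R -> R) : measurable4 R setT G -> (forall x, `|G x| <= M' * \1_K x) ->
    leb4.-integrable setT (EFin \o G).
  exact: bounded_integrable_K.
have if_ : leb4.-integrable setT (EFin \o f).
  apply: iK => // x; have [Kx|Kx] := pselect (K x); first by rewrite indicE mem_set// mulr1.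
  by rewrite (K0 0%N x Kx).2 normr0 mulr_ge0.
have ifT (n : nat) : leb4.-integrable setT (EFin \o (fun x => f (n.+1%:R^-1 *: basis4 i + x))).
  apply: iK => // x; have [Kx|Kx] := pselect (K x); first by rewrite indicE mem_set// mulr1.
  by rewrite (K0 n x Kx).1 normr0 mulr_ge0.
have IF (n : nat) : (\int[leb4]_x (F n x)%:E = 0)%E.
  under eq_integral do rewrite EFinM.
  rewrite integralZl//; last first.
    by have := integrableB measurableT (ifT n) if_; apply: eq_integrable.
  rewrite integralB_EFin//.
  have -> : (\int[leb4]_x (f (n.+1%:R^-1 *: basis4 i + x))%:E = \int[leb4]_x (f x)%:E)%E.
    rewrite -(@integral_translate4 (EFin \o f) (n.+1%:R^-1 *: basis4 i)); last exact/measurable_EFinP.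
    by apply: eq_integral => x _; rewrite /= affine4_1.
  by rewrite subee ?mule0//; exact: integrable_fin_num.
have cF x : (F n x)%:E @[n --> \oo] --> (partial i f x)%:E.
  apply/cvg_EFin; first by near=> n.
  have := smooth_is_derive i x sf; move=> [d dE].
  have : (fun h : R => h^-1 *: (f (h *: basis4 i + x) - f x)) @ 0^' --> partial i f x.
    exact: d.
  move=> /cvgr_dnbhsP /(_ harmonic) H.
  have hh : (forall n, harmonic n != 0 :> R) /\ @harmonic R n @[n --> \oo] --> 0.
    by split; [move=> n; rewrite invr_eq0|exact: cvg_harmonic].
  have -> : fine \o (fun n => (F n x)%:E) = (fun n =>
      (harmonic n)^-1 *: (f (harmonic n *: basis4 i + x) - f x)).
    by apply/funext => n; rewrite /F /= invrK.
  exact: H hh.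
have mp : measurable4 R setT (partial i f).
  by apply: continuous_measurable4; apply: smooth_continuous; exact: smooth_partial.
have ig : leb4.-integrable setT (fun x => (M%:E * (\1_K x)%:E)%E).
  exact: integrable_MK.
have mF' n : measurable4 R setT (fun x => (F n x)%:E) by exact/measurable_EFinP.
have mp' : measurable4 R setT (fun x => (partial i f x)%:E) by exact/measurable_EFinP.
have [_ _] := dominated_convergence measurableT mF' mp' (aeW leb4 (fun x _ => cF x)) ig
  (aeW leb4 (fun x n _ => FM' n x)).
rewrite /=; under eq_fun do rewrite IF.
by move=> /cvg_lim <-//; rewrite lim_cst.
Unshelve. all: by end_near. Qed.

Lemma Rintegral_partial_test f i : test_function f ->
  \int[leb4]_(x in B) partial i f x = 0.
Proof.
move=> tf; have t1 := test_function_partial i tf.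
rewrite /Rintegral integral_mkcond.
have -> : (fun x => (partial i f x)%:E) \_ B = (fun x => (partial i f x)%:E).
  apply/funext => x; rewrite patchE; case: ifPn => // /negP nB.
  by rewrite (test_function0 t1)// => Bx; apply: nB; rewrite inE.
by rewrite integral_partial_test.
Qed.

Lemma Rintegral_by_parts_test f g i : test_function f -> smooth g ->
  \int[leb4]_(x in B) (f x * partial i g x) = - \int[leb4]_(x in B) (partial i f x * g x).
Proof.
move=> tf sg; have [sf _ _] := tf.
have E : partial i (fun x => f x * g x) = (fun x => f x * partial i g x + partial i f x * g x).
  apply/funext => x; have := is_deriveM (smooth_is_derive i x sf) (smooth_is_derive i x sg).
  by move=> [_]; rewrite /partial /GRing.scale /= => ->; rewrite [X in _ + X]mulrC.
have c1 := smooth_continuous (smoothM sf (smooth_partial i sg)).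
have c2 := smooth_continuous (smoothM (smooth_partial i sf) sg).
apply/eqP; rewrite -addr_eq0; apply/eqP.
rewrite -(Rintegral_partial_test i (test_functionM tf sg)) E RintegralD//.
- exact: measurable_unit_ball.
- exact: continuous_integrable_ball c1.
- exact: continuous_integrable_ball c2.
Qed.

End TestFunctions.

Section L2ball.
Context {R : realType}.
Local Notation leb4 := (@lebesgue4 R).
Local Notation B := (@unit_ball R).
Implicit Types (u v w : R4 R -> R).

Let mB : measurable (B : set (@measurableTypeR4 R)) := measurable_unit_ball.

Lemma Lnorm2_restrict (D : set (R4 R)) u : measurable (D : set (@measurableTypeR4 R)) ->
  ('N[leb4]_2%:E[EFin \o (u \_ D)] = (\int[leb4]_(x in D) (u x ^+ 2)%:E) `^ 2^-1)%E.
Proof.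
move=> mD; rewrite unlock; congr (_ `^ _)%E.
rewrite [RHS]integral_mkcond; apply: eq_integral => x _; rewrite /= !patchE.
case: ifP => _; last by rewrite normr0 powR0.
by rewrite powR_mulrn// real_normK ?num_real.
Qed.

Lemma norm2E u : (norm2 u = (\int[leb4]_(x in B) (u x ^+ 2)%:E) `^ 2^-1)%E.
Proof. exact: Lnorm2_restrict. Qed.

Lemma L2P u : L2 u <-> measurable4 R B u /\ (\int[leb4]_(x in B) (u x ^+ 2)%:E < +oo)%E.
Proof.
have I0 : (0 <= \int[leb4]_(x in B) (u x ^+ 2)%:E)%E.
  by apply: integral_ge0 => x _; rewrite lee_fin sqr_ge0.
have N : finite_norm leb4 2%:E (u \_ B) <-> (\int[leb4]_(x in B) (u x ^+ 2)%:E < +oo)%E.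
  have -> : finite_norm leb4 2%:E (u \_ B) = (norm2 u < +oo)%E by [].
  rewrite norm2E; move: I0; case: (integral _ _ _) => [r||]//= _.
    by rewrite !ltry.
  by rewrite invr_eq0 pnatr_eq0.
have M := measurable_restrictT u mB.
split => [/andP[/[!inE] /= mu /N fu]|[mu fu]].
  by split => //; apply/M.
apply/andP; split; first by rewrite inE /=; apply/M.
by rewrite inE /=; apply/N.
Qed.

Lemma L2_measurable u : L2 u -> measurable4 R B u.
Proof. by move=> /L2P[]. Qed.

Definition sqint u : R := fine (\int[leb4]_(x in B) (u x ^+ 2)%:E).

Lemma sqint_ge0 u : 0 <= sqint u.
Proof. by apply/fine_ge0/integral_ge0 => x _; rewrite lee_fin sqr_ge0. Qed.

Lemma sqintE u : L2 u -> (\int[leb4]_(x in B) (u x ^+ 2)%:E = (sqint u)%:E)%E.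
Proof.
move=> /L2P[_ fu]; rewrite /sqint fineK// ge0_fin_numE//.
by apply: integral_ge0 => x _; rewrite lee_fin sqr_ge0.
Qed.

Lemma norm2_sqint u : L2 u -> norm2 u = (Num.sqrt (sqint u))%:E.
Proof.
by move=> Lu; rewrite norm2E sqintE// poweR_EFin powR12_sqrt// sqint_ge0.
Qed.

(** Takes upper bounds [a] and [b] in place of the square integrals, and any measurable domain,
    because on annuli one of those integrals is only estimated. *)
Lemma cauchy_schwarz (D : set (R4 R)) u v (a b : R) : measurable (D : set (@measurableTypeR4 R)) ->
  measurable4 R D u -> measurable4 R D v -> 0 <= a -> 0 <= b ->
  (\int[leb4]_(x in D) (u x ^+ 2)%:E <= a%:E)%E ->
  (\int[leb4]_(x in D) (v x ^+ 2)%:E <= b%:E)%E ->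
  (\int[leb4]_(x in D) `|u x * v x|%:E <= (Num.sqrt a * Num.sqrt b)%:E)%E.
Proof.
move=> mD mu mv a0 b0 ua vb.
have mu' := (measurable_restrictT u mD).1 mu.
have mv' := (measurable_restrictT v mD).1 mv.
have half : (2 : R)^-1 + 2^-1 = 1 by field.
have := hoelder leb4 mu' mv' (ltr0n _ 2) (ltr0n _ 2) half.
rewrite !Lnorm2_restrict// Lnorm1.
have -> : (\int[leb4]_x `|(EFin \o (u \_ D \* v \_ D)%R) x| = \int[leb4]_(x in D) `|u x * v x|%:E)%E.
  rewrite [RHS]integral_mkcond; apply: eq_integral => x _; rewrite /= !patchE.
  by case: ifP => _; rewrite ?mul0r ?normr0.
move=> /le_trans; apply; rewrite EFinM.
have pw (f : R4 R -> R) (c : R) : 0 <= c -> (\int[leb4]_(x in D) (f x ^+ 2)%:E <= c%:E)%E ->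
    ((\int[leb4]_(x in D) (f x ^+ 2)%:E) `^ 2^-1 <= (Num.sqrt c)%:E)%E.
  move=> c0 fc; rewrite -powR12_sqrt// -poweR_EFin.
  apply: gt0_ler_poweR => //; rewrite ?invr_ge0 ?in_itv/= ?leey ?andbT ?lee_fin//.
  by apply: integral_ge0 => x _; rewrite lee_fin sqr_ge0.
by apply: lee_pmul; rewrite ?poweR_ge0// pw.
Qed.

Lemma L2_mul_integrable u v : L2 u -> L2 v -> leb4.-integrable B (EFin \o (fun x => u x * v x)).
Proof.
move=> Lu Lv; apply/integrableP; split.
  by apply/measurable_EFinP; apply: measurable_funM; exact: L2_measurable.
apply: le_lt_trans (ltry (Num.sqrt (sqint u) * Num.sqrt (sqint v))).
by apply: cauchy_schwarz; rewrite ?sqint_ge0 ?sqintE//; exact: L2_measurable.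
Qed.

Lemma bounded_L2 u (M : R) : measurable4 R B u -> (forall x, B x -> `|u x| <= M) -> L2 u.
Proof.
move=> mu uM; apply/L2P; split => //.
have H x : B x -> `|u x ^+ 2| <= M ^+ 2.
  move=> Bx; rewrite normrX; have H := uM _ Bx.
  by rewrite ler_pXn2r// ?nnegrE// (le_trans _ H).
have /integrableP[_] := bounded_integrable_ball (measurable_funX 2 mu) H.
have -> // : (\int[leb4]_(x in B) `|(EFin \o (fun x =>
    u x ^+ 2)%R) x| = \int[leb4]_(x in B) (u x ^+ 2)%:E)%E.
by apply: eq_integral => x _ /=; rewrite ger0_norm// sqr_ge0.
Qed.

Lemma continuous_L2 u : continuous u -> L2 u.
Proof.
move=> cu; have [M _ HM] := continuous_bounded_ball cu.
by apply: (bounded_L2 _ HM); apply: measurable_funTS; exact: continuous_measurable4.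
Qed.

Lemma L2_integrable u : L2 u -> leb4.-integrable B (EFin \o u).
Proof.
move=> Lu; have L1 : L2 (fun _ : R4 R => 1 : R) by apply: continuous_L2 => x; exact: cvg_cst.
have := L2_mul_integrable Lu L1; apply: eq_integrable => // x _ /=.
by rewrite mulr1.
Qed.

Lemma L2B u v : L2 u -> L2 v -> L2 (u \- v).
Proof.
move=> Lu Lv; apply/L2P; split; first by apply: measurable_funB; exact: L2_measurable.
have iu := L2_mul_integrable Lu Lu; have iv := L2_mul_integrable Lv Lv.
have iuv := L2_mul_integrable Lu Lv.
have := integrableD mB (integrableD mB iu iv) (integrableZl mB (- 2) iuv).
move=> /integrableP[_]; set J := integral _ _ _; have ->
    // : J = (\int[leb4]_(x in B) ((u \- v) x ^+ 2)%:E)%E.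
apply: eq_integral => x _ /=.
have -> : u x * u x + v x * v x + - 2 * (u x * v x) = (u x - v x) ^+ 2 by ring.
by rewrite ger0_norm// sqr_ge0.
Qed.

Lemma L2D u v : L2 u -> L2 v -> L2 (u \+ v).
Proof.
move=> Lu Lv; have L0 : L2 (fun _ : R4 R => 0 : R) by apply: continuous_L2 => x; exact: cvg_cst.
have := L2B Lu (L2B L0 Lv); congr L2.
by apply/funext => x /=; rewrite sub0r opprK.
Qed.

Lemma Rintegral_cauchy_schwarz u v : L2 u -> L2 v ->
  `|\int[leb4]_(x in B) (u x * v x)| <= Num.sqrt (sqint u) * Num.sqrt (sqint v).
Proof.
move=> Lu Lv; have i := L2_mul_integrable Lu Lv.
apply: (le_trans (le_normr_Rintegral mB i)).
rewrite -lee_fin; apply: le_trans; last first.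
  by apply: cauchy_schwarz (sqint_ge0 u) (sqint_ge0 v) _ _; first exact: mB; rewrite ?sqintE//;
      exact: L2_measurable.
rewrite /Rintegral fineK//.
by have := integrable_fin_num mB (integrable_abse i).
Qed.

End L2ball.

(** * The Green bound *)

Section GreenFields.
Context {R : realType}.
Local Notation leb4 := (@lebesgue4 R).
Local Notation B := (@unit_ball R).
Implicit Types (u v w : R4 R -> R).

Let mB : measurable (B : set (@measurableTypeR4 R)) := measurable_unit_ball.

(** Here zero boundary values are exploited: [Y] need not vanish near the sphere. The identity holds
    for the test functions approximating [u], and both sides pass to the limit by Cauchy-Schwarz. *)
Lemma sobolev10_by_parts u : sobolev10 u -> exists2 g : 'I_4 -> R4 R -> R,
  (forall i, L2 (g i)) & forall i Y, smooth Y ->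
  \int[leb4]_(x in B) (u x * partial i Y x) = - \int[leb4]_(x in B) (g i x * Y x).
Proof.
move=> [Lu [g [gP [phi [tphi cu cg]]]]]; exists g => [i|i Y sY]; first exact: (gP i).1.
have Lg : L2 (g i) := (gP i).1.
have sphi n : smooth (phi n) by have [] := tphi n.
have Lphi n : L2 (phi n) by apply: continuous_L2; exact: smooth_continuous.
have Ldphi n : L2 (partial i (phi n)).
  by apply: continuous_L2; apply: smooth_continuous; exact: smooth_partial.
have LY : L2 Y by apply: continuous_L2; exact: smooth_continuous.
have LdY : L2 (partial i Y).
  by apply: continuous_L2; apply: smooth_continuous; exact: smooth_partial.
apply/eqP; rewrite -addr_eq0 -normr_eq0 eq_le normr_ge0 andbT.
apply/ler_addgt0Pr => e e0; rewrite add0r.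
pose C := Num.sqrt (sqint (partial i Y)) + Num.sqrt (sqint Y) + 1.
have C0 : 0 < C by rewrite ltr_wpDl// addr_ge0// sqrtr_ge0.
have e1 : 0 < e / (2 * C) by rewrite divr_gt0// mulr_gt0.
have near0 (s : nat -> R4 R -> R) : (forall n, L2 (s n)) -> norm2 (s n) @[n --> \oo] --> 0%E ->
    \forall n \near \oo, Num.sqrt (sqint (s n)) <= e / (2 * C).
  move=> Ls /fine_cvgP[_ /cvgrPdist_le /(_ _ e1)]; apply: filterS => n /=.
  by rewrite norm2_sqint//= sub0r normrN ger0_norm// sqrtr_ge0.
have [n [H1 H2]] : exists n, Num.sqrt (sqint (u \- phi n)) <= e / (2 * C) /\
    Num.sqrt (sqint (g i \- partial i (phi n))) <= e / (2 * C).
  have N1 := near0 _ (fun n => L2B Lu (Lphi n)) cu.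
  have N2 := near0 _ (fun n => L2B Lg (Ldphi n)) (cg i).
  by near \oo => n; exists n; split; near: n.
have -> : \int[leb4]_(x in B) (u x * partial i Y x) + \int[leb4]_(x in B) (g i x * Y x) =
   \int[leb4]_(x in B) ((u \- phi n) x * partial i Y x) +
       \int[leb4]_(x in B) ((g i \- partial i (phi n)) x * Y x).
  have E1 : \int[leb4]_(x in B) ((u \- phi n) x * partial i Y x) =
     \int[leb4]_(x in B) (u x * partial i Y x) - \int[leb4]_(x in B) (phi n x * partial i Y x).
    rewrite -RintegralB//; [|exact: L2_mul_integrable|exact: L2_mul_integrable].
    by apply: eq_Rintegral => x _; rewrite /= mulrBl.
  have E2 : \int[leb4]_(x in B) ((g i \- partial i (phi n)) x * Y x) =
     \int[leb4]_(x in B) (g i x * Y x) - \int[leb4]_(x in B) (partial i (phi n) x * Y x).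
    rewrite -RintegralB//; [|exact: L2_mul_integrable|exact: L2_mul_integrable].
    by apply: eq_Rintegral => x _; rewrite /= mulrBl.
  by rewrite E1 E2 (Rintegral_by_parts_test i (tphi n) sY); ring.
apply: (le_trans (ler_normD _ _)).
have B1 := Rintegral_cauchy_schwarz (L2B Lu (Lphi n)) LdY.
have B2 := Rintegral_cauchy_schwarz (L2B Lg (Ldphi n)) LY.
apply: (le_trans (lerD B1 B2)).
apply: (@le_trans _ _ (e / (2 * C) * C + e / (2 * C) * C)).
  apply: lerD; apply: ler_pM; rewrite ?sqrtr_ge0//.
    by rewrite /C -addrA lerDl addr_ge0// sqrtr_ge0.
  by rewrite /C -addrA addrCA lerDl addr_ge0// sqrtr_ge0.
have -> // : e / (2 * C) * C + e / (2 * C) * C = e by field; rewrite gt_eqF.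
Unshelve. all: by end_near. Qed.

Lemma laplacian_by_parts u w phi : laplacian u w -> test_function phi -> L2 u ->
  \int[leb4]_(x in B) (w x * phi x) =
  \int[leb4]_(x in B) (u x * \sum_i partial i (partial i phi) x).
Proof.
move=> [h [hP ->]] tphi Lu; have [sphi _ _] := tphi.
have Lphi : L2 phi by apply: continuous_L2; exact: smooth_continuous.
have Ldd i : L2 (partial i (partial i phi)).
  by apply: continuous_L2; apply: smooth_continuous; do 2 apply: smooth_partial.
have Lh i : L2 (h i) := (hP i).1.
have E i : \int[leb4]_(x in B) (h i x * phi x) = \int[leb4]_(x in B) (u x * partial i (partial i phi) x).
  by have := (hP i).2 _ tphi; rewrite /= expr2 mulrNN !mul1r.
have sumE (F : 'I_4 -> R4 R -> R) : (forall i, leb4.-integrable B (EFin \o F i)) ->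
    \int[leb4]_(x in B) (F 0 x + F 1 x + F 2 x + F 3 x) =
    \int[leb4]_(x in B) F 0 x + \int[leb4]_(x in B) F 1 x + \int[leb4]_(x in B) F 2 x +
        \int[leb4]_(x in B) F 3 x.
  move=> iF; have i2 : leb4.-integrable B (EFin \o (fun x => F 0 x + F 1 x)).
    by have := integrableD mB (iF 0) (iF 1); apply: eq_integrable.
  have i3 : leb4.-integrable B (EFin \o (fun x => F 0 x + F 1 x + F 2 x)).
    by have := integrableD mB i2 (iF 2); apply: eq_integrable.
  by rewrite RintegralD// RintegralD// RintegralD.
have sum4 (F : 'I_4 -> R) : \sum_i F i = F 0 + F 1 + F 2 + F 3.
  rewrite !big_ord_recl big_ord0 addr0 !addrA.
  by do !congr (_ + _); congr F; apply: val_inj.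
transitivity (\int[leb4]_(x in B) (h 0 x * phi x + h 1 x * phi x + h 2 x * phi x + h 3 x * phi x)).
  by apply: eq_Rintegral => x _; rewrite sum4 !mulrDl.
rewrite (sumE (fun i x => h i x * phi x)); last by move=> i; exact: L2_mul_integrable.
rewrite !E -(sumE (fun i x => u x * partial i (partial i phi) x)); last by move=> i;
    exact: L2_mul_integrable.
by apply: eq_Rintegral => x _; rewrite sum4 !mulrDr.
Qed.

End GreenFields.

Section StepField.
Context {R : realType}.
Implicit Types (x : R4 R).

(* Coincides with [quart x] where [step ((quart x - c) / e)] does not vanish,
   and never vanishes. *)
Definition safe_quart (c : R) x : R := quart x + flat 0 (c - quart x).

Lemma safe_quart_gt0 c x : 0 < c -> 0 < safe_quart c x.
Proof.
move=> c0; rewrite /safe_quart; have [qc|cq] := ltP (quart x) c.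
  by rewrite ltr_wpDl ?quart_ge0// flat_gt0// subr_gt0.
by rewrite ltr_pwDl ?flat_ge0// (lt_le_trans c0).
Qed.

Lemma safe_quartE c x : c <= quart x -> safe_quart c x = quart x.
Proof. by move=> cx; rewrite /safe_quart flat_le0 ?addr0// subr_le0. Qed.

Lemma smoothn_safe_quart n c : smoothn n (safe_quart c).
Proof.
apply: smoothnD; first exact: smoothn_quart.
apply: (@smoothn_flat R n 0 (fun x => c - quart x)).
by apply: smoothnB; [exact: smoothn_cst|exact: smoothn_quart].
Qed.

(* The field [x / |x|^4] is divergence free away from the origin, so that the
   divergence of its product with a step only sees the derivative of the step. *)
Definition step_field (c e : R) (i : 'I_4) x : R :=
  coord4 i x * (step ((quart x - c) / e) / safe_quart c x).

Lemma smoothn_step_field n c e i : 0 < c -> smoothn n (step_field c e i).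
Proof.
move=> c0; apply: smoothnM; first exact: smoothn_coord4.
apply: smoothnM; last first.
  apply: smoothnV; last exact: smoothn_safe_quart.
  by move=> x; rewrite gt_eqF// safe_quart_gt0.
apply: (@smoothn_step R n (fun x => (quart x - c) / e)).
apply: smoothnM; last exact: smoothn_cst.
by apply: smoothnB; [exact: smoothn_quart|exact: smoothn_cst].
Qed.

Lemma is_derive_step_field c e i x : 0 < c -> 0 < e ->
  is_derive x (basis4 i) (step_field c e i)
    (if quart x <= c then 0 else
     step ((quart x - c) / e) / quart x + dstep ((quart x - c) / e) / e * (4 * sqnorm x *
         coord4 i x ^+ 2) / quart x
     - step ((quart x - c) / e) * (4 * sqnorm x * coord4 i x ^+ 2) / quart x ^+ 2).
Proof.
move=> c0 e0.
have dq := is_derive_quart i x.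
have dc : is_derive x (basis4 i) (coord4 i) 1 by have := is_derive_coord4 i i x; rewrite eqxx.
have dl : is_derive (quart x) (1 : R) (fun q : R => (q - c) / e) e^-1.
  have H := is_deriveM (is_deriveB (is_derive_id (quart x) (1 : R)) (is_derive_cst c (quart x) (1
      : R))) (is_derive_cst e^-1 (quart x) (1 : R)).
  by apply: (is_derive_eq H); rewrite /GRing.scale /=; ring.
have dS : is_derive x (basis4 i) (fun x => step ((quart x - c) / e))
   (dstep ((quart x - c) / e) * e^-1 * (4 * sqnorm x * coord4 i x)).
  apply: (is_derive_chain (F := fun q => step ((q - c) / e))) dq.
  exact: (is_derive1_comp (is_derive_step _) dl).
have dfl : is_derive (quart x) (1 : R) (fun q : R => flat 0 (c - q)) (- (flat 2 (c - quart x))).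
  have H := is_derive_flat 0 (c - quart x); rewrite mul0r subr0 in H.
  have H2 : is_derive (quart x) (1 : R) (fun q : R => c - q) (0 - 1).
    exact: is_deriveB.
  by have := @is_derive1_comp R (flat 0) (fun q => c - q) (quart x) _ _ H H2; rewrite sub0r mulrN1.
have dD : is_derive x (basis4 i) (safe_quart c) ((1 - flat 2 (c - quart x)) * (4 * sqnorm x *
    coord4 i x)).
  have H := is_deriveD dq (is_derive_chain dfl dq).
  by apply: (is_derive_eq H); ring.
have n0 : safe_quart c x != 0 by rewrite gt_eqF// safe_quart_gt0.
have dV : is_derive x (basis4 i) (fun x => (safe_quart c x)^-1)
   (- (safe_quart c x) ^- 2 *: ((1 - flat 2 (c - quart x)) * (4 * sqnorm x * coord4 i x))).
  by split; [apply: derivableV => //; case: dD|rewrite deriveV//; case: dD => // _ ->].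
have dSV : is_derive x (basis4 i) (fun x => step ((quart x - c) / e) / safe_quart c x) _ :=
    is_deriveM dS dV.
have H := is_deriveM dc dSV.
apply: (is_derive_eq H); rewrite /GRing.scale /=.
case: leP => [qc|cq].
  have q0 : (quart x - c) / e <= 0 by rewrite pmulr_lle0 ?invr_gt0// subr_le0.
  by rewrite (step_le0 q0) (dstep_le0 q0); ring.
have q0 : quart x != 0 by rewrite gt_eqF// (lt_trans c0).
rewrite (safe_quartE (ltW cq)) (@flat_le0 R 2 (c - quart x)) ?subr_le0 ?ltW//.
by field; rewrite q0 gt_eqF.
Qed.

(** The terms carrying [step] cancel: differentiating the four coordinates gives [4 / quart x], and
    differentiating the denominator gives the opposite, [- 4 sqnorm x ^ 2 / quart x ^ 2]. *)
Lemma div_step_field c e x : 0 < c -> 0 < e ->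
  \sum_i partial i (step_field c e i) x = 4 * (dstep ((quart x - c) / e) / e).
Proof.
move=> c0 e0; under eq_bigr do rewrite /partial (@derive_val _ _ _ _ _ _ _ (is_derive_step_field _
    x c0 e0)).
case: leP => [qc|cq].
  have q0 : (quart x - c) / e <= 0 by rewrite pmulr_lle0 ?invr_gt0// subr_le0.
  by rewrite big1// (dstep_le0 q0) mul0r mulr0.
have q0 : quart x != 0 by rewrite gt_eqF// (lt_trans c0).
set S := step _; set S' := dstep _.
transitivity (\sum_(i < 4) S / quart x + (\sum_(i < 4) coord4 i x * coord4 i x) *
   (S' / e * (4 * sqnorm x) / quart x - S * (4 * sqnorm x) / quart x ^+ 2)).
  rewrite mulr_suml -big_split /=; apply: eq_bigr => i _.
  by field; rewrite q0 gt_eqF.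
rewrite -sqnormE sumr_const card_ord -mulr_natl.
have -> : quart x = sqnorm x ^+ 2 by [].
have s0 : sqnorm x != 0 by apply: contra_neq q0; rewrite /quart => ->; rewrite expr0n.
by field; rewrite s0 gt_eqF.
Qed.

End StepField.

(** * Compactly supported radial potentials *)

Section Potential.
Context {R : realType}.
Local Notation mu := (@lebesgue_measure R).

Lemma continuous_antiderivative (n : R -> R) : continuous n ->
  exists2 N : R -> R, N 1 = 0 & forall q : R, 0 <= q -> is_derive q (1 : R) N (n q).
Proof.
(* Starting the integral at [-1] makes [0] an interior point, so that the derivative there is
   two-sided. *)
move=> cn; pose F (q : R) := \int[mu]_(t in `[(-1)%R, q]) n t.
exists (fun q => F q - F 1) => [|q q0]; first by rewrite subrr.
have qu : q < q + 1 by rewrite ltrDl.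
have i : mu.-integrable `[(-1)%R, (q + 1)%R] (EFin \o n).
  apply: continuous_compact_integrable; first exact: segment_compact.
  exact: continuous_subspaceT.
have q1 : -1 < q by rewrite (lt_le_trans _ q0)// ltrN10.
have [d dE] := continuous_FTC1_closed qu i q1 (cn q).
have dF : is_derive q (1 : R) F (n q) by split; [exact: d|rewrite -derive1E; exact: dE].
by have := is_deriveB dF (is_derive_cst (F 1) q (1 : R)); rewrite subr0.
Qed.

(** Smoothness of the composite is read off its gradient [M], so that [N] has to be differentiated
    only once. *)
Lemma smooth_quart_comp (N n : R -> R) (M : 'I_4 -> R4 R -> R) :
  (forall q : R, 0 <= q -> is_derive q (1 : R) N (n q)) ->
  (forall i x, n (quart x) * (4 * sqnorm x * coord4 i x) = M i x) ->
  (forall k i, smoothn k (M i)) ->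
  smooth (N \o quart) /\ forall i, partial i (N \o quart) = M i.
Proof.
move=> dN nM sM.
have d i x : is_derive x (basis4 i) (N \o quart) (M i x).
  by rewrite -nM; apply: is_derive_chain (is_derive_quart i x); exact/dN/quart_ge0.
have c : continuous (N \o quart).
  move=> x; apply: continuous_comp; first exact: continuous_quart.
  apply: differentiable_continuous; apply/derivable1_diffP.
  by case: (dN _ (quart_ge0 x)).
split; last by move=> i; apply/funext => x; case: (d i x).
apply/smoothP => k; apply: smoothnS; apply: (smoothn_derive c d) => i; exact: sM.
Qed.

Lemma MVT_ge0 (N n : R -> R) (p q : R) : (forall q : R, 0 <= q -> is_derive q (1 : R) N (n q)) ->
  0 <= p -> p <= q -> exists2 c, p <= c <= q & N q - N p = n c * (q - p).
Proof.
move=> dN p0 pq.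
have dW c : c \in `]p, q[ -> is_derive c (1 : R) N (n c).
  by rewrite in_itv/= => /andP[pc _]; apply: dN; rewrite (le_trans p0)// ltW.
have cN : {within `[p, q], continuous N}.
  apply: derivable_within_continuous => c; rewrite in_itv/= => /andP[pc _].
  by case: (dN c (le_trans p0 pc)).
by have [c] := MVT_segment pq dW cN; rewrite in_itv/=; exists c.
Qed.

Variables (a e b d : R).
Hypotheses (a0 : 0 < a) (e0 : 0 < e) (d0 : 0 < d) (aeb : a + e <= b) (bd1 : b + d < 1).

Let H (t : R) := step ((t - a) / e) - step ((t - b) / d).

Let b0 : 0 < b. Proof. by rewrite (lt_le_trans _ aeb)// addr_gt0. Qed.

Let H_le_a (t : R) : t <= a -> H t = 0.
Proof.
move=> ta; rewrite /H !step_le0 ?subrr//; rewrite pmulr_lle0 ?invr_gt0// subr_le0//.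
by rewrite (le_trans ta)// (le_trans _ aeb)// lerDl ltW.
Qed.

Let H_ge (t : R) : b + d <= t -> H t = 0.
Proof.
move=> tb; rewrite /H !step_ge1 ?subrr//; rewrite ler_pdivlMr// mul1r.
  by rewrite lerBrDr addrC.
by rewrite lerBrDr addrC (le_trans aeb)// (le_trans _ tb)// lerDl ltW.
Qed.

Let H01 (t : R) : 0 <= H t <= 1.
Proof.
rewrite /H; have [tb|bt] := leP t b.
  rewrite (@step_le0 _ ((t - b) / d)) ?subr0 ?step_ge0 ?step_le1//.
  by rewrite pmulr_lle0 ?invr_gt0// subr_le0.
rewrite (@step_ge1 _ ((t - a) / e)); last by rewrite ler_pdivlMr// mul1r lerBrDr addrC (le_trans
    aeb)// ltW.
by rewrite subr_ge0 step_le1/= gerDl oppr_le0 step_ge0.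
Qed.

(** On the support of [H] this is [H / (4 t^(3/2))], chosen so that its product with the gradient of
    [quart] is the difference of the two step fields. The maximum with [a] removes the singularity
    at [0], in a range where [H] vanishes. *)
Let nu (t : R) := H t / (4 * (Num.max t a * Num.sqrt (Num.max t a))).

Let max_gt0 (t : R) : 0 < Num.max t a. Proof. by rewrite lt_max a0 orbT. Qed.

Let continuous_nu : continuous nu.
Proof.
have caff (c k : R) : continuous (fun t : R => step ((t - c) / k)).
  move=> t; apply: (@continuous_comp _ _ _ (fun t : R => (t - c) / k) step); last exact: continuous_step.
  by apply: cvgM; [apply: cvgB; [exact: cvg_id|exact: cvg_cst]|exact: cvg_cst].
have cm : continuous (fun t : R => Num.max t a).
  by move=> t; apply: continuous_max; [exact: cvg_id|exact: cvg_cst].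
move=> t; apply: cvgM; first by apply: cvgB; exact: caff.
apply: cvgV; first by rewrite gt_eqF// !mulr_gt0// sqrtr_gt0.
apply: cvgM; first exact: cvg_cst.
apply: cvgM; first exact: cm.
apply: (@continuous_comp _ _ _ (fun t : R => Num.max t a) Num.sqrt); first exact: cm.
exact: sqrt_continuous.
Qed.

(* Subtracting a second step near the boundary makes the potential compactly
   supported in the ball. *)
Lemma step_potential : exists phi : R4 R -> R,
  [/\ test_function phi,
      forall i, partial i phi = (fun x => step_field a e i x - step_field b d i x) &
      forall x, unit_ball x -> `|phi x| <= (2 * Num.max (sqnorm x) (Num.sqrt a))^-1].
Proof.
have [N N1 dN] := continuous_antiderivative continuous_nu.
have sM k i : smoothn k (fun x => step_field a e i x - step_field b d i x).
  by apply: smoothnB; exact: smoothn_step_field.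
have nM i x : nu (quart x) * (4 * sqnorm x * coord4 i x) = step_field a e i x - step_field b d i x.
  rewrite /step_field -mulrBr mulrC.
  have [xa|ax] := leP (quart x) a.
    rewrite /nu H_le_a// !step_le0 ?mul0r ?subrr ?mulr0//; rewrite pmulr_lle0 ?invr_gt0// subr_le0//.
    by rewrite (le_trans xa)// (le_trans _ aeb)// lerDl ltW.
  have q0 : 0 < quart x by exact: lt_trans ax.
  have s0 : 0 < sqnorm x.
    by rewrite lt_neqAle sqnorm_ge0 andbT; apply: contraTneq q0; rewrite /quart => <-;
        rewrite expr0n ltxx.
  rewrite (safe_quartE (ltW ax)) /nu (max_idPl (ltW ax)) sqrt_quart.
  have E : H (quart x) / (4 * (quart x * sqnorm x)) * (4 * sqnorm x * coord4 i x) =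
      coord4 i x * (H (quart x) / quart x).
    by field; rewrite !gt_eqF.
  rewrite mulrC E; congr (_ * _); rewrite /H mulrBl; congr (_ - _).
  have [xb|bx] := leP (quart x) b.
    by rewrite step_le0 ?mul0r// pmulr_lle0 ?invr_gt0// subr_le0.
  by rewrite safe_quartE// ltW.
have [sphi dphi] := smooth_quart_comp dN nM sM.
have N0 (q : R) : b + d <= q -> N q = 0.
  move=> bq; have [q1|q1] := leP q 1.
    have [c /andP[c1 c2] E] := MVT_ge0 dN (le_trans (ltW (addr_gt0 b0 d0)) bq) q1.
    have nc : nu c = 0 by rewrite /nu H_ge ?mul0r// (le_trans bq).
    by move/eqP: E; rewrite nc mul0r N1 sub0r oppr_eq0 => /eqP.
  have [c /andP[c1 c2] E] := MVT_ge0 dN ler01 (ltW q1).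
  have nc : nu c = 0 by rewrite /nu H_ge ?mul0r// (le_trans (ltW bd1)).
  by move/eqP: E; rewrite nc mul0r N1 subr0 => /eqP.
exists (N \o quart); split => //.
  by apply: (@test_function_quart R _ (b + d)) => // x bx; exact: N0.
move=> x; rewrite unit_ballE /= => x1; set q := quart x in x1 *.
have q0 : 0 <= q by exact: quart_ge0.
have nu0 (t : R) : 0 <= nu t.
  by rewrite /nu divr_ge0//; [case/andP : (H01 t)|rewrite !mulr_ge0// ?sqrtr_ge0// ltW].
have Nle0 : N q <= 0.
  have [c _ E] := MVT_ge0 dN q0 (ltW x1); rewrite N1 sub0r in E.
  by rewrite -oppr_ge0 E mulr_ge0// subr_ge0 ltW.
rewrite ler0_norm//.
(* Comparison with the uncut potential: as [H <= 1], the function [N t + 1 / (2 sqrt t)] has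
   nonpositive derivative on [[p, 1]], and it equals [1 / 2] at [1]. *)
have ge_a (p : R) : a <= p -> p < 1 -> - N p <= (2 * Num.sqrt p)^-1.
  move=> ap p1; have p0 : 0 < p by exact: lt_le_trans ap.
  have dQ (t : R) : t \in `]p, 1[ -> is_derive t (1 : R) (fun t =>
      N t + (2 * Num.sqrt t)^-1) (nu t - (4 * (t * Num.sqrt t))^-1).
    rewrite in_itv/= => /andP[pt _]; have t0 : 0 < t by exact: lt_trans pt.
    have s0 : 0 < Num.sqrt t by rewrite sqrtr_gt0.
    have d1 := is_derive1_sqrt t0.
    have d2 : is_derive t (1 : R) (fun t => 2 * Num.sqrt t) (Num.sqrt t)^-1.
      have X := is_deriveM (is_derive_cst (2 : R) t (1 : R)) d1.
      by apply: (is_derive_eq X); rewrite /GRing.scale /= /cst; field; rewrite gt_eqF.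
    have n2 : 2 * Num.sqrt t != 0 by rewrite gt_eqF// mulr_gt0.
    have X := is_deriveD (dN t (ltW t0)) (@is_deriveV _ (fun t => 2 * Num.sqrt t) _ _ _ n2 d2).
    apply: (is_derive_eq X); congr (_ + _); rewrite /GRing.scale /=.
    rewrite -[X in (4 * (X * _))^-1](sqr_sqrtr (ltW t0)).
    by field; rewrite gt_eqF.
  have cQ : {within `[p, 1], continuous (fun t => N t + (2 * Num.sqrt t)^-1)}.
    apply: continuous_in_subspaceT => t; rewrite inE /= in_itv/= => /andP[pt _].
    have t0 : 0 < t by exact: lt_le_trans pt.
    apply: cvgD.
      apply: differentiable_continuous; apply/derivable1_diffP.
      by case: (dN _ (ltW t0)).
    apply: cvgV; first by rewrite gt_eqF// mulr_gt0// sqrtr_gt0.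
    by apply: cvgM; [exact: cvg_cst|exact: sqrt_continuous].
  have [c] := MVT_segment (ltW p1) dQ cQ; rewrite in_itv/= => /andP[pc _].
  rewrite N1 sqrtr1 mulr1 add0r => E.
  have c0 : 0 < c by exact: lt_le_trans pc.
  have s0 : 0 < Num.sqrt c by rewrite sqrtr_gt0.
  have nuc : nu c <= (4 * (c * Num.sqrt c))^-1.
    rewrite /nu (max_idPl (le_trans ap pc)) ler_piMl//; last by case/andP : (H01 c).
    by rewrite invr_ge0 !mulr_ge0// ltW.
  have : (nu c - (4 * (c * Num.sqrt c))^-1) * (1 - p) <= 0.
    by rewrite mulr_le0_ge0// ?subr_le0// subr_ge0 ltW.
  rewrite -E; lra.
have [aq|qa] := leP a q.
  have -> : Num.max (sqnorm x) (Num.sqrt a) = Num.sqrt q.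
    by rewrite -(sqrt_quart x) (max_idPl _)// ler_sqrt.
  exact: ge_a.
have -> : Num.max (sqnorm x) (Num.sqrt a) = Num.sqrt a.
  by rewrite -(sqrt_quart x) (max_idPr _)// ler_sqrt// ltW.
(* Below [a] the profile is constant, so the bound at [a] applies. *)
have [c /andP[_ ca] E] := MVT_ge0 dN q0 (ltW qa).
have nc : nu c = 0 by rewrite /nu H_le_a ?mul0r.
have -> : N q = N a by move/eqP : E; rewrite nc mul0r subr_eq0 => /eqP ->.
apply: ge_a => //; apply: lt_trans bd1; apply: (@le_lt_trans _ _ b); last by rewrite ltrDl.
by rewrite (le_trans _ aeb)// lerDl ltW.
Qed.

End Potential.

Section GreenBound.
Context {R : realType}.
Local Notation leb4 := (@lebesgue4 R).
Local Notation B := (@unit_ball R).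
Implicit Types (u v w : R4 R -> R).

Let mB : measurable (B : set (@measurableTypeR4 R)) := measurable_unit_ball.

Lemma measurable_quart_gt (b : R) : measurable ([set x | b < quart x] : set (@measurableTypeR4 R)).
Proof.
rewrite -[X in measurable X]setTI.
have -> : [set x | b < quart x] = quart @^-1` `]b, +oo[ by apply/seteqP; split => x;
    rewrite /= in_itv/= andbT.
exact: measurable_quart.
Qed.

(** Dominated convergence over boundary layers shrinking to the sphere. Applied to the weak gradient
    of [u], it removes the contribution of the cutoff of the potential. *)
Lemma cvg_boundary_tail g : L2 g ->
  \int[leb4]_(x in B) (`|g x| * \1_[set x | 1 - n.+1%:R^-1 < quart x] x) @[n --> \oo] --> (0 : R).
Proof.
move=> Lg; have ig := L2_integrable Lg.
pose f (n : nat) (x : R4 R) : R := `|g x| * \1_[set x | 1 - n.+1%:R^-1 < quart x] x.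
have mf n : measurable4 R B (f n).
  apply: measurable_funM; first by apply: measurableT_comp => //; exact: L2_measurable.
  by apply: measurable_funTS; apply: measurable_indic; exact: measurable_quart_gt.
have mf' n : measurable4 R B (fun x => (f n x)%:E) by exact/measurable_EFinP.
have m0 : measurable4 R B (fun x => 0%:E : \bar R) by exact: measurable_cst.
have cf x : B x -> (f n x)%:E @[n --> \oo] --> (0%:E : \bar R).
  rewrite unit_ballE /= => x1; apply/cvg_EFin; first by near=> n.
  apply: cvg_near_cst; near=> n; rewrite /f /= indicE memNset ?mulr0//=.
  apply/negP; rewrite -leNgt lerBrDr -lerBrDl ltW//.
  by near: n; apply: (near_infty_natSinv_lt (PosNum (_ : 0 < 1 - quart x))); rewrite subr_gt0.
have fM x (n : nat) : B x -> (`|(f n x)%:E| <= `|g x|%:E)%E.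
  move=> _; rewrite lee_fin /f normrM normr_id ler_piMr// indicE.
  by case: (_ \in _); rewrite ?normr1 ?normr0.
have ig' : leb4.-integrable B (fun x => `|g x|%:E) by exact: integrable_norm ig.
have [_ _] := dominated_convergence mB mf' m0 (aeW leb4 cf) ig' (aeW leb4 (fun x n => @fM x n)).
rewrite integral0 => /fine_cvgP[_]; exact.
Unshelve. all: by end_near. Qed.

(* Up to a factor, the kernel is the average of [|x - y|^-2] over the sphere
   [quart y = a]. *)
Definition green_potential w (a : R) : R :=
  \int[leb4]_(x in B) (`|w x| / Num.max (sqnorm x) (Num.sqrt a)).

Lemma continuous_green_kernel (a : R) : 0 < a -> continuous (fun x : R4 R =>
    (Num.max (sqnorm x) (Num.sqrt a))^-1).
Proof.
move=> a0 x; apply: cvgV; first by rewrite gt_eqF// lt_max sqrtr_gt0 a0 orbT.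
by apply: continuous_max; [exact: continuous_sqnorm|exact: cvg_cst].
Qed.

Lemma L2_norm u : L2 u -> L2 (fun x => `|u x|).
Proof.
move=> /L2P[mu fu]; apply/L2P; split; first exact: measurableT_comp.
by under eq_integral do rewrite real_normK ?num_real//.
Qed.

Lemma integrable_green_potential w (a : R) : L2 w -> 0 < a ->
  leb4.-integrable B (EFin \o (fun x => `|w x| / Num.max (sqnorm x) (Num.sqrt a))).
Proof.
move=> Lw a0; apply: L2_mul_integrable; first exact: L2_norm.
by apply: continuous_L2; exact: continuous_green_kernel.
Qed.

Lemma continuous_dstep_quart (c e : R) : continuous (fun x : R4 R => dstep ((quart x - c) / e) / e).
Proof.
move=> x; apply: cvgM; last exact: cvg_cst.
apply: (@continuous_comp _ _ _ (fun x : R4 R => (quart x - c) / e) dstep); last exact: continuous_dstep.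
by apply: cvgM; [apply: cvgB; [exact: continuous_quart|exact: cvg_cst]|exact: cvg_cst].
Qed.

Lemma step_field_bound (b d : R) i x : 2^-1 <= b -> 0 < d -> B x ->
  `|step_field b d i x| <= 2 * \1_[set x | b < quart x] x.
Proof.
move=> b2 d0; rewrite unit_ballE /= => x1.
have b0 : 0 < b by rewrite (lt_le_trans _ b2)// invr_gt0.
rewrite /step_field; have [xb|bx] := leP (quart x) b.
  rewrite step_le0 ?mul0r ?mulr0 ?normr0 ?mulr_ge0// pmulr_lle0 ?invr_gt0// subr_le0//.
rewrite indicE mem_set// mulr1 (safe_quartE (ltW bx)) normrM.
have s1 : sqnorm x <= 1.
  by rewrite -(@ler_pXn2r _ 2)// ?nnegrE ?sqnorm_ge0// expr1n ltW.
have c1 : `|coord4 i x| <= 1.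
  rewrite -(@ler_pXn2r _ 2)// ?nnegrE// expr1n real_normK ?num_real//.
  exact: le_trans (coord_sqr_le i x) s1.
rewrite -[X in _ <= X]mul1r; apply: ler_pM => //.
rewrite ger0_norm; last by rewrite divr_ge0 ?step_ge0 ?quart_ge0.
have q0 : 0 < quart x by exact: lt_trans bx.
rewrite ler_pdivrMr// (le_trans (step_le1 _))//.
by rewrite -ler_pdivrMl// mulr1 (le_trans b2)// ltW.
Qed.

(** The Laplacian of the test potential is [4] times a kernel concentrated near [quart x = a], minus
    [4] times one near the sphere. The latter is the divergence of a step field; by the zero
    boundary values of [u] it turns into an integral of the weak gradient over a thin layer, which
    tends to zero. What remains is bounded through the size of the potential. *)
Lemma green_bound u w (a e : R) : sobolev10 u -> laplacian u w -> L2 w ->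
  0 < a -> 0 < e -> a + e < 1 ->
  `|\int[leb4]_(x in B) (u x * (dstep ((quart x - a) / e) / e))| <= 8^-1 * green_potential w a.
Proof.
move=> su lu Lw a0 e0 ae1; have [Lu _] := su.
have [g Lg gP] := sobolev10_by_parts su.
set I := \int[leb4]_(x in B) _.
have Lh c k : L2 (fun x : R4 R => dstep ((quart x - c) / k) / k).
  by apply: continuous_L2; exact: continuous_dstep_quart.
have sum4 (F : 'I_4 -> R) : \sum_i F i = F 0 + F 1 + F 2 + F 3.
  rewrite !big_ord_recl big_ord0 addr0 !addrA.
  by do !congr (_ + _); congr F; apply: val_inj.
have key (b d : R) : 2^-1 <= b -> 0 < d -> a + e <= b -> b + d < 1 ->
    4 * `|I| <= 2^-1 * green_potential w a +
      \sum_i 2 * \int[leb4]_(x in B) (`|g i x| * \1_[set x | b < quart x] x).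
  move=> b2 d0 aeb bd1.
  have b0 : 0 < b by rewrite (lt_le_trans _ b2)// invr_gt0.
  have [phi [tphi dphi phiM]] := step_potential a0 e0 d0 aeb bd1.
  have [sphi _ _] := tphi.
  have Lphi : L2 phi by apply: continuous_L2; exact: smooth_continuous.
  have sY c k i : 0 < c -> smooth (@step_field R c k i).
    by move=> c0; apply/smoothP => n; exact: smoothn_step_field.
  have LY c k i : 0 < c -> L2 (@step_field R c k i).
    by move=> c0; apply: continuous_L2; apply: smooth_continuous; exact: sY.
  have LdY c k i j : 0 < c -> L2 (partial j (@step_field R c k i)).
    by move=> c0; apply: continuous_L2; apply: smooth_continuous; apply: smooth_partial; exact: sY.
  have lapphi x : \sum_i partial i (partial i phi) x =
      4 * (dstep ((quart x - a) / e) / e) - 4 * (dstep ((quart x - b) / d) / d).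
    rewrite -!div_step_field// -sumrB; apply: eq_bigr => i _; rewrite dphi.
    have := is_deriveB (smooth_is_derive i x (sY a e i a0)) (smooth_is_derive i x (sY b d i b0)).
    by move=> [_].
  have E1 := laplacian_by_parts lu tphi Lu.
  pose J := \int[leb4]_(x in B) (u x * (dstep ((quart x - b) / d) / d)).
  have E2 : \int[leb4]_(x in B) (u x * \sum_i partial i (partial i phi) x) = 4 * I - 4 * J.
    rewrite -!RintegralZl//; try exact: L2_mul_integrable.
    rewrite -RintegralB//; try by apply: integrableZl => //; exact: L2_mul_integrable.
      by apply: eq_Rintegral => x _; rewrite lapphi mulrBr !(mulrCA (u x)).
    by have := integrableZl mB 4 (L2_mul_integrable Lu (Lh a e)); apply: eq_integrable.
    by have := integrableZl mB 4 (L2_mul_integrable Lu (Lh b d)); apply: eq_integrable.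
  have E3 : 4 * J = - \sum_i \int[leb4]_(x in B) (g i x * step_field b d i x).
    rewrite -sumrN sum4 -(gP 0 _ (sY b d 0 b0)) -(gP 1 _ (sY b d 1 b0)) -(gP 2 _ (sY b d 2 b0))
        -(gP 3 _ (sY b d 3 b0)).
    have iF i : leb4.-integrable B (EFin \o (fun x => u x * partial i (step_field b d i) x)).
      by apply: L2_mul_integrable => //; exact: LdY.
    have i2 : leb4.-integrable B (EFin \o (fun x =>
        u x * partial 0 (step_field b d 0) x + u x * partial 1 (step_field b d 1) x)).
      by have := integrableD mB (iF 0) (iF 1); apply: eq_integrable.
    have i3 : leb4.-integrable B (EFin \o (fun x =>
        u x * partial 0 (step_field b d 0) x + u x * partial 1 (step_field b d 1) x +
        u x * partial 2 (step_field b d 2) x)).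
      by have := integrableD mB i2 (iF 2); apply: eq_integrable.
    rewrite -RintegralD// -RintegralD// -RintegralD// -RintegralZl//; last exact: L2_mul_integrable.
    apply: eq_Rintegral => x _; rewrite mulrCA -div_step_field// sum4 !mulrDr//.
  have E4 : 4 * I = \int[leb4]_(x in B) (w x * phi x) - \sum_i \int[leb4]_(x in B) (g i x *
      step_field b d i x).
    by rewrite E1 E2 -E3; ring.
  rewrite -(ger0_norm (ler0n R 4)) -normrM E4.
  apply: (le_trans (ler_normB _ _)); apply: lerD.
    have iwphi := L2_mul_integrable Lw Lphi.
    apply: (le_trans (le_normr_Rintegral mB iwphi)).
    have iK := integrable_green_potential Lw a0.
    rewrite /green_potential -RintegralZl//.
    apply: le_Rintegral => //.
    - exact: integrable_norm iwphi.
    - by have := integrableZl mB 2^-1 iK; apply: eq_integrable.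
    - move=> x Bx; rewrite normrM mulrCA ler_wpM2l//.
      by rewrite (le_trans (phiM x Bx))// invfM.
  apply: (le_trans (ler_norm_sum _ _ _)); apply: ler_sum => i _.
  have igY := L2_mul_integrable (Lg i) (LY b d i b0).
  apply: (le_trans (le_normr_Rintegral mB igY)).
  have itail : leb4.-integrable B (EFin \o (fun x => `|g i x| * \1_[set x | b < quart x] x)).
    apply: L2_mul_integrable; first exact: L2_norm.
    apply: (@bounded_L2 R _ 1).
      by apply: measurable_funTS; apply: measurable_indic; exact: measurable_quart_gt.
    by move=> x _; rewrite indicE; case: (_ \in _); rewrite ?normr1 ?normr0.
  rewrite -RintegralZl//; apply: le_Rintegral => //.
  - exact: integrable_norm igY.
  - by have := integrableZl mB 2 itail; apply: eq_integrable.
  - move=> x Bx; rewrite normrM mulrCA ler_wpM2l//.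
    exact: step_field_bound.
have tail0 : (\sum_i 2 * \int[leb4]_(x in B) (`|g i x| *
    \1_[set x | 1 - n.+1%:R^-1 < quart x] x)) @[n --> \oo] --> (0 : R).
  pose T i (n : nat) := \int[leb4]_(x in B) (`|g i x| * \1_[set x | 1 - n.+1%:R^-1 < quart x] x).
  under eq_fun do rewrite sum4.
  have cT i : 2 * T i n @[n --> \oo] --> 2 * (0 : R).
    by apply: cvgM; [exact: cvg_cst|exact: cvg_boundary_tail].
  have := cvgD (cvgD (cvgD (cT 0) (cT 1)) (cT 2)) (cT 3).
  by rewrite mulr0 !addr0; apply.
have : 4 * `|I| <= 2^-1 * green_potential w a; last first.
  by move=> ?; rewrite -(@ler_pM2l _ 4)//; lra.
apply/ler_addgt0Pr => eps eps0.
move/cvgrPdist_le : tail0 => /(_ _ eps0) T.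
have [n [n1 n2 n3]] : exists n : nat, [/\ n.+1%:R^-1 <= (1 - (a + e)), n.+1%:R^-1 <= 2^-1 :> R &
   `|0 - \sum_i 2 * \int[leb4]_(x in B) (`|g i x| * \1_[set x | 1 - n.+1%:R^-1 < quart x] x)| <= eps].
  have ae' : 0 < 1 - (a + e) by rewrite subr_gt0.
  have h0 : 0 < 2^-1 :> R by rewrite invr_gt0.
  near \oo => n; exists n; split; last by near: n; exact: T.
    by apply: ltW; near: n; exact: (near_infty_natSinv_lt (PosNum ae')).
  by apply: ltW; near: n; exact: (near_infty_natSinv_lt (PosNum h0)).
have N0 : 0 < n.+1%:R^-1 :> R by rewrite invr_gt0.
rewrite sub0r normrN in n3.
have {}n3 := le_trans (ler_norm _) n3.
have K : 4 * `|I| <= 2^-1 * green_potential w a +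
      \sum_i 2 * \int[leb4]_(x in B) (`|g i x| * \1_[set x | 1 - n.+1%:R^-1 < quart x] x).
  by apply: (key _ (n.+1%:R^-1 / 2)); move: (n.+1%:R^-1 : R) n1 n2 N0 => N n1 n2 N0; lra.
by apply: (le_trans K); rewrite lerD2l.
Unshelve. all: by end_near. Qed.

End GreenBound.

(** * Borel profiles of radial functions *)

Section RadialProfile.
Context {R : realType}.
Local Notation leb4 := (@lebesgue4 R).
Local Notation B := (@unit_ball R).
Local Notation mu := (@lebesgue_measure R).

Lemma lebesgue4_quart_preimage (E : set R) : measurable (E : set (measurableTypeR R)) ->
  mu (E `&` `[0%R, +oo[%classic) = 0%E -> leb4 (quart @^-1` E) = 0%E.
Proof.
move=> mE E0; have mqE : measurable (quart @^-1` E : set (@measurableTypeR4 R)).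
  by rewrite -[X in measurable X]setTI; exact: measurable_quart.
have mi : measurable_fun setT (fun q : R => (\1_E q)%:E : \bar R).
  by apply/measurable_EFinP; exact: measurable_indic.
have i0 (q : R) : (0%R <= (\1_E q)%:E :> \bar R)%E by rewrite lee_fin.
have := ge0_integral_quart mi i0.
have -> : (\int[mu]_(q in `[0%R, +oo[) (\1_E q)%:E = 0)%E.
  by rewrite integral_indic ?E0//; exact: measurable_itv.
rewrite mule0 => <-.
have -> : (fun x : R4 R => (\1_E (quart x))%:E) = (fun x => (\1_(quart @^-1` E) x)%:E) by [].
by rewrite integral_indic// setIT.
Qed.

Let root4 (q : R) : R := Num.sqrt (Num.sqrt q).

Let measurable_root4 : measurable_fun setT root4.
Proof.
by apply: measurableT_comp; apply: continuous_measurable_fun; exact: sqrt_continuous.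
Qed.

Let root4_gt0 q : 0 < q -> 0 < root4 q.
Proof. by move=> q0; rewrite !sqrtr_gt0. Qed.

Let root4K (q : R) : 0 <= q -> root4 q ^+ 4 = q.
Proof.
move=> q0; have -> : root4 q ^+ 4 = (root4 q ^+ 2) ^+ 2 by ring.
by rewrite sqr_sqrtr ?sqrtr_ge0// sqr_sqrtr.
Qed.

Let dil (z : R4 R * R) : R4 R := affine4 (root4 z.2) 0 z.1.

Let measurable_dil : @measurable_fun _ _ (@measurableTypeR4 R *
    measurableTypeR R)%type (@measurableTypeR4 R) setT dil.
Proof.
have c1 : @measurable_fun _ _ (@measurableTypeR4 R * measurableTypeR R)%type R setT (fun z => root4 z.2).
  exact: (measurableT_comp measurable_root4 measurable_snd).
have f1 : @measurable_fun _ _ (@measurableTypeR4 R * measurableTypeR R)%type _ setT (fun z =>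
    z.1.1) by exact: (measurableT_comp measurable_fst measurable_fst).
have f2 : @measurable_fun _ _ (@measurableTypeR4 R * measurableTypeR R)%type _ setT (fun z =>
    z.1.1.1) by exact: (measurableT_comp measurable_fst f1).
apply: measurable_fun_pair; last first.
  apply: measurable_funD; last exact: measurable_cst.
  apply: measurable_funM => //; exact: (measurableT_comp measurable_snd measurable_fst).
apply: measurable_fun_pair; last first.
  apply: measurable_funD; last exact: measurable_cst.
  apply: measurable_funM => //; exact: (measurableT_comp measurable_snd f1).
apply: measurable_fun_pair.
  apply: measurable_funD; last exact: measurable_cst.
  apply: measurable_funM => //; exact: (measurableT_comp measurable_fst f2).
apply: measurable_funD; last exact: measurable_cst.
apply: measurable_funM => //; exact: (measurableT_comp measurable_snd f2).
Qed.

Let mu_set10 : mu ([set (0 : R)] `&` `[0%R, +oo[%classic) = 0%E.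
Proof.
by rewrite setIidl; [exact: lebesgue_measure_set1|move=> x ->; rewrite /= in_itv/= lexx].
Qed.

(** In the space of pairs of a point [x] and a scale [q], each section at fixed [q > 0] is a
    preimage of [N] under a dilation, hence null. Exchanging the order of integration makes the
    section in [q] null for almost every [x], and a suitable [x] off the origin exists because the
    ball has positive volume. *)
Let null_ray (N : set (@measurableTypeR4 R)) : measurable N -> leb4 N = 0%E ->
  exists2 x0 : R4 R, 0 < quart x0 & mu [set q | 0 < q /\ N (affine4 (root4 q) 0 x0)] = 0%E.
Proof.
move=> mN N0.
pose P : set (@measurableTypeR4 R * measurableTypeR R)%type := (dil @^-1` N) `&` (snd @^-1` `]0, +oo[).
have mP : measurable P.
  apply: measurableI.
    by rewrite -[X in measurable X]setTI; exact: measurable_dil.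
  by rewrite -[X in measurable X]setTI; apply: measurable_snd => //; exact: measurable_itv.
have PE : (sigma_lebesgue4 \x mu)%E P = 0%E.
  have -> : (sigma_lebesgue4 \x mu)%E P = (sigma_lebesgue4 \x^ mu)%E P.
    apply: product_measure_unique => // ? ? ? ?; exact: product_measure2E.
  rewrite /product_measure2 integral0_eq// => q _ /=.
  rewrite -lebesgue4E /ysection.
  have [q0|q0] := ltP 0 q; last first.
    rewrite (_ : [set _ | _] = set0) ?measure0//; apply/seteqP; split => // x /=.
    by rewrite inE /P /= in_itv/= andbT ltNge q0 => -[].
  have r0 := root4_gt0 q0.
  have -> : [set x | (x, q) \in P] = affine4 (root4 q) 0 @^-1` N.
    apply/seteqP; split => x /=; rewrite ?inE /P /dil /= in_itv/= andbT q0; first by case.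
    by [].
  have := lebesgue4_affine 0 r0 mN; rewrite N0 => /esym/eqP.
  by rewrite mule_eq0 eqe expf_eq0/= gt_eqF//= => /eqP.
have H0 : (\int[leb4]_x mu (xsection P x) = 0)%E by [].
have mx : measurable4 R setT (mu \o xsection P) by exact: measurable_fun_xsection.
have H1 : (\int[leb4]_x `|mu (xsection P x)| = 0)%E.
  by rewrite -[RHS]H0; apply: eq_integral => x _; rewrite gee0_abs.
have [Z [mZ Z0 ZP]] := (ae_eq_integral_abs leb4 measurableT mx).1 H1.
apply: contrapT => nx.
have sub : [set x | quart x <= 1] `<=` Z `|` (quart @^-1` [set 0]).
  move=> x x1; have [x0|x0] := pselect (quart x = 0); [by right|left].
  apply: ZP => /= /(_ I) H; apply: nx; exists x.
    by rewrite lt_neqAle quart_ge0 andbT eq_sym; exact/eqP.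
  rewrite (_ : [set q | _] = xsection P x)//.
  apply/seteqP; split => q /=; rewrite /xsection /= inE /P /dil /= in_itv/= andbT.
    by move=> [].
  by move=> [].
have m0 : leb4 (quart @^-1` [set 0]) = 0%E.
  apply: lebesgue4_quart_preimage; first exact: measurable_set1.
  exact: mu_set10.
have mq0 : measurable (quart @^-1` [set 0] : set (@measurableTypeR4 R)).
  by rewrite -[X in measurable X]setTI; apply: measurable_quart => //; exact: measurable_set1.
have : (leb4 [set x | (quart x <= 1)%R] <= leb4 Z + leb4 (quart @^-1` [set 0%R]))%E.
  apply: (le_trans _ (measureU2 _ mZ mq0)); apply: le_measure; rewrite ?inE//.
    exact: measurable_quart_le.
  exact: measurableU.
by rewrite Z0 m0 adde0 lebesgue4_quart_le1 lee_fin leNgt divr_gt0// exprn_gt0// pi_gt0.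
Qed.

(* The profile [v] of a radial function need not be measurable. By Fubini,
   [u] agrees almost everywhere on almost every ray with [v]; its restriction
   to one such ray is a Borel profile. *)
Lemma radial_profile u : measurable4 R setT (u \_ B) -> radial u ->
  exists2 U : R -> R, measurable_fun setT U & {ae leb4, forall x, B x -> u x = U (quart x)}.
Proof.
move=> mu [v [N [mN N0 Nv]]].
have [x0 c0 E0] := null_ray mN N0; set c := quart x0 in c0.
(* The factor [c^-1] makes [quart (y q) = q] for [q >= 0]. *)
pose y (q : R) : R4 R := affine4 (root4 (c^-1 * q)) 0 x0.
have my : @measurable_fun _ _ (measurableTypeR R) (@measurableTypeR4 R) setT y.
  have -> : y = dil \o (fun q => (x0, c^-1 * q)) by [].
  apply: (measurableT_comp measurable_dil).
  by apply: measurable_fun_pair => //; exact: measurable_funM.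
exists ((u \_ B) \o y); first exact: (measurableT_comp mu my).
pose E : set R := [set q | 0 < q /\ N (y q)].
have mE : measurable (E : set (measurableTypeR R)).
  have -> : E = `]0, +oo[ `&` (y @^-1` N) by apply/seteqP; split => q /=; rewrite in_itv/= andbT.
  apply: measurableI; first exact: measurable_itv.
  by rewrite -[X in measurable X]setTI; exact: my.
have mu0 : lebesgue_measure E = 0%E.
  rewrite (lebesgue_measure_affine 0 c0 mE).
  rewrite (_ : _ @^-1` E = [set q | 0 < q /\ N (affine4 (root4 q) 0 x0)]); first by rewrite E0 mule0.
  apply/seteqP; split => q /=; rewrite /E /y /= addr0 mulKf ?gt_eqF// pmulr_rgt0//.
have mqE : measurable (quart @^-1` E : set (@measurableTypeR4 R)).
  by rewrite -[X in measurable X]setTI; apply: measurable_quart.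
have mq0 : measurable (quart @^-1` [set 0] : set (@measurableTypeR4 R)).
  by rewrite -[X in measurable X]setTI; apply: measurable_quart => //; exact: measurable_set1.
have qE0 : leb4 (quart @^-1` E) = 0%E.
  apply: lebesgue4_quart_preimage => //.
  by apply: (@subset_measure0 _ _ _ lebesgue_measure _ E) => //; apply: measurableI => //;
      exact: measurable_itv.
have q00 : leb4 (quart @^-1` [set 0]) = 0%E.
  apply: lebesgue4_quart_preimage; first exact: measurable_set1.
  exact: mu_set10.
exists (N `|` (quart @^-1` E) `|` (quart @^-1` [set 0])); split.
- by apply: measurableU => //; exact: measurableU.
- apply/eqP; rewrite eq_le measure_ge0 andbT.
  apply: (le_trans (measureU2 _ _ mq0)); first exact: measurableU.
  rewrite [X in (_ + X)%E]q00 adde0; apply: (le_trans (measureU2 _ mN mqE)).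
  by rewrite [X in (_ + X)%E]qE0 adde0 le_eqVlt; apply/orP; left; apply/eqP; exact: N0.
- move=> x /= nx; apply: contrapT => /not_orP[/not_orP[nN nE] n0]; apply: nx => Bx.
  have q0 : 0 < quart x by rewrite lt_neqAle quart_ge0 andbT eq_sym; exact/eqP.
  have yq : quart (y (quart x)) = quart x.
    have cq0 : 0 <= c^-1 * quart x by rewrite mulr_ge0 ?invr_ge0 ?quart_ge0// ltW.
    by rewrite /y quart_affine root4K// -/c mulrAC mulVf ?mul1r// gt_eqF.
  have By : B (y (quart x)) by move: Bx; rewrite !unit_ballE /= yq.
  have Ny : ~ N (y (quart x)) by move=> Ny; apply: nE; split.
  have ux : u x = v (enorm x) by apply: contrapT => H; apply: nN; apply: Nv => /= /(_ Bx).
  have uy : u (y (quart x)) = v (enorm (y (quart x))) by apply: contrapT => H; apply: Ny;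
      apply: Nv => /= /(_ By).
  by rewrite /= patchE mem_set// uy ux !enorm_quart yq.
Qed.

End RadialProfile.

(** * Pointwise bound on the profile *)

Section PointwiseBound.
Context {R : realType}.
Local Notation leb4 := (@lebesgue4 R).
Local Notation B := (@unit_ball R).
Local Notation mu := (@lebesgue_measure R).
Local Notation V := (pi ^+ 2 / 2 : R).

Let mB : measurable (B : set (@measurableTypeR4 R)) := measurable_unit_ball.

Definition annulus (a b : R) : set (R4 R) := [set x | a <= quart x < b].

Lemma measurable_annulus a b : measurable (annulus a b : set (@measurableTypeR4 R)).
Proof.
rewrite -[X in measurable X]setTI.
have -> : annulus a b = quart @^-1` `[a, b[ by apply/seteqP; split => x; rewrite /annulus /= in_itv/=.
exact: measurable_quart.
Qed.

Lemma annulus_ball : annulus 0 1 = B.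
Proof. by rewrite unit_ballE; apply/seteqP; split => x; rewrite /annulus /= quart_ge0. Qed.

Lemma ge0_integral_annulus (h : R -> \bar R) (a b : R) : 0 <= a ->
  measurable_fun (`[a, b[%classic : set R) h -> (forall q, a <= q < b -> (0 <= h q)%E) ->
  (\int[leb4]_(x in annulus a b) h (quart x) = V%:E * \int[mu]_(q in `[a, b[) h q)%E.
Proof.
move=> a0 mh h0; pose h1 := (h \_ `[a, b[)%E.
have mh1 : measurable_fun setT h1 by exact: ((measurable_restrictT h (measurable_itv `[a, b[)).1 mh).
have h10 q : (0 <= h1 q)%E.
  rewrite /h1 patchE; case: ifP => //; rewrite inE /= in_itv/=; exact: h0.
have := ge0_integral_quart mh1 h10.
have -> : (\int[leb4]_x h1 (quart x) = \int[leb4]_(x in annulus a b) h (quart x))%E.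
  rewrite [RHS]integral_mkcond; apply: eq_integral => x _.
  rewrite /h1 !patchE.
  have E : (quart x \in `[a, b[%classic) = (x \in annulus a b).
    by apply/idP/idP; rewrite !inE /annulus /= ?in_itv.
  by rewrite E.
move=> ->; congr (_ * _)%E; rewrite [RHS]integral_mkcond [LHS]integral_mkcond.
apply: eq_integral => q _; rewrite /h1 !patchE.
have [qI|qI] := boolP (q \in `[a, b[%classic); last by case: ifP.
rewrite mem_set//; move: qI; rewrite inE /= !in_itv/= andbT => /andP[aq _].
exact: le_trans aq.
Qed.

Lemma ge0_integral_quart_ball (h : R -> \bar R) : measurable_fun (`[0%R, 1%R[%classic : set R) h ->
  (forall q, 0 <= q < 1 -> (0 <= h q)%E) ->
  (\int[leb4]_(x in B) h (quart x) = V%:E * \int[mu]_(q in `[0%R, 1%R[) h q)%E.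
Proof. by move=> mh h0; rewrite -annulus_ball ge0_integral_annulus. Qed.

Lemma Rintegral_quart_ball (h : R -> R) : mu.-integrable `[0%R, 1%R[ (EFin \o h) ->
  \int[leb4]_(x in B) h (quart x) = V * \int[mu]_(q in `[0%R, 1%R[) h q.
Proof.
move=> ih; have V0 : 0 <= V by rewrite divr_ge0// sqr_ge0.
have mh := measurable_int mu ih.
rewrite /Rintegral integralE [in RHS]integralE.
have E1 : (\int[leb4]_(x in B) ((fun x => (h (quart x))%:E)^\+)%E x = V%:E * \int[mu]_(q in `[0%R,
    1%R[) ((EFin \o h)^\+)%E q)%E.
  rewrite -ge0_integral_quart_ball//; last exact: measurable_funepos.
  by apply: eq_integral => x _; rewrite !funeposE.
have E2 : (\int[leb4]_(x in B) ((fun x => (h (quart x))%:E)^\-)%E x = V%:E * \int[mu]_(q in `[0%R,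
    1%R[) ((EFin \o h)^\-)%E q)%E.
  rewrite -ge0_integral_quart_ball//; last exact: measurable_funeneg.
  by apply: eq_integral => x _; rewrite !funenegE.
rewrite E1 E2 -muleBr//; last first.
  apply: fin_num_adde_defr; apply: integrable_pos_fin_num => //.
by rewrite fineM// fin_numB; apply/andP; split; [exact: integrable_pos_fin_num|exact:
    integrable_neg_fin_num].
Qed.

Let mollif (a e q : R) : R := dstep ((q - a) / e) / e.

Let continuous_mollif (a e : R) : continuous (mollif a e).
Proof.
move=> q; apply: cvgM; last exact: cvg_cst.
apply: (@continuous_comp _ _ _ (fun q : R => (q - a) / e) dstep); last exact: continuous_dstep.
by apply: cvgM; [apply: cvgB; [exact: cvg_id|exact: cvg_cst]|exact: cvg_cst].
Qed.

Let mollif_out (a e q : R) : 0 < e -> ~ `[a, (a + e)%R]%classic q -> mollif a e q = 0.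
Proof.
move=> e0 /=; rewrite in_itv/= => /negP; rewrite negb_and -!ltNge => /orP[qa|aq].
  by rewrite /mollif dstep_le0 ?mul0r// pmulr_lle0 ?invr_gt0// subr_le0 ltW.
by rewrite /mollif dstep_ge1 ?mul0r// ler_pdivlMr// mul1r lerBrDl ltW.
Qed.

Let integral_mollif (a e : R) : 0 < e -> \int[mu]_(q in `[a, (a + e)%R]) mollif a e q = 1.
Proof.
move=> e0; rewrite /Rintegral.
have dl q : is_derive q (1 : R) (fun q : R => (q - a) / e) e^-1.
  have H := is_deriveM (is_deriveB (is_derive_id q (1 : R)) (is_derive_cst a q (1 : R)))
      (is_derive_cst e^-1 q (1 : R)).
  by apply: (is_derive_eq H); rewrite /GRing.scale /=; ring.
have dS q : is_derive q (1 : R) (fun q : R => step ((q - a) / e)) (mollif a e q).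
  exact: (is_derive1_comp (is_derive_step _) (dl q)).
have cS : continuous (fun q : R => step ((q - a) / e)).
  by move=> q; apply: differentiable_continuous; apply/derivable1_diffP; case: (dS q).
rewrite (@continuous_FTC2 _ _ (fun q : R => step ((q - a) / e))).
- by rewrite subrr mul0r (@step_le0 _ 0)// [a + e]addrC addrK divff ?gt_eqF// step_ge1//= subr0.
- by rewrite ltrDl.
- exact: continuous_subspaceT.
- split; first by move=> q _; case: (dS q).
    exact: cvg_at_right_filter (cS _).
  exact: cvg_at_left_filter (cS _).
- by move=> q _; rewrite derive1E; case: (dS q).
Qed.

Lemma radial_profile_integrable u (U : R -> R) : L2 u -> measurable_fun setT U ->
  {ae leb4, forall x, B x -> u x = U (quart x)} -> mu.-integrable `[0%R, 1%R[ (EFin \o U).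
Proof.
move=> Lu mU uU; have /integrableP[_ iu] := L2_integrable Lu.
have mUq : measurable4 R B (fun x => U (quart x)).
  by apply: measurable_funTS; exact: (measurableT_comp mU (@measurable_quart R)).
have E : (\int[leb4]_(x in B) `|(EFin \o u) x| = \int[leb4]_(x in B) `|U (quart x)|%:E)%E.
  apply: ge0_ae_eq_integral => //.
  - by apply/measurable_EFinP; apply: measurableT_comp => //; exact: L2_measurable.
  - by apply/measurable_EFinP; exact: measurableT_comp.
  - apply: filterS uU => [|x ux Bx /=]; [exact: (ae_filter_ringOfSetsType leb4)|by rewrite ux].
apply/integrableP; split; first by apply/measurable_EFinP; exact: measurable_funTS.
move: iu; rewrite E (ge0_integral_quart_ball (h := fun q => `|U q|%:E))//; last first.
  by apply/measurable_EFinP; apply: measurable_funTS; exact: measurableT_comp.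
have V0 : 0 < V by rewrite divr_gt0// exprn_gt0// pi_gt0.
move=> H; rewrite ltey; apply/eqP => E1; move: H; rewrite E1 gt0_muley ?lte_fin// ltxx.
Qed.

Let integrable_dominated (D : set R) (f g : R -> R) : measurable (D : set (measurableTypeR R)) ->
  measurable_fun setT f -> (forall q, `|f q| <= g q) ->
  mu.-integrable D (EFin \o g) -> mu.-integrable D (EFin \o f).
Proof.
move=> mD mf fg /integrableP[mg ig]; apply/integrableP; split.
  by apply/measurable_EFinP; exact: measurable_funTS.
apply: le_lt_trans ig; apply: ge0_le_integral => //.
- by apply/measurable_EFinP; apply: measurable_funTS; exact: measurableT_comp.
- exact: measurableT_comp mg.
- move=> q _ /=; rewrite lee_fin; apply: (le_trans (fg q)); exact: ler_norm.
Qed.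

(** The kernel is at most [M / e] and lives on an interval inside the ball of radius [2 e], whose
    length is [4 e]; hence the factor [4 M] in front of the mean oscillation. *)
Let mollif_average (U : R -> R) (a e M : R) : mu.-integrable setT (EFin \o U) ->
  (forall y, dstep y <= M) -> 0 < e ->
  `|\int[mu]_(q in `[a, (a + e)%R]) (U q * mollif a e q) - U a| <= 4 * M * fine (davg U a (2 * e)).
Proof.
move=> iU HM e0.
have M0 : 0 <= M by exact: le_trans (dstep_ge0 0) (HM 0).
have mU : measurable_fun setT U by apply/measurable_EFinP; exact: (measurable_int mu iU).
pose A : set R := `[a, (a + e)%R]%classic.
have mA : measurable (A : set (measurableTypeR R)) by exact: measurable_itv.
have mb : measurable (ball a (2 * e) : set (measurableTypeR R)) by exact: measurable_ball.
have mub : mu (ball a (2 * e)) = (4 * e)%:E.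
  by rewrite lebesgue_measure_ball ?mulr_ge0 ?ltW// -mulr_natr; congr (_%:E); ring.
have e4 : 0 < 4 * e by rewrite mulr_gt0.
have Ab : A `<=` ball a (2 * e).
  move=> q; rewrite /A /ball /= in_itv/= => /andP[aq qa].
  by rewrite ltr_norml; apply/andP; split; lra.
have icst (D : set R) c : measurable (D : set (measurableTypeR R)) -> D `<=` ball a (2 * e) ->
    mu.-integrable D (EFin \o (fun _ : R => c)).
  move=> mD Db; apply: (integrableS mb) => //.
  apply/integrableP; split; first exact: measurable_cst.
  have -> : (\int[mu]_(x in ball a (2 * e)) `|(EFin \o (fun _ : R =>
      c)) x| = \int[mu]_(x in ball a (2 * e)) cst `|c|%:E x)%E by [].
  by rewrite integral_cst// [X in (_ * X)%E]mub ltry.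
have iUb : mu.-integrable (ball a (2 * e)) (EFin \o U) by exact: (integrableS measurableT).
have iD : mu.-integrable (ball a (2 * e)) (EFin \o (fun q => U q - U a)).
  have := integrableB mb iUb (icst _ (U a) mb (@subset_refl _ _)).
  by apply: eq_integrable => // q _ /=.
have iaD : mu.-integrable (ball a (2 * e)) (EFin \o (fun q => `|U q - U a|)).
  have := integrable_abse iD; by apply: eq_integrable.
have dE : fine (davg U a (2 * e)) = (4 * e)^-1 * \int[mu]_(q in ball a (2 * e)) `|U q - U a|.
  rewrite /davg /iavg mub inver gt_eqF// /Rintegral /=.
  have If := integrable_fin_num mb iaD.
  by rewrite fineM.
have ik q : 0 <= mollif a e q <= M / e.
  apply/andP; split; first by rewrite /mollif divr_ge0 ?dstep_ge0// ltW.
  by rewrite /mollif ler_wpM2r ?invr_ge0 ?(ltW e0).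
have mk : measurable_fun setT (mollif a e) by apply: continuous_measurable_fun; exact: continuous_mollif.
have iUk : mu.-integrable A (EFin \o (fun q => (U q - U a) * mollif a e q)).
  apply: (@integrable_dominated _ _ (fun q => (M / e) * `|U q - U a|)) => //.
  - by apply: measurable_funM => //; exact: measurable_funB.
  - move=> q; rewrite normrM mulrC; have /andP[k0 kM] := ik q.
    by rewrite (ger0_norm k0) ler_wpM2r.
  - apply: (integrableS mb) => //; have := integrableZl mb (M / e) iaD.
    by apply: eq_integrable.
have ikA : mu.-integrable A (EFin \o (fun q => U a * mollif a e q)).
  apply: (@integrable_dominated _ _ (fun q => `|U a| * (M / e))) => //.
  - exact: measurable_funM.
  - move=> q; rewrite normrM; have /andP[k0 kM] := ik q.
    by rewrite (ger0_norm k0) ler_wpM2l.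
  - exact: icst.
have -> : \int[mu]_(q in A) (U q * mollif a e q) - U a = \int[mu]_(q in A) ((U q - U a) * mollif a e q).
  have ikA1 : mu.-integrable A (EFin \o mollif a e).
    apply: (@integrable_dominated _ _ (fun q => M / e)) => //; last exact: icst.
    by move=> q; have /andP[k0 kM] := ik q; rewrite (ger0_norm k0).
  have -> : \int[mu]_(q in A) (U q * mollif a e q) =
      \int[mu]_(q in A) ((U q - U a) * mollif a e q + U a * mollif a e q).
    by apply: eq_Rintegral => q _; ring.
  by rewrite RintegralD// RintegralZl// integral_mollif// mulr1 addrK.
apply: (le_trans (le_normr_Rintegral mA iUk)).
apply: (@le_trans _ _ (\int[mu]_(q in A) ((M / e) * `|U q - U a|))).
  apply: le_Rintegral => //.
  - by have := integrable_abse iUk; apply: eq_integrable.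
  - apply: (integrableS mb) => //; have := integrableZl mb (M / e) iaD.
    by apply: eq_integrable.
  - move=> q _; rewrite normrM mulrC; have /andP[k0 kM] := ik q.
    by rewrite (ger0_norm k0) ler_wpM2r.
have iaA : mu.-integrable A (EFin \o (fun q => `|U q - U a|)) by exact: (integrableS mb).
rewrite RintegralZl//.
have -> : 4 * M * fine (davg U a (2 * e)) = (M / e) * \int[mu]_(q in ball a (2 * e)) `|U q - U a|.
  by rewrite dE; field; rewrite gt_eqF.
apply: ler_wpM2l; first by rewrite divr_ge0// ltW.
apply: fine_le; [exact: integrable_fin_num|exact: integrable_fin_num|].
apply: ge0_subset_integral => //; first exact: measurable_int iaD.
Qed.

(** At a Lebesgue point of the profile the mollified averages of the Green bound tend to the value
    itself. The factor [1 / (4 pi^2)] is [1 / 8] divided by the radial constant [pi^2 / 2]. *)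
Lemma radial_pointwise_bound u w (U : R -> R) : sobolev10 u -> laplacian u w -> L2 w ->
  measurable_fun setT U -> {ae leb4, forall x, B x -> u x = U (quart x)} ->
  {ae mu, forall a, 0 < a < 1 -> `|U a| <= green_potential w a / (4 * pi ^+ 2)}.
Proof.
move=> su lu Lw mU uU; have [Lu _] := su.
have iU := radial_profile_integrable Lu mU uU.
pose I01 : set R := `[0%R, 1%R[%classic.
have mI01 : measurable (I01 : set (measurableTypeR R)) by exact: measurable_itv.
pose Ut := U \_ I01.
have mUt : measurable_fun setT Ut by apply: (measurable_restrictT U mI01).1; exact: measurable_funTS.
have iUt : mu.-integrable setT (EFin \o Ut).
  have := (@integrable_mkcond _ _ _ mu _ (EFin \o U) mI01).1 iU.
  by apply: eq_integrable => // q _; rewrite /Ut /= !patchE; case: ifP.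
have lUt : locally_integrable setT Ut.
  split => //; first exact: openT.
  move=> K _ cK; have /integrableP[_] := iUt; apply: le_lt_trans.
  apply: ge0_subset_integral => //.
  - exact: compact_measurable.
  - by apply/measurable_EFinP; exact: measurableT_comp.
have [M HM] := @dstep_bounded R.
have M0 : 0 <= M by exact: le_trans (dstep_ge0 0) (HM 0).
have V0 : 0 < V by rewrite divr_gt0// exprn_gt0// pi_gt0.
apply: filterS (lebesgue_differentiation lUt) => [|a La /andP[a0 a1]].
  exact: (ae_filter_ringOfSetsType mu).
have Uta : Ut a = U a by rewrite /Ut patchE mem_set// /I01 /= in_itv/= ltW.
apply/ler_addgt0Pr => eta eta0.
have eta1 : 0 < eta / (4 * M + 1) by rewrite divr_gt0// ltr_wpDl// mulr_ge0.
move: La => /fine_cvgP[Lfin /cvgrPdist_le /(_ _ eta1) Lle].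
have [e [e0 ae1 ele]] : exists e : R, [/\ 0 < e, a + e < 1 &
     `|0 - (fine \o davg Ut a) (2 * e)| <= eta / (4 * M + 1)].
  have a1' : 0 < 1 - a by rewrite subr_gt0.
  near (0 : R)^'+ => r; exists (r / 2); split.
  - by rewrite divr_gt0.
  - have : r < 1 - a by near: r; exact: nbhs_right_lt.
    have : 0 < r by [].
    lra.
  - rewrite [2 * _]mulrC divfK//; near: r; exact: Lle.
pose A : set R := `[a, (a + e)%R]%classic.
have mA : measurable (A : set (measurableTypeR R)) by exact: measurable_itv.
have AI : A `<=` I01.
  move=> q; rewrite /A /I01 /= !in_itv/= => /andP[aq qa]; apply/andP; split.
    exact: le_trans (ltW a0) aq.
  exact: le_lt_trans qa ae1.
have avg := mollif_average a iUt HM e0; set J := Rintegral _ _ _ in avg.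
have Ikm : mu.-integrable I01 (EFin \o (fun q => U q * mollif a e q)).
  apply: (@integrable_dominated _ _ (fun q => (M / e) * `|U q|)) => //.
  - apply: measurable_funM => //.
    by apply: continuous_measurable_fun; exact: continuous_mollif.
  - move=> q; rewrite normrM mulrC.
    have k0 : 0 <= mollif a e q by rewrite /mollif divr_ge0 ?dstep_ge0// ltW.
    by rewrite (ger0_norm k0) ler_wpM2r// ler_wpM2r// invr_ge0 ltW.
  - have := integrableZl mI01 (M / e) (integrable_abse iU).
    by apply: eq_integrable.
have := green_bound su lu Lw a0 e0 ae1.
have -> : \int[leb4]_(x in B) (u x * (dstep ((quart x - a) / e) / e)) = V * J.
  rewrite -[RHS](_ : V * \int[mu]_(q in I01) (U q * mollif a e q) = _); last first.
    congr (_ * _); rewrite Rintegral_mkcond [RHS]Rintegral_mkcond; apply: eq_Rintegral => q _.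
    rewrite !patchE /Ut patchE; case: ifPn => qA; case: ifPn => qI //.
    - by rewrite mollif_out ?mulr0// => qA'; move: qI; rewrite mem_set.
    - by rewrite mul0r.
  rewrite -Rintegral_quart_ball//; congr fine.
  have mk : measurable4 R setT (fun x => mollif a e (quart x)).
    by apply: continuous_measurable4; exact: continuous_dstep_quart.
  apply: ae_eq_integral => //.
  - by apply/measurable_EFinP; apply: measurable_funM; [exact: L2_measurable|exact: measurable_funTS].
  - apply/measurable_EFinP; apply: measurable_funTS; apply: measurable_funM => //.
    exact: (measurableT_comp mU (@measurable_quart R)).
  - by apply: filterS uU => [|x ux Bx /=]; [exact: (ae_filter_ringOfSetsType leb4)|rewrite ux].
set W := green_potential w a; rewrite normrM (ger0_norm (ltW V0)) => JW.
move: avg; rewrite Uta => avg.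
have Jeta : `|J - U a| <= eta.
  apply: (le_trans avg); move: ele; rewrite /= sub0r normrN ger0_norm; last first.
    by apply: fine_ge0; exact: davg_ge0.
  rewrite ler_pdivlMr; last by rewrite ltr_wpDl// mulr_ge0.
  have : 0 <= fine (davg Ut a (2 * e)) by apply: fine_ge0; exact: davg_ge0.
  set d := fine _; move=> d0 H; apply: le_trans H; rewrite mulrC mulrDr mulr1 lerDl//.
have Ule : `|U a| <= `|J| + `|J - U a|.
  by rewrite -[X in `|X| <= _](_ : J - (J - U a) = U a);
      [exact: ler_normB|rewrite opprB addrCA subrr addr0].
have pi0 : 0 < pi ^+ 2 :> R by rewrite exprn_gt0// pi_gt0.
have JW' : `|J| <= W / (4 * pi ^+ 2).
  have H : `|J| * (4 * pi ^+ 2) <= W.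
    have -> : `|J| * (4 * pi ^+ 2) = 8 * (pi ^+ 2 / 2 * `|J|) by field.
    by rewrite -ler_pdivlMl.
  by rewrite ler_pdivlMr// mulr_gt0.
lra.
Unshelve. all: by end_near.
Qed.

End PointwiseBound.

(** * Moser's argument *)

Section Flux.
Context {R : realType}.
Local Notation leb4 := (@lebesgue4 R).
Local Notation B := (@unit_ball R).
Local Notation mu := (@lebesgue_measure R).
Local Notation V := (pi ^+ 2 / 2 : R).

Let mB : measurable (B : set (@measurableTypeR4 R)) := measurable_unit_ball.

Lemma measurable_inv (D : set R) : measurable_fun D (@GRing.inv R).
Proof.
apply: measurable_funTS; have -> : [set: R] = ~` [set 0] `|` [set 0] by rewrite setvU.
apply/measurable_funU => //; first exact: measurableC.
split; last exact: measurable_fun_set1.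
apply: open_continuous_measurable_fun.
  by rewrite openC; exact: closed_eq.
by move=> x; rewrite inE /= => /eqP; exact: inv_continuous.
Qed.

Lemma integral_recip (a b : R) : 0 < a -> a < b ->
  (\int[mu]_(q in `[a, b]) (q^-1)%:E = (ln (b / a))%:E)%E.
Proof.
move=> a0 ab; have b0 : 0 < b by exact: lt_trans ab.
have dl (q : R) : 0 < q -> is_derive q (1 : R) (@ln R) q^-1.
  by move=> q0; exact: is_derive1_ln.
rewrite (@continuous_FTC2 _ _ (@ln R))//.
- by rewrite ln_div ?posrE// EFinB.
- apply: continuous_in_subspaceT => q; rewrite inE /= in_itv/= => /andP[aq _].
  by apply: inv_continuous; rewrite gt_eqF// (lt_le_trans a0).
- split.
  + by move=> q; rewrite in_itv/= => /andP[aq _]; case: (dl q (lt_trans a0 aq)).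
  + by apply: cvg_at_right_filter; exact: continuous_ln.
  + by apply: cvg_at_left_filter; exact: continuous_ln.
- by move=> q; rewrite in_itv/= => /andP[aq _]; rewrite derive1E; case: (dl q (lt_trans a0 aq)).
Qed.

Let annulus_sub_ball (a b : R) : b <= 1 -> annulus a b `<=` B.
Proof. by move=> b1 x; rewrite unit_ballE /annulus /= => /andP[_ xb]; exact: lt_le_trans b1. Qed.

Definition mass (w : R4 R -> R) (a : R) : R := \int[leb4]_(x in annulus 0 a) (w x ^+ 2).

Definition flux (w : R4 R -> R) (a b : R) : R := \int[leb4]_(x in annulus a b) (`|w x| / sqnorm x).

Section Bounds.
Variable w : R4 R -> R.
Hypothesis Lw : L2 w.

Let iw2 : leb4.-integrable B (EFin \o (fun x => w x ^+ 2)).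
Proof. by have := L2_mul_integrable Lw Lw; apply: eq_integrable. Qed.

Let iw2S (a b : R) : b <= 1 -> leb4.-integrable (annulus a b) (EFin \o (fun x => w x ^+ 2)).
Proof.
by move=> b1; apply: (integrableS mB) => //; [exact: measurable_annulus|exact: annulus_sub_ball].
Qed.

Let annulusU (a b c : R) : a <= b -> b <= c -> annulus a c = annulus a b `|` annulus b c.
Proof.
move=> ab bc; apply/seteqP; split => x; rewrite /annulus /=.
  by move=> /andP[ax xc]; have [xb|bx] := ltP (quart x) b; [left; rewrite ax|right].
by move=> [/andP[ax xb]|/andP[bx xc]]; apply/andP; split => //;
    [exact: lt_le_trans bc|exact: le_trans bx].
Qed.

Let annulus_disj (a b c : R) : [disjoint annulus a b & annulus b c].
Proof.
apply/disj_setPS => x; rewrite /annulus /= => -[/andP[_ xb] /andP[bx _]].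
by move: xb; rewrite ltNge bx.
Qed.

Lemma mass_ge0 a : 0 <= mass w a.
Proof. by apply: Rintegral_ge0 => x _; exact: sqr_ge0. Qed.

Lemma mass1 : mass w 1 = sqint w.
Proof. by rewrite /mass annulus_ball. Qed.

Lemma massB (a b : R) : 0 <= a -> a <= b -> b <= 1 ->
  (\int[leb4]_(x in annulus a b) (w x ^+ 2)%:E = (mass w b - mass w a)%:E)%E.
Proof.
move=> a0 ab b1.
have -> : mass w b = mass w a + \int[leb4]_(x in annulus a b) (w x ^+ 2).
  rewrite /mass (annulusU a0 ab); apply: Rintegral_setU; try exact: measurable_annulus.
    by rewrite -(annulusU a0 ab); exact: iw2S.
  exact: annulus_disj.
rewrite addrC addKr /Rintegral fineK//.
by apply: integrable_fin_num; [exact: measurable_annulus|exact: iw2S].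
Qed.

Lemma le_mass (a b : R) : 0 <= a -> a <= b -> b <= 1 -> mass w a <= mass w b.
Proof.
move=> a0 ab b1; rewrite -subr_ge0 -lee_fin -(massB a0 ab b1).
by apply: integral_ge0 => x _; rewrite lee_fin sqr_ge0.
Qed.

Let measurable_sqnormV (D : set (R4 R)) : measurable4 R D (fun x => (sqnorm x)^-1).
Proof.
apply: measurable_funTS; apply: (measurableT_comp (f := @GRing.inv R)); last exact: measurable_sqnorm.
exact: measurable_inv.
Qed.

Let flux_lee (a b : R) : 0 < a -> a < b -> b <= 1 ->
  (\int[leb4]_(x in annulus a b) (`|w x| / sqnorm x)%:E <=
   (Num.sqrt (mass w b - mass w a) * Num.sqrt (V * ln (b / a)))%:E)%E.
Proof.
move=> a0 ab b1; have a0' := ltW a0; have ab' := ltW ab.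
have mw : measurable4 R (annulus a b) w.
  by apply: (measurable_funS mB) (L2_measurable Lw) => //; exact: annulus_sub_ball.
have V0 : 0 <= V by rewrite divr_ge0// sqr_ge0.
have := @cauchy_schwarz R (annulus a b) w (fun x =>
    (sqnorm x)^-1) (mass w b - mass w a) (V * ln (b / a)).
have -> : (\int[leb4]_(x in annulus a b) `|w x * (sqnorm x)^-1|%:E =
    \int[leb4]_(x in annulus a b) (`|w x| / sqnorm x)%:E)%E.
  by apply: eq_integral => x _; rewrite normrM [`|_^-1|]ger0_norm// invr_ge0 sqnorm_ge0.
apply => //.
- exact: measurable_annulus.
- by rewrite subr_ge0; exact: le_mass.
- by rewrite mulr_ge0// ln_ge0// ler_pdivlMr// mul1r.
- by rewrite massB.
have -> : (\int[leb4]_(x in annulus a b) ((sqnorm x)^-1 ^+ 2)%:E =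
    \int[leb4]_(x in annulus a b) ((quart x)^-1)%:E)%E.
  by apply: eq_integral => x _; rewrite /quart exprVn.
rewrite (ge0_integral_annulus (h := fun q => (q^-1)%:E))//.
- rewrite [leRHS]EFinM; apply: lee_wpmul2l; rewrite ?lee_fin// -(integral_recip a0 ab).
  apply: ge0_subset_integral => //.
  + apply/measurable_EFinP; exact: measurable_inv.
  + by move=> q; rewrite /= in_itv/= => /andP[aq _]; rewrite lee_fin invr_ge0 (le_trans a0').
  + by move=> q; rewrite /= !in_itv/= => /andP[-> /ltW].
- apply/measurable_EFinP; exact: measurable_inv.
- by move=> q /andP[aq _]; rewrite lee_fin invr_ge0 (le_trans a0').
Qed.

Lemma flux_bound (a b : R) : 0 < a -> a <= b -> b <= 1 ->
  flux w a b <= Num.sqrt (mass w b - mass w a) * Num.sqrt (V * ln (b / a)).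
Proof.
move=> a0; rewrite le_eqVlt => /predU1P[<-|ab] b1.
  have -> : flux w a a = 0; last by rewrite mulr_ge0// sqrtr_ge0.
  rewrite /flux (_ : annulus a a = set0) ?Rintegral_set0//.
  apply/seteqP; split => x; rewrite /annulus //= => /andP[ax xa].
  by move: xa; rewrite ltNge ax.
have H := flux_lee a0 ab b1; rewrite -lee_fin /flux /Rintegral fineK//.
rewrite ge0_fin_numE; first exact: le_lt_trans H (ltry _).
by apply: integral_ge0 => x _; rewrite lee_fin divr_ge0// sqnorm_ge0.
Qed.

Let iflux (a b : R) : 0 < a -> b <= 1 ->
  leb4.-integrable (annulus a b) (EFin \o (fun x => `|w x| / Num.max (sqnorm x) (Num.sqrt a))).
Proof.
move=> a0 b1; apply: (integrableS mB) => //; first exact: measurable_annulus.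
  exact: annulus_sub_ball.
exact: integrable_green_potential.
Qed.

Let max_sqnorm (a b : R) x : 0 < a -> annulus a b x -> Num.max (sqnorm x) (Num.sqrt a) = sqnorm x.
Proof.
move=> a0; rewrite /annulus /= => /andP[ax _]; apply/max_idPl.
by rewrite -sqrt_quart ler_wsqrtr.
Qed.

(** Truncating the kernel at a smaller radius changes nothing on the annulus and gives an integrand
    that is integrable on the whole ball, from which additivity in the annulus follows. *)
Let fluxE (a b : R) (c : R) : 0 < a -> 0 < c -> c <= a ->
  flux w a b = \int[leb4]_(x in annulus a b) (`|w x| / Num.max (sqnorm x) (Num.sqrt c)).
Proof.
move=> a0 c0 ca; apply: eq_Rintegral => x; rewrite inE => xab; rewrite (@max_sqnorm c b)//.
by move: xab; rewrite /annulus /= => /andP[ax ->]; rewrite (le_trans ca).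
Qed.

Lemma fluxD (a b c : R) : 0 < a -> a <= b -> b <= c -> c <= 1 ->
  flux w a c = flux w a b + flux w b c.
Proof.
move=> a0 ab bc c1; have b0 : 0 < b by exact: lt_le_trans ab.
rewrite !(@fluxE _ _ a)// (annulusU ab bc); apply: Rintegral_setU; try exact: measurable_annulus.
  by rewrite -(annulusU ab bc); exact: iflux.
exact: annulus_disj.
Qed.

Lemma flux_ge0 (a b : R) : 0 <= flux w a b.
Proof. by apply: Rintegral_ge0 => x _; rewrite divr_ge0// sqnorm_ge0. Qed.

(** Inside, the kernel is the constant [1 / sqrt a], whose square integrates to [V] whatever [a] is.
    This term therefore stays bounded, and only the flux can grow logarithmically. *)
Lemma green_potential_le (a : R) : 0 < a -> a <= 1 ->
  green_potential w a <= Num.sqrt V * Num.sqrt (mass w a) + flux w a 1.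
Proof.
move=> a0 a1; have a0' := ltW a0; have sa0 : 0 < Num.sqrt a by rewrite sqrtr_gt0.
have V0 : 0 <= V by rewrite divr_ge0// sqr_ge0.
have iB : leb4.-integrable (annulus 0 1) (EFin \o (fun x => `|w x| / Num.max (sqnorm x) (Num.sqrt a))).
  by rewrite annulus_ball; exact: integrable_green_potential.
have -> : green_potential w a = \int[leb4]_(x in annulus 0 a) (`|w x| / Num.max (sqnorm x)
    (Num.sqrt a)) + flux w a 1.
  rewrite (@fluxE _ _ a)// /green_potential -annulus_ball (annulusU a0' a1).
  apply: Rintegral_setU; try exact: measurable_annulus.
    by rewrite -(annulusU a0' a1).
  exact: annulus_disj.
rewrite lerD2r.
have mw : measurable4 R (annulus 0 a) w.
  by apply: (measurable_funS mB) (L2_measurable Lw) => //; exact: annulus_sub_ball.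
have E : \int[leb4]_(x in annulus 0 a) (`|w x| / Num.max (sqnorm x) (Num.sqrt a)) =
    \int[leb4]_(x in annulus 0 a) `|w x * (Num.sqrt a)^-1|.
  apply: eq_Rintegral => x; rewrite inE /annulus /= => /andP[_ xa].
  rewrite normrM [`|_^-1|]ger0_norm ?invr_ge0 ?sqrtr_ge0//; congr (_ / _); apply/max_idPr.
  by rewrite -sqrt_quart ler_wsqrtr// ltW.
rewrite E.
have H : (\int[leb4]_(x in annulus 0 a) `|w x * (Num.sqrt a)^-1|%:E <= (Num.sqrt (mass w a) *
    Num.sqrt V)%:E)%E.
  apply: cauchy_schwarz => //.
  - exact: measurable_annulus.
  - exact: mass_ge0.
  - rewrite massB// (_ : mass w 0 = 0) ?subr0// /mass (_ : annulus 0 0 = set0) ?Rintegral_set0//.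
    apply/seteqP; split => x; rewrite /annulus //= => /andP[ax xa].
    by move: xa; rewrite ltNge ax.
  - rewrite (ge0_integral_annulus (h := fun q => ((Num.sqrt a)^-1 ^+ 2)%:E))//.
      rewrite integral_cst//= lebesgue_measure_itv/= lte_fin a0 oppr0 adde0.
      have -> : (((Num.sqrt a)^-1 ^+ 2)%:E * a%:E = 1%:E :> \bar R)%E.
        by congr EFin; rewrite exprVn sqr_sqrtr// mulVf// gt_eqF.
      by rewrite mule1.
rewrite mulrC -lee_fin /Rintegral fineK//.
rewrite ge0_fin_numE; first exact: le_lt_trans H (ltry _).
by apply: integral_ge0 => x _; rewrite lee_fin.
Qed.

End Bounds.
End Flux.

Section Moser.
Context {R : realType}.
Local Notation V := (pi ^+ 2 / 2 : R).

(* In the next three lemmas [l] and [y] stand for the mass of the squared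
   Laplacian inside a ball and the scaled flux outside it, and [t] for the
   logarithmic radius of the ball. *)
Lemma moser_upper (t l y : R) : 0 <= t -> 0 <= l <= 1 -> 0 <= y ->
  y <= Num.sqrt t * Num.sqrt (1 - l) -> (y + Num.sqrt l / 2) ^+ 2 <= t + 4^-1.
Proof.
move=> t0 /andP[l0 l1] y0 yt; have l1' : 0 <= 1 - l by rewrite subr_ge0.
have p0 := sqrtr_ge0 l; have c0 := sqrtr_ge0 (1 - l); have r0 := sqrtr_ge0 t.
have c2 := sqr_sqrtr l1'; have r2 := sqr_sqrtr t0.
rewrite -{1}r2; rewrite -{2}(sqr_sqrtr l0) in c2.
move: (Num.sqrt l) (Num.sqrt (1 - l)) (Num.sqrt t) p0 c0 r0 c2 yt => p c r p0 c0 r0 c2 yt.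
(* Lagrange's identity for the vector [(r, 1/2)] and the unit vector [(c, p)]. *)
have -> : r ^+ 2 + 4^-1 = (r * c + p / 2) ^+ 2 + (r * p - c / 2) ^+ 2.
  have -> : r ^+ 2 + 4^-1 = (r ^+ 2 + 4^-1) * (c ^+ 2 + p ^+ 2) by rewrite c2 subrK mulr1.
  by field.
rewrite -[leLHS]addr0 lerD ?sqr_ge0// lerXn2r ?nnegrE ?lerD2r// addr_ge0 ?divr_ge0// mulr_ge0//.
Qed.

Lemma moser_mass (t l y lam : R) : 0 <= t -> 0 <= l <= 1 -> 0 <= y ->
  y <= Num.sqrt t * Num.sqrt (1 - l) -> t - (y + Num.sqrt l / 2) ^+ 2 <= lam ->
  t * l <= 2 * lam + 3 / 2.
Proof.
move=> t0 /andP[l0 l1] y0 yt; have l1' : 0 <= 1 - l by rewrite subr_ge0.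
have p0 := sqrtr_ge0 l; have c0 := sqrtr_ge0 (1 - l); have r0 := sqrtr_ge0 t.
have c2 := sqr_sqrtr l1'; have r2 := sqr_sqrtr t0; have p2 := sqr_sqrtr l0.
have p1 : Num.sqrt l <= 1 by rewrite -sqrtr1 ler_wsqrtr.
have c1 : Num.sqrt (1 - l) <= 1 by rewrite -[leRHS]sqrtr1 ler_wsqrtr// gerBl.
rewrite -{2}p2 -{1 2}r2; rewrite -{2}p2 in c2.
move: (Num.sqrt l) (Num.sqrt (1 - l)) (Num.sqrt t) p0 c0 r0 c2 yt p1 c1.
move=> p c r p0 c0 r0 c2 yt p1 c1 H.
have H1 : (y + p / 2) ^+ 2 <= (r * c + p / 2) ^+ 2.
  rewrite lerXn2r ?nnegrE ?lerD2r// addr_ge0 ?divr_ge0// mulr_ge0//.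
(* As [c^2 = 1 - p^2], the square in [H1] is [t - t l] plus lower-order terms, so a small defect
   bounds [t l] by [lam] plus these terms. The mixed term is at most [sqrt (t l)] and is absorbed by
   [x <= x^2 / 2 + 1 / 2]. *)
have H2 : r ^+ 2 * p ^+ 2 <= lam + r * c * p + p ^+ 2 / 4.
  have E : (r * c + p / 2) ^+ 2 = r ^+ 2 - r ^+ 2 * p ^+ 2 + r * c * p + p ^+ 2 / 4.
    have -> : r ^+ 2 - r ^+ 2 * p ^+ 2 = r ^+ 2 * c ^+ 2 by rewrite c2; ring.
    by field.
  move: H H1; rewrite E; lra.
have H3 : r * c * p <= r * p by rewrite ler_wpM2r// ler_piMr.
have H4 : r * p <= (r * p) ^+ 2 / 2 + 2^-1 by have := sqr_ge0 (r * p - 1); lra.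
have H5 : p ^+ 2 <= 1 by rewrite expr_le1.
move: H4; rewrite exprMn; lra.
Qed.

Lemma moser_gap (s t ls lt ys yt lam : R) : 0 <= lam -> s <= t -> 8 * lam + 6 <= s ->
  0 <= ls <= 1 -> 0 <= lt -> lt <= ls -> 0 <= ys -> 0 <= yt ->
  ys <= Num.sqrt s * Num.sqrt (1 - ls) -> yt <= ys + Num.sqrt (t - s) * Num.sqrt ls ->
  s - (ys + Num.sqrt ls / 2) ^+ 2 <= lam -> t - (yt + Num.sqrt lt / 2) ^+ 2 <= lam ->
  t - s <= 40 * (lam + 1).
Proof.
move=> lam0 st sM ls01 lt0 lts ys0 yt0 yss yts Fs Ft.
have s0 : 0 <= s by lra.
have sl := moser_mass s0 ls01 ys0 yss Fs.
have /andP[ls0 ls1] := ls01.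
have yr : ys <= Num.sqrt s.
  by apply: (le_trans yss); rewrite ler_piMr ?sqrtr_ge0// -[leRHS]sqrtr1 ler_wsqrtr// gerBl.
have st0 : 0 <= t - s by rewrite subr_ge0.
have p0 := sqrtr_ge0 ls; have m0 := sqrtr_ge0 lt; have r0 := sqrtr_ge0 s; have e0 := sqrtr_ge0 (t - s).
have mp : Num.sqrt lt <= Num.sqrt ls by rewrite ler_wsqrtr.
have p2 := sqr_sqrtr ls0; have r2 := sqr_sqrtr s0; have e2 := sqr_sqrtr st0.
(* The threshold [8 lam + 6] is four times the bound [2 lam + 3 / 2] on [s ls]. *)
have l4 : ls <= 4^-1.
  rewrite leNgt; apply/negP => H.
  have sp : 0 < s by lra.
  have : s * 4^-1 < s * ls by rewrite ltr_pM2l.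
  lra.
move: (Num.sqrt ls) (Num.sqrt lt) (Num.sqrt s) (Num.sqrt (t - s)) p0 m0 r0 e0 mp p2 r2 e2 yr yts Ft.
move=> p m r e p0 m0 r0 e0 mp p2 r2 e2 yr yts Ft.
have H1 : (yt + m / 2) ^+ 2 <= (r + p * (e + 2^-1)) ^+ 2.
  rewrite lerXn2r ?nnegrE//.
  - by rewrite addr_ge0// divr_ge0.
  - by rewrite addr_ge0// mulr_ge0// addr_ge0.
  - rewrite mulrDr; lra.
have E : (r + p * (e + 2^-1)) ^+ 2 = r ^+ 2 + 2 * (r * p) * e + r * p + p ^+ 2 * (e +
    2^-1) ^+ 2 by field.
(* With [e^2 = t - s], the estimates [H2] and [H4] use up at most three quarters of [e^2]. The last
   quarter is at most [lam + 9/2 s ls + 5/8], and [s ls <= 2 lam + 3/2] leads to the constant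
   [40]. *)
have H2 : 2 * (r * p) * e <= e ^+ 2 / 4 + 4 * (r * p) ^+ 2.
  by have := sqr_ge0 (e / 2 - 2 * (r * p)); lra.
have H3 : r * p <= (r * p) ^+ 2 / 2 + 2^-1 by have := sqr_ge0 (r * p - 1); lra.
have H4 : p ^+ 2 * (e + 2^-1) ^+ 2 <= 4^-1 * (2 * e ^+ 2 + 2^-1).
  rewrite p2; apply: ler_pM; rewrite ?sqr_ge0//.
  by have := sqr_ge0 (e - 2^-1); lra.
have k2 : (r * p) ^+ 2 = s * ls by rewrite exprMn r2 p2.
move: H2 H3; rewrite k2; move: E H4 H1 e2; move: (r * p) => k; move: r2 => r2; rewrite r2.
move: ((r + p * (e + 2^-1)) ^+ 2) (p ^+ 2 * (e + 2^-1) ^+ 2) (e ^+ 2) (2 * k * e) (s * ls) sl =>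
    x1 x2 x3 x4 x5 h1 h2 h3 h4 h5 h6 h7.
move: Ft; move: ((yt + m / 2) ^+ 2) h4 => x6 h4 Ft; lra.
Qed.

(* [log_radius (quart x)] is [- ln |x|]. *)
Definition log_radius (q : R) : R := - ln q / 4.

(** Dividing by [sqrt (4 V)] turns [V ln (1 / q)], the square integral of the kernel outside, into
    the logarithmic radius; the same scaling turns the inner term [sqrt V sqrt L] into
    [sqrt L / 2]. *)
Definition moser_defect w (q : R) : R :=
  log_radius q - (flux w q 1 / Num.sqrt (4 * V) + Num.sqrt (mass w q) / 2) ^+ 2.

Section Defect.
Variable w : R4 R -> R.
Hypothesis Lw : L2 w.
Hypothesis w1 : sqint w = 1.

Let V0 : 0 < V. Proof. by rewrite divr_gt0// exprn_gt0// pi_gt0. Qed.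

Let K0 : 0 < Num.sqrt (4 * V). Proof. by rewrite sqrtr_gt0 mulr_gt0. Qed.

Let log_radius_ge0 q : 0 < q -> q <= 1 -> 0 <= log_radius q.
Proof. by move=> q0 q1; rewrite divr_ge0// oppr_ge0 ln_le0. Qed.

Let mass01 q : 0 <= q -> q <= 1 -> 0 <= mass w q <= 1.
Proof. by move=> q0 q1; rewrite mass_ge0 -w1 -mass1 le_mass. Qed.

Let flux0 q : 0 <= flux w q 1 / Num.sqrt (4 * V).
Proof. by rewrite divr_ge0 ?flux_ge0// ltW. Qed.

Let flux_log a b : 0 < a -> a <= b -> b <= 1 ->
  flux w a b / Num.sqrt (4 * V) <=
  Num.sqrt (log_radius a - log_radius b) * Num.sqrt (mass w b - mass w a).
Proof.
move=> a0 ab b1; have b0 : 0 < b by exact: lt_le_trans ab.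
rewrite ler_pdivrMr//; apply: (le_trans (flux_bound Lw a0 ab b1)).
have -> : V * ln (b / a) = (log_radius a - log_radius b) * (4 * V).
  by rewrite ln_div ?posrE// /log_radius; field.
rewrite [Num.sqrt (_ * (4 * V))]sqrtrM; last first.
  by rewrite subr_ge0 /log_radius ler_pM2r// lerN2 ler_ln ?posrE.
by rewrite le_eqVlt; apply/orP; left; apply/eqP; ring.
Qed.

Let flux_log1 q : 0 < q -> q <= 1 ->
  flux w q 1 / Num.sqrt (4 * V) <= Num.sqrt (log_radius q) * Num.sqrt (1 - mass w q).
Proof.
move=> q0 q1; have := flux_log q0 q1 (lexx _).
by rewrite /log_radius ln1 oppr0 mul0r subr0 mass1 w1.
Qed.

Lemma moser_defect_ge q : 0 < q -> q <= 1 -> - 4^-1 <= moser_defect w q.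
Proof.
move=> q0 q1; rewrite lerBrDl -lerBrDr opprK.
by apply: moser_upper; [exact: log_radius_ge0|exact: (mass01 (ltW q0) q1)|exact: flux0|exact: flux_log1].
Qed.

Lemma moser_defect_gap p q lam : 0 <= lam -> 0 < q -> q <= p -> p <= 1 ->
  8 * lam + 6 <= log_radius p -> moser_defect w p <= lam -> moser_defect w q <= lam ->
  log_radius q - log_radius p <= 40 * (lam + 1).
Proof.
move=> lam0 q0 qp p1 pM Fp Fq; have p0 : 0 < p by exact: lt_le_trans qp.
have q1 : q <= 1 by exact: le_trans p1.
apply: (@moser_gap _ _ (mass w p) (mass w q) (flux w p 1 / Num.sqrt (4 *
    V)) (flux w q 1 / Num.sqrt (4 * V)) lam) => //.
- by rewrite /log_radius ler_pM2r// lerN2 ler_ln ?posrE.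
- exact: (mass01 (ltW p0) p1).
- exact: mass_ge0.
- by apply: le_mass => //; rewrite ltW.
- exact: flux_log1.
- rewrite (fluxD Lw q0 qp p1 (lexx _)) mulrDl addrC lerD2l.
  apply: (le_trans (flux_log q0 qp p1)); apply: ler_wpM2l; first exact: sqrtr_ge0.
  by rewrite ler_wsqrtr// gerBl mass_ge0.
Qed.

(** Either no point of the level set lies beyond the threshold [8 n + 6], or one does and serves as
    centre [s]: by the gap estimate every other such point is close to it. *)
Lemma moser_defect_cover (n : nat) : exists s, forall q, 0 < q -> q <= 1 ->
  moser_defect w q <= n%:R ->
  log_radius q <= 8 * n%:R + 6 \/ `|log_radius q - s| <= 40 * (n%:R + 1).
Proof.
have [[p [p0 p1 Fp pM]]|np] := pselect (exists p, [/\ 0 < p, p <= 1,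
    moser_defect w p <= n%:R & 8 * n%:R + 6 <= log_radius p]).
  exists (log_radius p) => q q0 q1 Fq; have [|qM] := leP (log_radius q) (8 * n%:R + 6); [by left|right].
  have [qp|pq] := leP q p.
    rewrite ger0_norm; last by rewrite subr_ge0 /log_radius ler_pM2r// lerN2 ler_ln ?posrE.
    exact: moser_defect_gap.
  rewrite distrC ger0_norm; last by rewrite subr_ge0 /log_radius ler_pM2r// lerN2 ler_ln ?posrE// ltW.
  by apply: moser_defect_gap => //; exact: ltW.
exists 0 => q q0 q1 Fq; left; rewrite leNgt; apply/negP => qM; apply: np.
by exists q; split => //; exact: ltW.
Qed.

Lemma sqr_le_moser (q x : R) : 0 < q -> q <= 1 -> `|x| <= green_potential w q / (4 * pi ^+ 2) ->
  8 * pi ^+ 2 * x ^+ 2 <= log_radius q - moser_defect w q.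
Proof.
move=> q0 q1 xq; have pi0 : 0 < pi ^+ 2 :> R by rewrite exprn_gt0// pi_gt0.
have KV : Num.sqrt (4 * V) = 2 * Num.sqrt V.
  rewrite sqrtrM//; congr (_ * _).
  by rewrite (_ : 4 = 2 ^+ 2 :> R) ?sqrtr_sqr ?ger0_norm//; ring.
rewrite /moser_defect opprB addrC subrK.
set y := flux w q 1 / _; set m := Num.sqrt (mass w q).
have sV0 : 0 < Num.sqrt V by rewrite sqrtr_gt0.
have xb : `|x| <= 2 * Num.sqrt V * (y + m / 2) / (4 * pi ^+ 2).
  apply: (le_trans xq); rewrite ler_pM2r ?invr_gt0 ?mulr_gt0 ?pi_gt0//.
  apply: (le_trans (green_potential_le Lw q0 q1)).
  rewrite -KV mulrDr -/m [X in _ <= X + _]mulrC divfK ?gt_eqF// KV.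
  by rewrite le_eqVlt; apply/orP; left; apply/eqP; field.
have : x ^+ 2 <= (2 * Num.sqrt V * (y + m / 2) / (4 * pi ^+ 2)) ^+ 2.
  by rewrite -real_normK ?num_real// lerXn2r ?nnegrE//; exact: le_trans xb.
have -> : (2 * Num.sqrt V * (y + m / 2) / (4 * pi ^+ 2)) ^+ 2 = (y + m / 2) ^+ 2 / (8 * pi ^+ 2).
  have G (s p z : R) : 0 < p -> s ^+ 2 = p / 2 -> (2 * s * z / (4 * p)) ^+ 2 = z ^+ 2 / (8 * p).
    move=> p0 E; have pn0 : p != 0 by rewrite gt_eqF.
    transitivity (s ^+ 2 * (4 * z ^+ 2 / (4 * p) ^+ 2)); first by field.
    by rewrite E; field.
  by apply: G => //; rewrite sqr_sqrtr// ltW.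
by rewrite ler_pdivlMr ?mulr_gt0 ?pi_gt0// mulrC.
Qed.

End Defect.
End Moser.

(** * Uniform bound on the functional *)

Section UpperBound.
Context {R : realType}.
Local Notation leb4 := (@lebesgue4 R).
Local Notation B := (@unit_ball R).
Local Notation mu := (@lebesgue_measure R).
Local Notation V := (pi ^+ 2 / 2 : R).

Let mB : measurable (B : set (@measurableTypeR4 R)) := measurable_unit_ball.

Let V0 : 0 < V. Proof. by rewrite divr_gt0// exprn_gt0// pi_gt0. Qed.

Let window (s d : R) : set R := `[expR (- (4 * (s + d))), expR (- (4 * (s - d)))]%classic.

Let measurable_window s d : measurable (window s d : set (measurableTypeR R)).
Proof. exact: measurable_itv. Qed.

Let windowP (s d q : R) : 0 < q -> window s d q <-> `|log_radius q - s| <= d.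
Proof.
move=> q0; rewrite /window /= in_itv/= -{1 2}(lnK (x := q)) ?posrE// !ler_expR.
rewrite ler_norml /log_radius.
have -> : (- d <= - ln q / 4 - s <= d) = (- (4 * (s + d)) <= ln q <= - (4 * (s - d))).
  by apply/idP/idP => /andP[h1 h2]; apply/andP; split; lra.
by [].
Qed.

(** [dq / q] is [4 dt] in the logarithmic radius [t], so the total mass is four times the window
    length [2 d]. *)
Let weight (s d q : R) : R := q^-1 * \1_(window s d) q.

Let weight_ge0 s d q : 0 <= weight s d q.
Proof.
rewrite /weight indicE; case: (boolP (q \in _)) => [|_]; last by rewrite mulr0.
rewrite inE /window /= in_itv/= mulr1 invr_ge0 => /andP[h _].
exact: le_trans (expR_ge0 _) h.
Qed.

Let measurable_weight s d (D : set R) : measurable_fun D (fun q => (weight s d q)%:E).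
Proof.
apply/measurable_EFinP; apply: measurable_funM; first exact: measurable_inv.
by apply: measurable_funTS; apply: measurable_indic; exact: measurable_window.
Qed.

Let integral_weight (s d : R) (D : set R) : measurable (D : set (measurableTypeR R)) -> 0 < d ->
  (\int[mu]_(q in D) (weight s d q)%:E <= (8 * d)%:E)%E.
Proof.
move=> mD d0; apply: (@le_trans _ _ (\int[mu]_q (weight s d q)%:E)%E).
  apply: ge0_subset_integral => //; first exact: measurable_weight.
  by move=> q _; rewrite lee_fin.
have -> : (\int[mu]_q (weight s d q)%:E = \int[mu]_(q in window s d) (q^-1)%:E)%E.
  rewrite [RHS]integral_mkcond; apply: eq_integral => q _.
  by rewrite patchE /weight indicE; case: ifP => _; rewrite ?mulr1 ?mulr0.
rewrite /window integral_recip ?expR_gt0//; last by rewrite ltr_expR; lra.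
by rewrite -expRN -expRD expRK lee_fin; lra.
Qed.

(** The factor [384 (n + 1)] bounds [8 (T n + D n)] for the half-lengths [T n = 8 n + 6] and
    [D n = 40 (n + 1)] of the two windows at level [n]. Since [(n + 1) 2^n <= 4^n <= exp (b n)], a
    geometric series of sum [768 exp b] results. *)
Let geometric_bound (b : R) (n : nat) : 4 <= b ->
  expR (- (b * (n%:R - 1))) * (384 * (n%:R + 1)) <= expR b * 768 / (2 ^ n.+1)%:R.
Proof.
move=> b4; have -> : - (b * (n%:R - 1)) = b - b * n%:R by ring.
rewrite expRB -mulrA; have -> : expR b * 768 / (2 ^ n.+1)%:R = expR b * (384 / (2 ^ n)%:R).
  by rewrite expnS natrM; field; rewrite pnatr_eq0 expn_eq0.
apply: ler_wpM2l; first exact: expR_ge0.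
have e4 : 4 <= expR (4 : R) by apply: le_trans (expR_ge1Dx _); lra.
have H : (n%:R + 1) * (2 ^ n)%:R <= expR (b * n%:R).
  apply: (@le_trans _ _ (4 ^+ n)).
    rewrite (_ : 4 = 2 * 2 :> R); last by ring.
    rewrite exprMn -natrX (natr1 n); apply: ler_wpM2r => //.
    by rewrite ler_nat; exact: ltn_expl.
  apply: (@le_trans _ _ (expR (4 * n%:R))); last by rewrite ler_expR ler_wpM2r.
  by rewrite mulrC expRM_natl lerXn2r ?nnegrE ?expR_ge0.
rewrite ler_pdivlMr ?ltr0n ?expn_gt0//.
rewrite -mulrA ler_pdivrMl ?expR_gt0//; lra.
Qed.

Section MoserIntegral.
Variables (w : R4 R -> R) (b : R).
Hypotheses (Lw : L2 w) (w1 : sqint w = 1) (b4 : 4 <= b).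

(* Truncating at the integer values of the defect: each level set lies in two
   windows of the logarithmic variable, of length linear in the level. *)
Lemma moser_integral (h : R -> \bar R) : measurable_fun (`[0, 1[%classic : set R) h ->
  (forall q, (0 <= h q)%E) ->
  {ae mu, forall q, 0 < q < 1 -> (h q <= (q^-1 * expR (- (b * moser_defect w q)))%:E)%E} ->
  (\int[mu]_(q in `[0%R, 1%R[) h q <= (expR b * 768)%:E)%E.
Proof.
move=> mh h0 hle.
have [s_ s_P] := choice (moser_defect_cover Lw w1).
pose T n : R := 8 * n%:R + 6; pose D n : R := 40 * (n%:R + 1).
have T0 n : 0 < T n by rewrite /T ltr_wpDl// mulr_ge0.
have D0 n : 0 < D n by rewrite /D mulr_gt0// ltr_wpDl.
pose c (n : nat) (q : R) : \bar R := ((expR (- (b * (n%:R - 1))))%:E * ((weight 0 (T n) q)%:E +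
    (weight (s_ n) (D n) q)%:E))%E.
have c0 n q : (0 <= c n q)%E by rewrite /c mule_ge0 ?adde_ge0 ?lee_fin ?expR_ge0.
have mc n : measurable_fun (`[0, 1[%classic : set R) (c n).
  by apply: measurable_funeM; apply: emeasurable_funD; exact: measurable_weight.
have pw : {ae mu, forall q, `[0, 1[%classic q -> (h q <= \sum_(n <oo) c n q)%E}.
  have n0 : {ae mu, forall q : R, q <> 0}.
    exists [set 0]; split => //; first exact: lebesgue_measure_set1.
    by move=> q /= /contrapT.
  have := @filterI _ _ (ae_filter_ringOfSetsType mu) _ _ hle n0.
  apply: (@filterS _ _ (ae_filter_ringOfSetsType mu)) => q [hq q0].
  rewrite /= in_itv/= => /andP[q0' q1]; have qgt0 : 0 < q by rewrite lt_neqAle eq_sym q0' andbT;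
      exact/eqP.
  apply: (le_trans (hq _)); first by rewrite qgt0.
  have Fq := moser_defect_ge Lw w1 qgt0 (ltW q1).
  (* Level [0] takes the nonpositive values, which are at least [- 1 / 4] and so above [0 - 1];
     positive values are rounded up. *)
  have [n [nF Fn]] : exists n : nat, n%:R - 1 <= moser_defect w q /\ moser_defect w q <= n%:R.
    have [F0|F0] := leP (moser_defect w q) 0; first by exists 0%N; split => //; lra.
    have /andP[Fl Fu] := truncn_itv (ltW F0).
    exists (Num.truncn (moser_defect w q)).+1; rewrite -natr1 addrK; split => //.
    by rewrite natr1 ltW.
  apply: (@le_trans _ _ (c n q)); last first.
    have := @nneseries_lim_ge _ (fun n => c n q) xpredT 0 n.+1.
    move=> /(_ (fun k _ _ => c0 k q)); apply: le_trans.
    by rewrite big_nat_recr//= leeDr// sume_ge0.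
  have w0 : q^-1 <= weight 0 (T n) q + weight (s_ n) (D n) q.
    have [tq|tq] := s_P n q qgt0 (ltW q1) Fn.
      rewrite -[leLHS]addr0 lerD// /weight indicE mem_set ?mulr1//.
      apply/windowP => //; rewrite subr0 ger0_norm//.
      by rewrite /log_radius divr_ge0// oppr_ge0 ln_le0// ltW.
    rewrite -[leLHS]add0r lerD// /weight indicE mem_set ?mulr1//.
    exact/windowP.
  rewrite /c -EFinD -EFinM lee_fin mulrC; apply: ler_pM => //.
  - by rewrite invr_ge0 ltW.
  - by rewrite ler_expR lerN2 ler_wpM2l// (le_trans _ b4).
have mI : measurable (`[0%R, 1%R[%classic : set (measurableTypeR R)) by exact: measurable_itv.
apply: (@le_trans _ _ (\int[mu]_(q in `[0%R, 1%R[) \sum_(n <oo) c n q)%E).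
  apply: ae_ge0_le_integral => //.
  - by move=> q _; exact: nneseries_ge0.
  - by apply: ge0_emeasurable_sum => [n q _ _|n _]; [exact: c0|exact: mc].
rewrite integral_nneseries//.
apply: (@le_trans _ _ (\sum_(n <oo) (expR b * 768 / (2 ^ n.+1)%:R)%:E)%E); last first.
  have K0 : 0 <= expR b * 768 := mulr_ge0 (expR_ge0 b) (ler0n R 768).
  move: (expR b * 768) K0 => K K0; exact: (@epsilon_trick0 _ K xpredT K0).
apply: lee_nneseries => [n _ _|n _]; first by apply: integral_ge0 => q _; exact: c0.
rewrite ge0_integralZl//; last 2 first.
- by apply: emeasurable_funD; exact: measurable_weight.
- by move=> q _; rewrite adde_ge0// lee_fin.
rewrite ge0_integralD//; try exact: measurable_weight; try by move=> q _; rewrite lee_fin.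
apply: (@le_trans _ _ ((expR (- (b * (n%:R - 1))))%:E * ((8 * T n)%:E + (8 * D n)%:E))%E).
  apply: lee_wpmul2l; first by rewrite lee_fin expR_ge0.
  by apply: leeD; exact: integral_weight.
rewrite -EFinD -EFinM lee_fin; apply: le_trans (geometric_bound n b4).
apply: ler_wpM2l; first exact: expR_ge0.
by rewrite /T /D; have : 0 <= n%:R :> R by []; lra.
Qed.

End MoserIntegral.
Lemma L2_sum n (h : 'I_n -> R4 R -> R) : (forall i, L2 (h i)) -> L2 (fun x => \sum_i h i x).
Proof.
elim: n h => [|n IHn] h Lh.
  have -> : (fun x => \sum_i h i x) = (fun _ => 0).
    by apply/funext => x; rewrite big_ord0.
  by apply: continuous_L2 => x; exact: cvg_cst.
have -> : (fun x => \sum_i h i x) = (fun x => \sum_(i < n) h (widen_ord (leqnSn n) i) x) \+ h ord_max.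
  by apply/funext => x; rewrite big_ord_recr.
exact: L2D (IHn _ (fun i => Lh _)) (Lh _).
Qed.

Lemma enorm_powR (a : R) x : enorm x `^ a = quart x `^ (a / 4).
Proof.
rewrite enorm_quart -!powR12_sqrt ?powR_ge0 ?quart_ge0// -!powRrM.
by congr (_ `^ _); field.
Qed.

(** With [t] the logarithmic radius and [b = 4 + alpha], the weight is [exp (- alpha t)] and
    [exp (sigma U^2)] is at most [exp (b (t - defect))]. Their product is at most
    [q^-1 exp (- b defect)], the form that Moser's integral controls. *)
Lemma adams_upper_bound (alpha sigma : R) u w : 0 < alpha -> 0 <= sigma ->
  sigma <= 32 * pi ^+ 2 * (1 + alpha / 4) ->
  H2Nrad u -> laplacian u w -> norm2 w = 1%E ->
  (adams_functional alpha sigma u <= (V * (expR (4 + alpha) * 768))%:E)%E.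
Proof.
move=> a0 s0 sle [[su _] ru] lu w1; have [Lu _] := su.
have Lw : L2 w by have [h [Lh ->]] := lu; apply: L2_sum => i; case: (Lh i).
have sw1 : sqint w = 1.
  move: w1; rewrite norm2_sqint// => -[sq]; by rewrite -(sqr_sqrtr (sqint_ge0 w)) sq expr1n.
have mu' : measurable4 R setT (u \_ B) by apply: (measurable_restrictT u mB).1; exact: L2_measurable.
have [U mU uU] := radial_profile mu' ru.
have Ub := radial_pointwise_bound su lu Lw mU uU.
pose h (q : R) := q `^ (alpha / 4) * expR (sigma * U q ^+ 2).
have h0 q : 0 <= h q by rewrite mulr_ge0 ?powR_ge0 ?expR_ge0.
have mh : measurable_fun setT h.
  apply: measurable_funM; first exact: measurable_powR.
  by apply: measurableT_comp => //; apply: measurable_funM => //; exact: measurable_funX.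
have mhE (D : set R) : measurable_fun D (EFin \o h).
  by apply/measurable_EFinP; exact: measurable_funTS.
have -> : adams_functional alpha sigma u = (\int[leb4]_(x in B) (EFin \o h) (quart x))%E.
  apply: ge0_ae_eq_integral => //.
  - apply/measurable_EFinP; apply: measurable_funM.
      have -> : (fun x : R4 R => enorm x `^ alpha) = (fun q => q `^ (alpha / 4)) \o quart.
        by apply/funext => x; rewrite enorm_powR.
      apply: measurable_funTS; apply: measurableT_comp; [exact: measurable_powR|exact: measurable_quart].
    apply: measurableT_comp => //; apply: measurable_funM => //; apply: measurable_funX.
    exact: L2_measurable.
  - apply/measurable_EFinP; apply: measurable_funTS; apply: (measurableT_comp mh);
      exact: measurable_quart.
  - by move=> x _; rewrite lee_fin mulr_ge0 ?powR_ge0 ?expR_ge0.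
  - by move=> x _; rewrite lee_fin.
  - apply: (@filterS _ _ (ae_filter_ringOfSetsType leb4)) uU => x ux Bx.
    by rewrite /= /h ux// enorm_powR.
rewrite ge0_integral_quart_ball//; last by move=> q _; rewrite lee_fin.
rewrite [leRHS]EFinM; apply: lee_wpmul2l; first by rewrite lee_fin ltW.
apply: (@moser_integral w) => //; first lra.
apply: (@filterS _ _ (ae_filter_ringOfSetsType mu)) Ub => q Uq /andP[q0 q1].
have := sqr_le_moser Lw q0 (ltW q1) (Uq _); rewrite q0 q1 => /(_ isT) H.
rewrite lee_fin /h.
have -> : q `^ (alpha / 4) = expR (- (alpha * log_radius q)).
  by rewrite /powR gt_eqF//; congr expR; rewrite /log_radius; field.
have -> : q^-1 = expR (4 * log_radius q).
  by rewrite -[in LHS](lnK (x := q)) ?posrE// -expRN; congr expR; rewrite /log_radius; field.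
rewrite -!expRD ler_expR.
have H2 : sigma * U q ^+ 2 <= (4 + alpha) * (8 * pi ^+ 2 * U q ^+ 2).
  rewrite mulrA; apply: ler_wpM2r; first exact: sqr_ge0.
  by apply: (le_trans sle); rewrite le_eqVlt; apply/orP; left; apply/eqP; field.
have H3 : (4 + alpha) * (8 * pi ^+ 2 * U q ^+ 2) <= (4 + alpha) * (log_radius q - moser_defect w q).
  by apply: ler_wpM2l => //; lra.
move: H2 H3; move: (sigma * _) (log_radius q) (moser_defect w q) ((4 + alpha) * (8 * _ * _)) =>
    x1 x2 x3 x4; lra.
Qed.

End UpperBound.

(** * Sharpness *)

Section Competitors.
Context {R : realType}.
Local Notation leb4 := (@lebesgue4 R).
Local Notation B := (@unit_ball R).
Implicit Types (f : R4 R -> R).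

Lemma test_functionZ (c : R) f : test_function f -> test_function (fun x => c * f x).
Proof.
move=> tf; have -> : (fun x => c * f x) = (fun x => f x * c) by apply/funext => x; rewrite mulrC.
apply: (test_functionM tf); apply/smoothP => n; exact: smoothn_cst.
Qed.

Lemma partialZ (c : R) f i : smooth f -> partial i (fun x => c * f x) = (fun x => c * partial i f x).
Proof.
move=> sf; apply/funext => x; have d := smooth_is_derive i x sf.
by have H := is_deriveZ c d; case: H.
Qed.

Lemma test_function_partials f s : test_function f -> test_function (partials s f).
Proof. by move=> tf; elim: s => //= i s; exact: test_function_partial. Qed.

Lemma test_function_smooth f : test_function f -> smooth f.
Proof. by case. Qed.

Lemma test_function_L2 f : test_function f -> L2 f.
Proof. by move=> /test_function_smooth/smooth_continuous; exact: continuous_L2. Qed.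

(** Each integration by parts moves the outermost derivative of [phi] onto [f], where it becomes the
    innermost; hence the reversed list. *)
Lemma test_function_weak_derivative f s : test_function f -> weak_derivative s f (partials (rev s) f).
Proof.
move=> tf phi tphi; elim: s f tf => [|i s IHs] f tf; first by rewrite expr0 mul1r.
have sphi := test_function_smooth (test_function_partials s tphi).
rewrite /= (Rintegral_by_parts_test i tf sphi) (IHs _ (test_function_partial i tf)).
by rewrite rev_cons /partials -cats1 foldr_cat/= exprS mulN1r mulNr.
Qed.

Let norm2_subrr f : norm2 (f \- f) = 0%E.
Proof.
rewrite norm2E integral0_eq ?poweR0r// => x _ /=.
by rewrite subrr expr0n.
Qed.

Lemma test_function_H2N f : test_function f -> H2N f.
Proof.
move=> tf; split; last first.
  split; first exact: test_function_L2.
  move=> s _; exists (partials (rev s) f); last exact: test_function_weak_derivative.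
  exact/test_function_L2/test_function_partials.
split; first exact: test_function_L2.
exists (fun i => partial i f); split => [i|].
  split; first exact/test_function_L2/test_function_partial.
  exact: (test_function_weak_derivative [:: i]).
exists (fun _ => f); split => // [|i].
  by under eq_fun do rewrite norm2_subrr; exact: cvg_cst.
by under eq_fun do rewrite norm2_subrr; exact: cvg_cst.
Qed.

Lemma test_function_laplacian f : test_function f ->
  laplacian f (fun x => \sum_i partial i (partial i f) x).
Proof.
move=> tf; exists (fun i => partial i (partial i f)); split => // i; split.
  exact/test_function_L2/test_function_partial/test_function_partial.
exact: (test_function_weak_derivative [:: i; i]).
Qed.

Lemma radial_quart (N : R -> R) : radial (fun x => N (quart x)).
Proof.
exists (fun r => N (r ^+ 4)); apply: aeW => x _.
have -> : enorm x ^+ 4 = (enorm x ^+ 2) ^+ 2 by ring.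
by rewrite enorm_quart !sqr_sqrtr ?sqrtr_ge0 ?quart_ge0.
Qed.

Lemma smooth_sum_partial2 f : smooth f -> smooth (fun x => \sum_i partial i (partial i f) x).
Proof.
move=> sf; apply/smoothP => n; apply: smoothn_sum => i.
by apply: (smoothP _).1; apply: smooth_partial; exact: smooth_partial.
Qed.

Lemma Trad_ge_test (alpha sigma : R) f (w : R4 R -> R) : test_function f -> radial f ->
  (forall x, \sum_i partial i (partial i f) x = w x) -> 0 < sqint w ->
  (adams_functional alpha sigma (fun x => ((Num.sqrt (sqint w))^-1 * f x)%R) <= Trad alpha sigma)%E.
Proof.
move=> tf [v rv] fw w0; have sf := test_function_smooth tf.
set c := (Num.sqrt (sqint w))^-1.
have wE : w = (fun x => \sum_i partial i (partial i f) x) by apply/funext.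
have Lw : L2 w by rewrite wE; apply: continuous_L2; apply: smooth_continuous; exact: smooth_sum_partial2.
have tcf := test_functionZ c tf.
apply: ereal_sup_ubound; exists (fun x => c * f x) => //; split.
  split; first exact: test_function_H2N.
  exists (fun r => c * v r).
  by apply: (@filterS _ _ (ae_filter_ringOfSetsType leb4)) rv => x vx Bx; rewrite vx.
exists (fun x => c * w x).
  have -> : (fun x => c * w x) = (fun x => \sum_i partial i (partial i (fun x => c * f x)) x).
    apply/funext => x; rewrite wE mulr_sumr; apply: eq_bigr => i _.
    by rewrite (partialZ c i sf) (partialZ c i (smooth_partial i sf)).
  exact: test_function_laplacian.
rewrite norm2E.
have -> : (\int[leb4]_(x in B) ((c * w x) ^+ 2)%:E = 1)%E; last by rewrite poweR1r.
have -> : (\int[leb4]_(x in B) ((c * w x) ^+ 2)%:E =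
    \int[leb4]_(x in B) ((c ^+ 2)%:E * (w x ^+ 2)%:E))%E.
  by apply: eq_integral => x _; rewrite exprMn EFinM.
rewrite ge0_integralZl//.
- rewrite (sqintE Lw) -EFinM /c exprVn sqr_sqrtr ?sqint_ge0// mulVf// gt_eqF//.
- exact: measurable_unit_ball.
- apply/measurable_EFinP; apply: measurable_funX; exact: L2_measurable.
- by move=> x _; rewrite lee_fin sqr_ge0.
- by rewrite lee_fin sqr_ge0.
Qed.

End Competitors.

(** * The regularized and cut-off logarithm *)

Section MoserFunction.
Context {R : realType}.
Local Notation leb4 := (@lebesgue4 R).
Local Notation B := (@unit_ball R).
Local Notation mu := (@lebesgue_measure R).
Local Notation V := (pi ^+ 2 / 2 : R).

Variable A : R.
Hypotheses (A0 : 0 < A) (A8 : A <= 8^-1).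

Let chi (q : R) : R := 1 - step (4 * q - 1).

Let chi01 q : 0 <= chi q <= 1.
Proof. by rewrite subr_ge0 step_le1 gerBl step_ge0. Qed.

Let chi_1 q : q <= 4^-1 -> chi q = 1.
Proof. by move=> q4; rewrite /chi step_le0 ?subr0//; lra. Qed.

Let chi_0 q : 2^-1 <= q -> chi q = 0.
Proof. by move=> q2; rewrite /chi step_ge1 ?subrr//; lra. Qed.

(* The derivative of the profile: a regularization at scale [A] of [-1/q], that
   is of the profile [-4 ln |x|], cut off away from the boundary. *)
Let n0 (q : R) : R := - chi q / (A + `|q|).

Let n1 (q : R) : R := 4 * dstep (4 * q - 1) / (A + q) + chi q / (A + q) ^+ 2.

(** The Laplacian of [N (quart x)] with [N' = n0] is [sqnorm x] times this function of [quart x]. *)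
Let G (q : R) : R := 16 * q * n1 q + 24 * n0 q.

Let Aq_gt0 q : 0 <= q -> 0 < A + q.
Proof. by move=> q0; rewrite ltr_pwDl. Qed.

Let n0E q : 0 <= q -> n0 q = - chi q / (A + q).
Proof. by move=> q0; rewrite /n0 ger0_norm. Qed.

Let is_derive_shift (q : R) : is_derive q (1 : R) (fun q : R => A + q) 1.
Proof.
have H := is_deriveD (is_derive_cst A q (1 : R)) (is_derive_id q (1 : R)).
by apply: (is_derive_eq H); rewrite add0r.
Qed.

Let is_derive_lin (q : R) : is_derive q (1 : R) (fun q : R => 4 * q - 1) 4.
Proof.
have H := is_deriveB (is_deriveM (is_derive_cst (4 : R) q (1 : R)) (is_derive_id q (1 : R)))
    (is_derive_cst (1 : R) q (1 : R)).
by apply: (is_derive_eq H); rewrite /GRing.scale /=; ring.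
Qed.

Let is_derive_chi (q : R) : is_derive q (1 : R) chi (- (4 * dstep (4 * q - 1))).
Proof.
have H := is_deriveB (is_derive_cst (1 : R) q (1 : R)) (is_derive1_comp (is_derive_step _)
    (is_derive_lin q)).
by apply: (is_derive_eq H); ring.
Qed.

Let continuous_chi : continuous chi.
Proof. by move=> q; apply: differentiable_continuous; apply/derivable1_diffP;
    case: (is_derive_chi q). Qed.

Let continuous_n0 : continuous n0.
Proof.
move=> q; apply: cvgM; first by apply: cvgN; exact: continuous_chi.
apply: cvgV; first by rewrite gt_eqF// ltr_pwDl.
by apply: cvgD; [exact: cvg_cst|exact: norm_continuous].
Qed.

Let is_derive_n1 (q : R) : 0 <= q -> is_derive q (1 : R) (fun q : R => - chi q / (A + q)) (n1 q).
Proof.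
move=> q0; have An0 : A + q != 0 by rewrite gt_eqF// Aq_gt0.
have dA := is_derive_shift q.
have dV : is_derive q (1 : R) (fun q : R => (A + q)^-1) (- (A + q) ^- 2 *: (1 : R)).
  by split; [apply: derivableV => //; case: dA|rewrite deriveV//; case: dA => // _ ->].
have H := is_deriveM (is_deriveN (is_derive_chi q)) dV.
apply: (is_derive_eq H); rewrite /n1 /GRing.scale /=.
have -> : (- chi) q = - chi q by [].
by field.
Qed.

Let M (i : 'I_4) (x : R4 R) : R := - chi (quart x) / (A + quart x) * (4 * sqnorm x * coord4 i x).

Let smoothn_M k i : smoothn k (M i).
Proof.
have sq := smoothn_quart k; have sc c := smoothn_cst k c.
apply: smoothnM.
  apply: smoothnM.
    apply: smoothnN; apply: smoothnB => //; apply: smoothn_step; apply: smoothnB => //.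
    exact: smoothnM.
  apply: smoothnV; last exact: smoothnD.
  by move=> x; rewrite gt_eqF// Aq_gt0// quart_ge0.
apply: smoothnM; last exact: smoothn_coord4.
by apply: smoothnM => //; exact: smoothn_sqnorm.
Qed.

Let partial_M i x : partial i (M i) x =
  n1 (quart x) * (4 * sqnorm x * coord4 i x) ^+ 2 +
  - chi (quart x) / (A + quart x) * (8 * coord4 i x ^+ 2 + 4 * sqnorm x).
Proof.
have dc : is_derive x (basis4 i) (coord4 i) 1 by have := is_derive_coord4 i i x; rewrite eqxx.
have ds := is_derive_sqnorm i x.
have dn := is_derive_chain (is_derive_n1 (quart_ge0 x)) (is_derive_quart i x).
have d4 : is_derive x (basis4 i) (fun x => 4 * sqnorm x * coord4 i x) (4 * sqnorm x +
    8 * coord4 i x ^+ 2).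
  have H := is_deriveM (is_deriveM (is_derive_cst (4 : R) x (basis4 i)) ds) dc.
  apply: (is_derive_eq H); rewrite /GRing.scale /=.
  have -> : (cst 4 * @sqnorm R) x = 4 * sqnorm x by [].
  ring.
have H := is_deriveM dn d4.
case: H => _ H; rewrite /partial; apply: (etrans H).
rewrite /GRing.scale /=; ring.
Qed.

Let w (x : R4 R) : R := sqnorm x * G (quart x).

Let lap_M x : \sum_i partial i (M i) x = w x.
Proof.
under eq_bigr do rewrite partial_M.
have q0 := quart_ge0 x.
transitivity (n1 (quart x) * (16 * sqnorm x ^+ 2) * (\sum_(i < 4) coord4 i x * coord4 i x) +
  - chi (quart x) / (A + quart x) * 8 * (\sum_(i < 4) coord4 i x * coord4 i x) +
  \sum_(i < 4) (- chi (quart x) / (A + quart x) * (4 * sqnorm x))).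
  rewrite !mulr_sumr -!big_split /=; apply: eq_bigr => i _; ring.
rewrite -sqnormE sumr_const card_ord -mulr_natl /w /G n0E//.
have -> : quart x = sqnorm x ^+ 2 by [].
ring.
Qed.

Let w2 x : w x ^+ 2 = quart x * G (quart x) ^+ 2.
Proof. by rewrite /w exprMn. Qed.

Let measurable_qG (D : set R) : measurable_fun D (fun q => (q * G q ^+ 2)%:E).
Proof.
apply/measurable_EFinP; apply: measurable_funTS.
have ml : measurable_fun setT (fun q : R => 4 * q - 1).
  by apply: measurable_funB => //; exact: measurable_funM.
have mAq : measurable_fun setT (fun q : R => (A + q)^-1).
  apply: (measurableT_comp (f := @GRing.inv R)); first exact: measurable_inv.
  exact: measurable_funD.
have mchi : measurable_fun setT chi by exact: continuous_measurable_fun.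
have mn0 : measurable_fun setT n0 by exact: continuous_measurable_fun.
have mn1 : measurable_fun setT n1.
  have -> : n1 = (fun q => 4 * dstep (4 * q - 1) * (A + q)^-1 + chi q * ((A + q)^-1) ^+ 2).
    by apply/funext => q; rewrite /n1 exprVn.
  apply: measurable_funD.
    apply: measurable_funM => //; apply: measurable_funM => //.
    apply: (measurableT_comp _ ml); apply: continuous_measurable_fun; exact: continuous_dstep.
  by apply: measurable_funM => //; exact: measurable_funX.
apply: measurable_funM => //; apply: measurable_funX; apply: measurable_funD.
  by apply: measurable_funM => //; exact: measurable_funM.
exact: measurable_funM.
Qed.

Let sqint_w : (\int[leb4]_(x in B) (w x ^+ 2)%:E = V%:E * \int[mu]_(q in `[0%R,
    1%R[) (q * G q ^+ 2)%:E)%E.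
Proof.
rewrite -ge0_integral_quart_ball//.
- by apply: eq_integral => x _; rewrite w2.
- by move=> q /andP[q0 _]; rewrite lee_fin mulr_ge0// sqr_ge0.
Qed.

(** Without the cutoff, [G] is [- 8 (q + 3 A) / (A + q)^2]. The leading term [64 / (A + q)]
    integrates to the logarithm behind the critical constant, as [64] times the radial constant
    [pi^2 / 2] is [32 pi^2]; the others integrate to bounded quantities. *)
Let qG_inner q : 0 <= q -> q <= 4^-1 ->
  q * G q ^+ 2 = 64 / (A + q) + 192 * A / (A + q) ^+ 2 - 256 * A ^+ 3 / (A + q) ^+ 4.
Proof.
move=> q0 q4; have An0 : A + q != 0 by rewrite gt_eqF// Aq_gt0.
rewrite /G /n1 n0E// (chi_1 q4) (dstep_le0 (y := 4 * q - 1)); last lra.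
by field.
Qed.

Let qG_outer m q : (forall y, @dstep R y <= m) -> 4^-1 <= q -> q <= 1 ->
  q * G q ^+ 2 <= (64 * m + 160) ^+ 2.
Proof.
move=> Hm q4 q1; have q0 : 0 < q by apply: lt_le_trans q4.
have m0 : 0 <= m by exact: le_trans (dstep_ge0 0) (Hm 0).
have Aq := Aq_gt0 (ltW q0); have /andP[c0 c1] := chi01 q.
have d0 := dstep_ge0 (4 * q - 1); have dm := Hm (4 * q - 1).
have V4 : (A + q)^-1 <= 4 by have a0 := A0; rewrite -[leLHS]mulr1 ler_pdivrMl//; lra.
have qV : q / (A + q) <= 1 by rewrite ler_pdivrMr// mul1r lerDr ltW.
have V0 : 0 <= (A + q)^-1 by rewrite invr_ge0 ltW.
have qV0 : 0 <= q / (A + q) by rewrite divr_ge0// ltW.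
have E : G q = 64 * (dstep (4 * q - 1) * (q / (A + q))) + 16 * (chi q * (q / (A + q)) * (A +
    q)^-1) - 24 * (chi q * (A + q)^-1).
  by rewrite /G /n1 n0E ?ltW//; field; rewrite gt_eqF.
have b1 : dstep (4 * q - 1) * (q / (A + q)) <= m * 1 by apply: ler_pM.
have b2 : chi q * (q / (A + q)) * (A + q)^-1 <= 1 * 4.
  by apply: ler_pM => //; [exact: mulr_ge0|exact: mulr_ile1].
have b3 : chi q * (A + q)^-1 <= 1 * 4 by apply: ler_pM.
have b1' : 0 <= dstep (4 * q - 1) * (q / (A + q)) by exact: mulr_ge0.
have b2' : 0 <= chi q * (q / (A + q)) * (A + q)^-1 by apply: mulr_ge0 => //; exact: mulr_ge0.
have b3' : 0 <= chi q * (A + q)^-1 by exact: mulr_ge0.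
(* [64 m + 16 * 4 + 24 * 4], from the three terms of [E]. *)
have Gb : `|G q| <= 64 * m + 160.
  by rewrite ler_norml E; apply/andP; split; lra.
rewrite -[leRHS]mul1r; apply: ler_pM => //; first exact: ltW.
  exact: sqr_ge0.
rewrite -real_normK ?num_real// lerXn2r ?nnegrE//; lra.
Qed.

Let qG_bound m q : (forall y, @dstep R y <= m) -> 0 <= q -> q <= 1 ->
  q * G q ^+ 2 <= 64 / (A + q) + 192 * A / (A + q) ^+ 2 + (64 * m + 160) ^+ 2.
Proof.
move=> Hm q0 q1; have Aq := Aq_gt0 q0.
have p1 : 0 <= 64 / (A + q) by rewrite divr_ge0// ltW.
have p2 : 0 <= 192 * A / (A + q) ^+ 2 by apply: divr_ge0; [apply: mulr_ge0;
    [exact: (ler0n R 192)|exact: ltW]|exact: sqr_ge0].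
have [q4|q4] := leP q 4^-1; last first.
  by have := qG_outer Hm (ltW q4) q1; lra.
have p3 : 0 <= 256 * A ^+ 3 / (A + q) ^+ 4 
  by apply: divr_ge0; [apply: mulr_ge0; [exact: (ler0n R 256)|apply: exprn_ge0;
      exact: ltW]|apply: exprn_ge0; exact: ltW].
by rewrite qG_inner//; have := sqr_ge0 (64 * m + 160); lra.
Qed.

Let primitive (c q : R) : R := 64 * ln (A + q) - 192 * A / (A + q) + c * q.

Let is_derive_primitive (c q : R) : 0 <= q ->
  is_derive q (1 : R) (primitive c) (64 / (A + q) + 192 * A / (A + q) ^+ 2 + c).
Proof.
move=> q0; have Aq := Aq_gt0 q0; have An0 : A + q != 0 by rewrite gt_eqF.
have dA := is_derive_shift q.
have dV : is_derive q (1 : R) (fun q : R => (A + q)^-1) (- (A + q) ^- 2 *: (1 : R)).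
  by split; [apply: derivableV => //; case: dA|rewrite deriveV//; case: dA => // _ ->].
have dl : is_derive q (1 : R) (fun q : R => ln (A + q)) ((A + q)^-1 * 1).
  exact: (is_derive1_comp (is_derive1_ln Aq) dA).
have H := is_deriveD (is_deriveB (is_deriveM (is_derive_cst (64 : R) q (1 : R)) dl)
  (is_deriveM (is_derive_cst (192 * A : R) q (1 : R)) dV)) (is_deriveM (is_derive_cst c q (1 : R))
      (is_derive_id q (1 : R))).
apply: (is_derive_eq H); rewrite /GRing.scale /=.
by field.
Qed.

(** Keeps the norm of the Laplacian away from zero, so that the competitor can be normalized: [8]
    times the length [1 / 8] of the interval already gives [1]. *)
Let qG_ge q : 8^-1 <= q -> q <= 4^-1 -> 8 <= q * G q ^+ 2.
Proof.
move=> q8 q4; have a0 := A0; have a8 := A8; have q0 : 0 <= q by lra.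
have Aq := Aq_gt0 q0; have An0 : A + q != 0 by rewrite gt_eqF.
rewrite qG_inner//; set v := (A + q)^-1; set r := A * v.
have v1 : 1 <= v by rewrite -invr1 lef_pV2 ?posrE//; lra.
have r2 : r <= 2^-1 by rewrite /r ler_pdivrMr//; lra.
have r0 : 0 <= r by rewrite mulr_ge0 ?(ltW A0)// (le_trans _ v1).
have -> : 64 / (A + q) + 192 * A / (A + q) ^+ 2 - 256 * A ^+ 3 / (A + q) ^+ 4 =
    v * (64 + 192 * r - 256 * r ^+ 3).
  by rewrite /r /v; field.
have r3 : r ^+ 3 <= 4^-1 * r.
  have -> : r ^+ 3 = r ^+ 2 * r by ring.
  apply: ler_wpM2r => //; rewrite (_ : 4^-1 = 2^-1 ^+ 2 :> R); last by field.
  by rewrite lerXn2r ?nnegrE.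
have : 1 * 64 <= v * (64 + 192 * r - 256 * r ^+ 3) by apply: ler_pM => //; lra.
lra.
Qed.

Let integral_qG_ge1 : (1 <= \int[mu]_(q in `[0%R, 1%R[) (q * G q ^+ 2)%:E)%E.
Proof.
have e8 : (8 : R)^-1 < 4^-1 by rewrite ltf_pV2 ?posrE//; lra.
apply: (@le_trans _ _ (\int[mu]_(q in `[8^-1%R, 4^-1%R]) (cst 8%:E q))%E).
  rewrite integral_cst//= lebesgue_measure_itv/= lte_fin e8 -EFinB.
  have -> : (1 = 1%:E :> \bar R)%E by [].
  have -> : (8%:E * (4^-1 - 8^-1)%:E = (8 * (4^-1 - 8^-1))%:E :> \bar R)%E by [].
  by rewrite lee_fin; lra.
apply: (@le_trans _ _ (\int[mu]_(q in `[8^-1%R, 4^-1%R]) (q * G q ^+ 2)%:E)%E).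
  apply: ge0_le_integral; [by []|by move=> q _; rewrite lee_fin|exact: measurable_cst|exact:
      measurable_qG|].
  by move=> q; rewrite /= in_itv/= => /andP[q8 q4]; rewrite lee_fin; exact: qG_ge.
apply: ge0_subset_integral => //; first exact: measurable_qG.
  by move=> q; rewrite /= in_itv/= => /andP[q0 _]; rewrite lee_fin mulr_ge0// sqr_ge0.
by move=> q; rewrite /= !in_itv/= => /andP[q8 q4]; apply/andP; split; lra.
Qed.

Let sqint_w_le m : (forall y, @dstep R y <= m) ->
  sqint w <= V * (64 * ln A^-1 + (256 + (64 * m + 160) ^+ 2)).
Proof.
move=> Hm; set c := (64 * m + 160) ^+ 2; have c0 : 0 <= c := sqr_ge0 _.
have V0 : 0 <= V by rewrite divr_ge0// sqr_ge0.
have L0 : 0 <= ln A^-1 by have a0 := A0; have a8 := A8; rewrite ln_ge0// -invr1 lef_pV2 ?posrE//; lra.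
pose g q := 64 / (A + q) + 192 * A / (A + q) ^+ 2 + c.
have cg : {within `[0, 1], continuous g}.
  have -> : g = (fun q => 64 * (A + q)^-1 + 192 * A * ((A + q)^-1 * (A + q)^-1) + c).
    by apply/funext => t; rewrite -expr2 exprVn.
  apply: continuous_in_subspaceT => q; rewrite inE /= in_itv/= => /andP[q0 _].
  have An0 : A + q != 0 by rewrite gt_eqF// Aq_gt0.
  have cA : {for q, continuous (fun q : R => (A + q)^-1)}.
    by apply: cvgV => //; apply: cvgD; [exact: cvg_cst|exact: cvg_id].
  apply: cvgD; last exact: cvg_cst.
  apply: cvgD; first by apply: cvgM; [exact: cvg_cst|exact: cA].
  by apply: cvgM; [exact: cvg_cst|apply: cvgM; exact: cA].
have Ig : (\int[mu]_(q in `[0%R, 1%R]) (g q)%:E = (primitive c 1)%:E - (primitive c 0)%:E)%E.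
  apply: continuous_FTC2 => //.
  - split.
    + by move=> q; rewrite in_itv/= => /andP[q0 _]; case: (is_derive_primitive c (ltW q0)).
    + apply: cvg_at_right_filter; apply: differentiable_continuous; apply/derivable1_diffP.
      by case: (is_derive_primitive c (lexx 0)).
    + apply: cvg_at_left_filter; apply: differentiable_continuous; apply/derivable1_diffP.
      by case: (is_derive_primitive c ler01).
  - by move=> q; rewrite in_itv/= => /andP[q0 _]; rewrite derive1E;
      case: (is_derive_primitive c (ltW q0)).
have Ile : (\int[mu]_(q in `[0%R, 1%R[) (q * G q ^+ 2)%:E <= (64 * ln A^-1 + (256 + c))%:E)%E.
  apply: (@le_trans _ _ (\int[mu]_(q in `[0%R, 1%R]) (q * G q ^+ 2)%:E)%E).
    apply: ge0_subset_integral => //; first exact: measurable_qG.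
      by move=> q; rewrite /= in_itv/= => /andP[q0 _]; rewrite lee_fin mulr_ge0// sqr_ge0.
    by move=> q; rewrite /= !in_itv/= => /andP[-> /ltW].
  apply: (@le_trans _ _ (\int[mu]_(q in `[0%R, 1%R]) (g q)%:E)%E).
    apply: ge0_le_integral => //.
    - by move=> q; rewrite /= in_itv/= => /andP[q0 _]; rewrite lee_fin mulr_ge0// sqr_ge0.
    - exact: measurable_qG.
    - by apply/measurable_EFinP; apply: subspace_continuous_measurable_fun.
    - by move=> q; rewrite /= in_itv/= => /andP[q0 q1]; rewrite lee_fin; exact: qG_bound.
  (* The constant [256] is [64], from [64 ln (1 + A) <= 64], plus [192], from the primitive at
     [0]. *)
  rewrite Ig -EFinB lee_fin /primitive addr0 mulr0 addr0 mulr1.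
  have l1 : ln (A + 1) <= 1.
    apply: (@le_trans _ _ A); last by have a8 := A8; lra.
    by rewrite addrC; apply: le_ln1Dx; rewrite (lt_trans _ A0)// ltrN10.
  have l2 : 0 <= 192 * A / (A + 1).
    by apply: divr_ge0; [apply: mulr_ge0; [exact: (ler0n R 192)|exact: ltW]|exact/ltW/Aq_gt0].
  have l3 : 192 * A / A = 192 by rewrite mulfK// gt_eqF.
  by rewrite l3 lnV ?posrE//; lra.
rewrite /sqint sqint_w; apply: (@le_trans _ _ (fine (V%:E * (64 * ln A^-1 + (256 + c))%:E)%E)).
  apply: fine_le => //; last by apply: lee_wpmul2l => //; rewrite lee_fin.
  rewrite ge0_fin_numE.
    by apply: lte_mul_pinfty; rewrite ?lee_fin//; exact: le_lt_trans Ile (ltry _).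
  apply: mule_ge0; first by rewrite lee_fin.
  by apply: integral_ge0 => q; rewrite /= in_itv/= => /andP[q0 _]; rewrite lee_fin mulr_ge0// sqr_ge0.
by rewrite -EFinM.
Qed.

Lemma moser_function : exists f : R4 R -> R, exists w : R4 R -> R,
  [/\ test_function f, radial f, forall x, \sum_i partial i (partial i f) x = w x,
      0 < sqint w & (forall m, (forall y, @dstep R y <= m) ->
        sqint w <= V * (64 * ln A^-1 + (256 + (64 * m + 160) ^+ 2))) /\
      forall x, quart x <= A -> ln (8 * A)^-1 <= f x].
Proof.
have [N N1 dN] := continuous_antiderivative continuous_n0.
have [sN pN] : smooth (N \o quart) /\ forall i, partial i (N \o quart) = M i.
  by apply: (smooth_quart_comp dN) => // i x; rewrite n0E ?quart_ge0.
have Nout q : 2^-1 <= q -> N q = 0.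
  move=> q2; have q0 : 0 <= q by apply: le_trans q2.
  have [q1|q1] := leP q 1.
    have [c /andP[qc _]] := MVT_ge0 dN q0 q1.
    by rewrite N1 /n0 chi_0 ?oppr0 ?mul0r; [lra|exact: le_trans qc].
  have [c /andP[qc _]] := MVT_ge0 dN ler01 (ltW q1).
  rewrite N1 /n0 chi_0 ?oppr0 ?mul0r; first lra.
  lra.
have Nin q : 0 <= q -> q <= A -> ln (8 * A)^-1 <= N q.
  move=> q0 qA; have a0 := A0; have a8 := A8; have q4 : q <= 4^-1 by lra.
  have N4 : 0 <= N 4^-1.
    have [||c /andP[c4 _]] := @MVT_ge0 R N n0 4^-1 1 dN => //; first lra.
    rewrite N1 sub0r => E; rewrite -oppr_le0 E mulr_le0_ge0//; last lra.
    have c0 : 0 <= c by apply: le_trans c4.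
    have /andP[k0 _] := chi01 c.
    by rewrite n0E// mulNr oppr_le0 divr_ge0// ltW// Aq_gt0.
  (* On [[0, 1/4]] the cutoff is [1], so [N t + ln (A + t)] is constant there. *)
  have dK (t : R) : 0 <= t -> is_derive t (1 : R) (fun t => N t + ln (A + t)) (n0 t + (A + t)^-1).
    move=> t0; have At := Aq_gt0 t0.
    have dA := is_derive_shift t.
    have dl : is_derive t (1 : R) (fun q : R => ln (A + q)) ((A + t)^-1 * 1).
      exact: (is_derive1_comp (is_derive1_ln At) dA).
    by rewrite mulr1 in dl; exact: is_deriveD (dN t t0) dl.
  have [c /andP[qc c4]] := MVT_ge0 dK q0 q4.
  have c0 : 0 <= c by exact: le_trans qc.
  rewrite n0E// chi_1// mulN1r addNr mul0r => /eqP; rewrite subr_eq0 => /eqP E.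
  have -> : N q = N 4^-1 + ln (A + 4^-1) - ln (A + q) by rewrite E addrK.
  have E1 : ln 4^-1 <= ln (A + 4^-1) by rewrite ler_ln ?posrE ?addr_gt0// lerDr ltW.
  have E2 : ln (A + q) <= ln (2 * A) by rewrite ler_ln ?posrE ?mulr_gt0 ?Aq_gt0//; lra.
  have E3 : ln (8 * A)^-1 = ln 4^-1 - ln (2 * A).
    by rewrite -ln_div ?posrE ?mulr_gt0//; congr ln; field; rewrite gt_eqF.
  by rewrite E3; lra.
have tf : test_function (N \o quart).
  apply: (@test_function_quart _ _ 2^-1) => //; first by rewrite invf_lt1//; lra.
  by move=> x qx /=; exact: Nout.
have lapw x : \sum_i partial i (partial i (N \o quart)) x = w x.
  by rewrite -lap_M; apply: eq_bigr => i _; rewrite pN.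
exists (N \o quart), w; split => //.
- exact: radial_quart.
- have Lw : L2 w.
    have -> : w = (fun x => \sum_i partial i (partial i (N \o quart)) x) by apply/funext.
    by apply: continuous_L2; apply: smooth_continuous; exact: smooth_sum_partial2.
  have V0 : 0 < V by rewrite divr_gt0// exprn_gt0// pi_gt0.
  apply: (lt_le_trans V0); rewrite -lee_fin -(sqintE Lw) sqint_w -[leLHS]mule1.
  by apply: lee_wpmul2l; rewrite ?lee_fin ?(ltW V0)//; exact: integral_qG_ge1.
- split; first exact: sqint_w_le.
  by move=> x qA /=; apply: Nin => //; exact: quart_ge0.
Qed.

End MoserFunction.

(** * Divergence above the critical exponent *)

Section Sharpness.
Context {R : realType}.
Local Notation leb4 := (@lebesgue4 R).
Local Notation B := (@unit_ball R).
Local Notation V := (pi ^+ 2 / 2 : R).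

Let mB : measurable (B : set (@measurableTypeR4 R)) := measurable_unit_ball.

Let V0 : 0 < V. Proof. by rewrite divr_gt0// exprn_gt0// pi_gt0. Qed.

(** For [alpha > 0] the weight degenerates at the origin, so only the annulus [A / 2 <= quart x < A]
    is kept, of volume [V A / 2], where the weight is at least its value on the inner sphere. *)
Lemma adams_lower_bound (alpha sigma A b : R) (u : R4 R -> R) : 0 <= alpha -> 0 <= sigma ->
    0 < A -> A < 1 ->
  0 <= b -> continuous u -> (forall x, quart x <= A -> b <= u x ^+ 2) ->
  ((V * (A / 2 * ((A / 2) `^ (alpha / 4) * expR (sigma * b))))%:E <= adams_functional alpha sigma u)%E.
Proof.
move=> a0 s0 A0 A1 b0 cu bu; have A2 : 0 < A / 2 by rewrite divr_gt0.
have A2A : A / 2 < A by lra.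
set K := (A / 2) `^ (alpha / 4) * expR (sigma * b).
have K0 : 0 <= K by rewrite mulr_ge0 ?powR_ge0 ?expR_ge0.
have mu4 : measurable4 R setT u by exact: continuous_measurable4.
have mI (D : set (R4 R)) : measurable4 R D (fun x => enorm x `^ alpha * expR (sigma * u x ^+ 2)).
  apply: measurable_funTS; apply: measurable_funM.
    have -> : (fun x : R4 R => enorm x `^ alpha) = (fun q => q `^ (alpha / 4)) \o quart.
      by apply/funext => x; rewrite enorm_powR.
    apply: measurableT_comp; [exact: measurable_powR|exact: measurable_quart].
  apply: measurableT_comp => //; apply: measurable_funM => //; exact: measurable_funX.
have I0 x : (0%R <= (enorm x `^ alpha * expR (sigma * u x ^+ 2))%:E)%E.
  by rewrite lee_fin mulr_ge0 ?powR_ge0 ?expR_ge0.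
have AB : annulus (A / 2) A `<=` B.
  by move=> x; rewrite unit_ballE /annulus /= => /andP[_ xA]; exact: lt_trans A1.
apply: (@le_trans _ _ (\int[leb4]_(x in annulus (A / 2) A) (enorm x `^ alpha * expR (sigma *
    u x ^+ 2))%:E)%E); last first.
  apply: ge0_subset_integral => //; first exact: measurable_annulus.
  by apply/measurable_EFinP; exact: mI.
have -> : ((V * (A / 2 * K))%:E = \int[leb4]_(x in annulus (A / 2) A) K%:E)%E.
  rewrite (ge0_integral_annulus (h := cst K%:E) (ltW A2))//.
  rewrite integral_cst//= lebesgue_measure_itv/= lte_fin A2A -EFinB.
  have -> : (K%:E * (A - A / 2)%:E = (A / 2 * K)%:E :> \bar R)%E.
    by congr EFin; field.
  by [].
apply: ge0_le_integral => //.
- exact: measurable_annulus.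
- by apply/measurable_EFinP; exact: mI.
- move=> x; rewrite /annulus /= => /andP[Ax xA]; rewrite lee_fin enorm_powR.
  apply: ler_pM; rewrite ?powR_ge0 ?expR_ge0//.
    by apply: ge0_ler_powR; rewrite ?nnegrE ?divr_ge0// ?quart_ge0// ltW.
  by rewrite ler_expR ler_wpM2l// bu// ltW.
Qed.

(** The competitor at scale [A = exp (- l)]. The shift [l - 3] comes from [8 <= exp 3], which bounds
    [ln (1 / (8 A))] below and gives [A <= 1 / 8] when [l >= 3]; the shift [l + 1] comes from
    [exp (- 1) <= 1 / 2], which gives [exp (- (l + 1)) <= A / 2]. *)
Lemma Trad_ge (alpha sigma m l : R) : 0 <= alpha -> 0 <= sigma -> (forall y, @dstep R y <= m) ->
    3 <= l ->
  ((V * expR (- ((l + 1) * (1 + alpha / 4)) +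
     sigma * ((l - 3) ^+ 2 / (V * (64 * l + (256 + (64 * m + 160) ^+ 2))))))%:E <= Trad alpha sigma)%E.
Proof.
move=> a0 s0 Hm l3; set D := 256 + _.
pose A := expR (- l); have A0 : 0 < A := expR_gt0 _.
have e1 : 2 <= expR (1 : R) by apply: le_trans (expR_ge1Dx _); lra.
have e3 : 8 <= expR (3 : R).
  rewrite -[3]mulr1 expRM_natl (_ : 8 = 2 ^+ 3 :> R); last by ring.
  by rewrite lerXn2r ?nnegrE ?expR_ge0.
have A8 : A <= 8^-1.
  rewrite /A expRN lef_pV2 ?posrE ?expR_gt0//; apply: (le_trans e3).
  by rewrite ler_expR.
have [f [w [tf rf fw w0 [wle fA]]]] := moser_function A0 A8.
have sw := wle m Hm; rewrite -/D /A -expRN opprK expRK in sw.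
have D0 : 0 <= D by rewrite addr_ge0 ?ler0n ?sqr_ge0.
have lD : 0 < 64 * l + D by lra.
have S0 : 0 < V * (64 * l + D) by exact: mulr_gt0.
apply: le_trans (Trad_ge_test alpha sigma tf rf fw w0).
have sf : continuous f by apply: smooth_continuous; exact: test_function_smooth.
have l3' : 0 <= l - 3 by lra.
set b := (l - 3) ^+ 2 / _.
have b0 : 0 <= b by rewrite divr_ge0 ?sqr_ge0// ltW.
have Lf x : quart x <= A -> l - 3 <= f x.
  move=> /fA; apply: le_trans; rewrite -{1}(expRK (l - 3)) ler_ln ?posrE ?expR_gt0 ?invr_gt0 ?mulr_gt0//.
  rewrite expRB /A expRN invfM invrK mulrC ler_pM2r ?expR_gt0//.
  by rewrite lef_pV2 ?posrE ?expR_gt0.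
have cu : continuous (fun x => (Num.sqrt (sqint w))^-1 * f x).
  by move=> x; apply: cvgM; [exact: cvg_cst|exact: sf].
have bu x : quart x <= A -> b <= ((Num.sqrt (sqint w))^-1 * f x) ^+ 2.
  move=> /Lf lf; rewrite exprMn exprVn sqr_sqrtr ?sqint_ge0// mulrC /b.
  apply: ler_pM; rewrite ?sqr_ge0 ?invr_ge0 ?(ltW S0)//.
    by rewrite lerXn2r ?nnegrE//; exact: le_trans lf.
  by rewrite lef_pV2 ?posrE.
have A1 : A < 1 by lra.
apply: le_trans (adams_lower_bound a0 s0 A0 A1 b0 cu bu); rewrite lee_fin ler_pM2l//.
have AE : expR (- (l + 1)) <= A / 2.
  rewrite opprD expRD /A ler_wpM2l ?expR_ge0// expRN lef_pV2 ?posrE ?expR_gt0//.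
rewrite expRD mulrA ler_wpM2r ?expR_ge0//.
have -> : expR (- ((l + 1) * (1 + alpha / 4))) = expR (- (l + 1)) * expR (- (l + 1)) `^ (alpha / 4).
  by rewrite -expRM -expRD; congr expR; field.
apply: ler_pM; rewrite ?powR_ge0 ?expR_ge0//.
by apply: ge0_ler_powR; rewrite ?nnegrE ?expR_ge0 ?divr_ge0// ltW.
Qed.

Lemma Trad_lty_le (alpha sigma : R) : 0 < alpha -> 0 < sigma ->
  (Trad alpha sigma < +oo)%E -> sigma <= 32 * pi ^+ 2 * (1 + alpha / 4).
Proof.
move=> a0 s0 Tfin; rewrite leNgt; apply/negP => sgt.
have [m Hm] := @dstep_bounded R; pose D := 256 + (64 * m + 160) ^+ 2.
have D0 : 0 <= D by rewrite addr_ge0 ?ler0n ?sqr_ge0.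
(* As [l] grows, the exponent in [Trad_ge] behaves like [(k - p) l]. Dividing [64 (l - 3)^2] by
   [64 l + D] as polynomials in [l] gives the quotient [l - (D / 64 + 6)] and a positive remainder,
   hence [c]. *)
pose p := 1 + alpha / 4; pose k := sigma / (64 * V); pose c := k * (D / 64 + 6).
have pk : p < k.
  rewrite /k ltr_pdivlMr; last by rewrite mulr_gt0.
  by rewrite (_ : p * _ = 32 * pi ^+ 2 * (1 + alpha / 4))// /p; field.
have T l : 3 <= l -> ((V * (1 + (k - p) * l - p - c))%:E <= Trad alpha sigma)%E.
  move=> l3; apply: le_trans (Trad_ge (ltW a0) (ltW s0) Hm l3).
  rewrite lee_fin ler_pM2l//; apply: le_trans (expR_ge1Dx _).
  rewrite -/D -/p.
  have lD : 0 < 64 * l + D by lra.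
  suff : k * l - c <= sigma * ((l - 3) ^+ 2 / (V * (64 * l + D))) by lra.
  have -> : sigma * ((l - 3) ^+ 2 / (V * (64 * l + D))) = k * (64 * (l - 3) ^+ 2 / (64 * l + D)).
    have E (v d : R) : 0 < v -> 0 < d ->
        sigma * ((l - 3) ^+ 2 / (v * d)) = sigma / (64 * v) * (64 * (l - 3) ^+ 2 / d).
      by move=> v0 d0; field; rewrite !gt_eqF.
    exact: E.
  rewrite /c -mulrBr ler_pM2l; last by rewrite /k divr_gt0// mulr_gt0.
  rewrite ler_pdivlMr//.
  have -> : (l - (D / 64 + 6)) * (64 * l + D) = 64 * l ^+ 2 - 384 * l - D ^+ 2 / 64 - 6 * D by field.
  have -> : 64 * (l - 3) ^+ 2 = 64 * l ^+ 2 - 384 * l + 576 by ring.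
  by have := sqr_ge0 D; lra.
move: Tfin T; case: (Trad alpha sigma) => [r||] // _ T; last first.
  by have := T 3 (lexx _).
pose l := Num.max 3 ((r / V + p + c) / (k - p)).
have := T l; rewrite /l le_max lexx => /(_ isT); rewrite lee_fin -/l leNgt => /negP; apply.
rewrite mulrC -ltr_pdivrMr//.
have : r / V + p + c <= (k - p) * l.
  rewrite -ler_pdivrMl ?subr_gt0// [leLHS]mulrC.
  by rewrite /l le_max lexx orbT.
lra.
Qed.

End Sharpness.

Theorem theorem1 (R : realType) (alpha sigma : R)
    (alpha_gt0 : 0 < alpha) (sigma_gt0 : 0 < sigma) :
  (Trad alpha sigma < +oo)%E <->
  sigma <= 32 * pi ^+ 2 * (1 + alpha / 4).
Proof.
split => [|sle]; first exact: Trad_lty_le.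
apply: le_lt_trans (ltry (pi ^+ 2 / 2 * (expR (4 + alpha) * 768))).
apply: ge_ereal_sup => _ [u [Hu [w lw w1]] <-].
exact: adams_upper_bound (ltW sigma_gt0) sle Hu lw w1.
Qed.
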